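(* Let $\mathcal K$ be a kernel satisfying Assumption (K1) with Lipschitz constant $Q$ and let $M>0$. Suppose $0<\varepsilon\le \exp\{-\max[1,(2M\|\mathcal K\|_1/\|\mathcal K\|_\infty)^2]\}$. Let $\widehat F_{(\widehat\theta,\widehat h)}(x)$ be the estimator produced by the selection rule described in the context. Then for every $f\in\mathbb F_M$, every $\theta^\circ\in\mathbb S^1$, with $F(t)=f(t^\top\theta^\circ)$, every $x\in[-1/2,1/2]^2$ and every $r\ge1$, $$\Big(\mathbb E_F^\varepsilon\big|\widehat F_{(\widehat\theta,\widehat h)}(x)-F(x)\big|^r\Big)^{1/r}\le C_{r,1}(Q,\mathcal K)\sqrt{\frac{\|\mathcal K\|_\infty^4\,\varepsilon^2\ln(1/\varepsilon)}{h^*_{\mathcal K,f}(x^\top\theta^\circ)}}+C_{r,2}(M,Q,\mathcal K)\,\|\mathcal K\|_\infty^2\,\varepsilon\sqrt{\ln(1/\varepsilon)} .$$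
   Context: **Model.** One observes $Y_\varepsilon(dt)=F(t)\,dt+\varepsilon W(dt)$, $t\in\mathcal D=[-1,1]^2$, where $W$ is a Brownian sheet. $\mathbb P_F^\varepsilon,\mathbb E_F^\varepsilon$ denote the law and expectation when the mean function is $F$. The signal is $F(t)=f(t^\top\theta^\circ)$ with $\theta^\circ\in\mathbb S^1$ (unit circle in $\mathbb R^2$) and $f\in\mathbb F_M=\{g:\mathbb R\to\mathbb R:\ \sup_{u\in\mathbb R}|g(u)|\le M\}$; both $f$ and $\theta^\circ$ are unknown. **Assumption (K1).** $\mathcal K:\mathbb R\to\mathbb R$ is symmetric, $\operatorname{supp}\mathcal K\subseteq[-1/2,1/2]$, $\int\mathcal K=1$, and $|\mathcal K(u)-\mathcal K(v)|\le Q|u-v|$ for all $u,v\in\mathbb R$, where $Q>0$. $\|\mathcal K\|_p$ is the $L_p$ norm of $\mathcal K$. Put $K(u,v)=\mathcal K(u)\mathcal K(v)$. **Oracle bandwidth.** For $h\in(0,1]$ and $z,y\in\mathbb R$, $$\Delta_{\mathcal K,f}(h,z)=\sup_{0<\delta\le h}\Big|\tfrac1\delta\int\mathcal K\big(\tfrac{u-z}{\delta}\big)[f(u)-f(z)]\,du\Big|,\qquad \overline\Delta_{\mathcal K,f}(h,y)=\sup_{a>0}\tfrac1{2a}\int_{y-a}^{y+a}\Delta_{\mathcal K,f}(h,z)\,dz,$$ $\Delta^*_{\mathcal K,f}=\max\{\overline\Delta_{\mathcal K,f},\Delta_{\mathcal K,f}\}$, and $$h^*_{\mathcal K,f}(y)=\sup\big\{h\in[\varepsilon^2,1]:\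 \sqrt h\,\Delta^*_{\mathcal K,f}(h,y)\le\|\mathcal K\|_\infty\varepsilon\sqrt{\ln(1/\varepsilon)}\big\}.$$ **Kernel estimators.** For $\theta,\nu\in\mathbb S^1$, $h\in[\varepsilon^2,1]$ let $$E_{(\theta,h)}=\begin{pmatrix}h^{-1}\theta_1&h^{-1}\theta_2\\-\theta_2&\theta_1\end{pmatrix},\qquad \overline E_{(\theta,h)(\nu,h)}=\frac1{2(1+|\nu^\top\theta|)}\begin{pmatrix}h^{-1}(\theta_1+\nu_1)&h^{-1}(\theta_2+\nu_2)\\-(\theta_2+\nu_2)&\theta_1+\nu_1\end{pmatrix},$$ $E_{(\theta,h)(\nu,h)}=\overline E_{(\theta,h)(\nu,h)}$ if $\nu^\top\theta\ge0$ and $E_{(\theta,h)(\nu,h)}=\overline E_{(-\theta,h)(\nu,h)}$ if $\nu^\top\theta<0$. Set $$\widehat F_{(\theta,h)}(x)=\det(E_{(\theta,h)})\int K(E_{(\theta,h)}(t-x))\,Y_\varepsilon(dt),\quad \widehat F_{(\theta,h)(\nu,h)}(x)=\det(E_{(\theta,h)(\nu,h)})\int K(E_{(\theta,h)(\nu,h)}(t-x))\,Y_\varepsilon(dt).$$ **Selection rule** (it uses $r$, $\mathcal K$, $Q$, $\varepsilon$, but neither $M$, $f$ nor $\theta^\circ$). Let $\Lambda(\mathcal K,Q)=8\sqrt{\ln(1+2Q\|\mathcal K\|_\infty)}+50$ and, for $\eta\in(0,1]$, $\mathrm{TH}(\eta)=2\|\mathcal K\|_\infty^2[\Lambda(\mathcal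 K,Q)+\sqrt{4r+2}+1]\,\varepsilon\sqrt{\eta^{-1}\ln(1/\varepsilon)}$. Let $\mathcal H_\varepsilon=\{2^{-k}:k=0,1,\dots\}\cap[\varepsilon^2,1]$ and for $\theta\in\mathbb S^1$, $h\in\mathcal H_\varepsilon$, $$R_{(\theta,h)}(x)=\sup_{\eta\in\mathcal H_\varepsilon,\,\eta\le h}\Big\{\sup_{\nu\in\mathbb S^1}\big|\widehat F_{(\theta,\eta)(\nu,\eta)}(x)-\widehat F_{(\nu,\eta)}(x)\big|-\mathrm{TH}(\eta)\Big\}.$$ Let $\mathcal P(x)=\{(\theta,h)\in\mathbb S^1\times\mathcal H_\varepsilon:R_{(\theta,h)}(x)\le0\}$. If $\mathcal P(x)=\emptyset$ put $\widehat\theta=(1,0)^\top$; otherwise let $\widetilde h=\max\{h:(\theta,h)\in\mathcal P(x)\}$ and let $\widehat\theta$ be any measurable choice of $\theta$ with $(\theta,\widetilde h)\in\mathcal P(x)$. Finally $$\widehat h=\sup\{h\in\mathcal H_\varepsilon:\ |\widehat F_{(\widehat\theta,h)}(x)-\widehat F_{(\widehat\theta,\eta)}(x)|\le\mathrm{TH}(\eta)\ \ \forall\eta\in\mathcal H_\varepsilon,\ \eta\le h\},$$ and the final estimator is $\widehat F(x)=\widehat F_{(\widehat\theta,\widehat h)}(x)$ ($\widehat\theta,\widehat h$ depend on $x$). **Constants.** With $\mathfrak c_q=[\mathbb E(1+|\varsigma|)^q]^{1/q}$, $\varsigma\sim\mathcal N(0,1)$: $C_{r,1}(Q,\mathcal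 K)=8[\Lambda(\mathcal K,Q)+\sqrt{4r+2}+1]+\mathfrak c_r[(2+\sqrt2)\Lambda(\mathcal K,Q)+2]+1$ and $C_{r,2}(M,Q,\mathcal K)=2^{1/r}[2M+\Lambda(\mathcal K,Q)\,\mathfrak c_{2r}]$.
   Formalization: The observation domain is any measurable set containing all kernel windows used at x (e.g. the whole plane or [-2,2]^2), instead of [-1,1]^2: for x in [-1/2,1/2]^2 the windows can leave [-1,1]^2, where no data exist and the estimators are undefined. *)

(* Defs.v *)
(* MathComp-Analysis, over an arbitrary realType R. *)
From HB Require Import structures.
From mathcomp Require Export all_boot all_order all_algebra.
From mathcomp Require Export all_classical all_reals all_analysis.
Export Order.TTheory GRing.Theory Num.Theory.
Export numFieldNormedType.Exports.

Set Implicit Arguments.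
Unset Strict Implicit.
Unset Printing Implicit Defensive.

Local Open Scope classical_set_scope.
Local Open Scope ring_scope.

Section Plane.
Context {R : realType}.

Definition leb2 := ((@lebesgue_measure R) \x (@lebesgue_measure R))%E.

Definition dotp (s t : R * R) : R := s.1 * t.1 + s.2 * t.2.

Definition S1 : set (R * R) := [set t | t.1 ^+ 2 + t.2 ^+ 2 = 1].

Definition mx2 (a b c d : R) : 'M[R]_2 :=
  \matrix_(i < 2, j < 2)
    (if i == 0 then (if j == 0 then a else b) else (if j == 0 then c else d)).

Definition mxact (E : 'M[R]_2) (u : R * R) : R * R :=
  (E 0 0 * u.1 + E 0 1 * u.2, E 1 0 * u.1 + E 1 1 * u.2).

End Plane.

Section WhiteNoise.
Context {d : measure_display} {T : measurableType d} {R : realType}.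
Variable P : probability T R.

(* X ~ N(0, v); [normal_prob 0 0] is not the Dirac mass, whence the case split *)
Definition centered_gaussian (X : T -> R) (v : R) : Prop :=
  forall A : set R, measurable A ->
    P (X @^-1` A) =
    if v == 0 then \d_(0 : R)%R A else normal_prob 0 (Num.sqrt v) A.

(* covariance of the two-sided Brownian motion: min(|a|, |b|) if a and b have
   the same sign, 0 otherwise *)
Definition bm_cov (a b : R) : R := (`|a| + `|b| - `|a - b|) / 2.

Definition sheet_cov (s t : R * R) : R := bm_cov s.1 t.1 * bm_cov s.2 t.2.

Definition brownian_sheet (W : R * R -> {RV P >-> R}) : Prop :=
  forall (n : nat) (a : 'I_n -> R) (t : 'I_n -> R * R),
    centered_gaussian (fun w => \sum_(i < n) a i * W (t i) w)
      (\sum_(i < n) \sum_(j < n) a i * a j * sheet_cov (t i) (t j)).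

Definition box (a b : R * R) : set (R * R) :=
  [set t | a.1 < t.1 <= b.1 /\ a.2 < t.2 <= b.2].

(* A step function is coded by a list of (coefficient, (lower-left corner,
   upper-right corner)). *)
Definition step := seq (R * ((R * R) * (R * R))).

Definition step_wf (s : step) : bool :=
  all (fun p => (p.2.1.1 <= p.2.2.1) && (p.2.1.2 <= p.2.2.2)) s.

Definition step_fun (s : step) (t : R * R) : R :=
  \sum_(p <- s) p.1 * \1_(box p.2.1 p.2.2) t.

Definition box_increment (W : R * R -> T -> R) (a b : R * R) (w : T) : R :=
  W b w - W (a.1, b.2) w - W (b.1, a.2) w + W a w.

Definition step_integral (W : R * R -> T -> R) (s : step) (w : T) : R :=
  \sum_(p <- s) p.1 * box_increment W p.2.1 p.2.2 w.

(* X is (a version of) the Wiener integral of g over D with respect to W *)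
Definition is_wiener_integral (W : R * R -> {RV P >-> R}) (D : set (R * R))
    (g : R * R -> R) (X : {RV P >-> R}) : Prop :=
  exists s : nat -> step,
    [/\ forall n, step_wf (s n),
        (\int[leb2]_t ((g t * \1_D t - step_fun (s n) t) ^+ 2)%:E)%E
          @[n --> \oo] --> 0%E
      & (\int[P]_w ((X w - step_integral W (s n) w) ^+ 2)%:E)%E
          @[n --> \oo] --> 0%E].

(* Y is (a version of) the integral of g over D with respect to the
   observation Y_eps(dt) = F(t) dt + eps W(dt) *)
Definition is_observed_integral (W : R * R -> {RV P >-> R}) (D : set (R * R))
    (eps : R) (F g : R * R -> R) (Y : {RV P >-> R}) : Prop :=
  exists X : {RV P >-> R}, is_wiener_integral W D g X /\
    {ae P, forall w, Y w = \int[leb2]_(t in D) (g t * F t) + eps * X w}.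

End WhiteNoise.

Section Kernel.
Context {R : realType}.
Implicit Types (K f : R -> R) (Q : R).

Definition Lp_norm (p : \bar R) K : R :=
  fine ('N[lebesgue_measure]_p[EFin \o K])%E.

Definition norm_inf K : R := Lp_norm +oo%E K.

Definition K1 K Q : Prop :=
  [/\ forall u, K (- u) = K u,
      closure [set u | K u != 0] `<=` `[- (1 / 2), 1 / 2],
      \int[lebesgue_measure]_u K u = 1,
      0 < Q
    & forall u v, `|K u - K v| <= Q * `|u - v|].

Definition Kprod K (u : R * R) : R := K u.1 * K u.2.

Definition window K (E : 'M[R]_2) (x t : R * R) : R :=
  Kprod K (mxact E (t.1 - x.1, t.2 - x.2)).

(* measurability is implicit in the use of integrals of f *)
Definition FM (M : R) : set (R -> R) :=
  [set f : R -> R | measurable_fun setT f /\ forall u, `|f u| <= M].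

Definition Delta K f (h z : R) : R :=
  sup [set `| delta^-1 * \int[lebesgue_measure]_u
                (K ((u - z) / delta) * (f u - f z)) |
       | delta in [set delta | 0 < delta <= h]].

Definition Delta_bar K f (h y : R) : R :=
  sup [set (2 * a)^-1 * \int[lebesgue_measure]_(z in `[y - a, y + a])
                Delta K f h z
       | a in [set a | 0 < a]].

Definition Delta_star K f (h y : R) : R :=
  Num.max (Delta_bar K f h y) (Delta K f h y).

Definition hstar K f (eps y : R) : R :=
  sup [set h | eps ^+ 2 <= h <= 1 /\
    Num.sqrt h * Delta_star K f h y <= norm_inf K * eps * Num.sqrt (ln (1 / eps))].

End Kernel.

Section Estimator.
Context {R : realType}.
Implicit Types (theta nu : R * R) (h eta eps r Q : R) (K : R -> R).

Definition Emx theta h : 'M[R]_2 :=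
  mx2 (h^-1 * theta.1) (h^-1 * theta.2) (- theta.2) theta.1.

Definition Emx_bar theta nu h : 'M[R]_2 :=
  (2 * (1 + `|dotp nu theta|))^-1 *:
  mx2 (h^-1 * (theta.1 + nu.1)) (h^-1 * (theta.2 + nu.2))
      (- (theta.2 + nu.2)) (theta.1 + nu.1).

Definition Emx2 theta nu h : 'M[R]_2 :=
  if 0 <= dotp nu theta then Emx_bar theta nu h
  else Emx_bar (- theta.1, - theta.2) nu h.

Definition Lambda K Q : R :=
  8 * Num.sqrt (ln (1 + 2 * Q * norm_inf K)) + 50.

Definition TH K Q r eps eta : R :=
  2 * norm_inf K ^+ 2 * (Lambda K Q + Num.sqrt (4 * r + 2) + 1) *
  eps * Num.sqrt (eta^-1 * ln (1 / eps)).

Definition Heps eps : set R :=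
  [set h | (exists k : nat, h = 2 ^- k) /\ eps ^+ 2 <= h <= 1].

(* In the rest of this section [y E] stands for the realized value of
   the integral of K(E(t - x)) with respect to Y_eps(dt). *)
Implicit Types (y : 'M[R]_2 -> R).

Definition Fhat_mx y (E : 'M[R]_2) : R := \det E * y E.
Definition Fhat y theta h : R := Fhat_mx y (Emx theta h).
Definition Fhat2 y theta nu h : R := Fhat_mx y (Emx2 theta nu h).

Definition Rstat K Q r eps y theta h : \bar R :=
  ereal_sup
    [set (ereal_sup [set `|Fhat2 y theta nu eta - Fhat y nu eta|%:E | nu in S1]
            - (TH K Q r eps eta)%:E)%E
     | eta in [set eta | Heps eps eta /\ eta <= h]].

Definition Padm K Q r eps y : set ((R * R) * R) :=
  [set p | [/\ S1 p.1, Heps eps p.2 & (Rstat K Q r eps y p.1 p.2 <= 0)%E]].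

Definition selected_direction K Q r eps y theta : Prop :=
  (Padm K Q r eps y = set0 -> theta = (1, 0)) /\
  (Padm K Q r eps y !=set0 ->
     exists htilde,
       Padm K Q r eps y (theta, htilde) /\
       forall p, Padm K Q r eps y p -> p.2 <= htilde).

Definition hhat K Q r eps y theta : R :=
  sup [set h | Heps eps h /\
         forall eta, Heps eps eta -> eta <= h ->
           `|Fhat y theta h - Fhat y theta eta| <= TH K Q r eps eta].

(* The observation domain D contains every kernel window used at x, so that the
   estimators integrate over their whole window. For x in [-1/2, 1/2]^2 and K
   supported in [-1/2, 1/2], the windows always lie in [-2, 2]^2, because
   Emx_bar stretches a window by up to 2 along the direction; they lie in
   [-1, 1]^2 only for K of smaller support or x close to 0. *)
Definition windows_observed K eps (x : R * R) (D : set (R * R)) : Prop :=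
  forall theta nu h t, S1 theta -> S1 nu -> Heps eps h ->
    (window K (Emx theta h) x t != 0 -> D t) /\
    (window K (Emx2 theta nu h) x t != 0 -> D t).

End Estimator.

Section Constants.
Context {R : realType}.
Implicit Types (q r M Q : R) (K : R -> R).

Definition gauss_c q : R :=
  (\int[normal_prob (0 : R) 1]_z ((1 + `|z|) `^ q)) `^ q^-1.

Definition C1 r Q K : R :=
  8 * (Lambda K Q + Num.sqrt (4 * r + 2) + 1) +
  gauss_c r * ((2 + Num.sqrt 2) * Lambda K Q + 2) + 1.

Definition C2 r M Q K : R :=
  2 `^ r^-1 * (2 * M + Lambda K Q * gauss_c (2 * r)).

End Constants.

(* Main.v *)
(** Every window matrix is [Emx p h], where [p] is either a direction or the
    half-sum of two directions divided by [1 + |nu . theta|]. Up to noise, the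
    corresponding estimator is a double average of [f] around [x . theta0],
    with step [al] of order [h] along one axis and a step [be] along the other
    which does not depend on [h]; averaging the one-dimensional bias over the
    second axis bounds the effect of [al] by the maximal function
    [Delta_star]. Both estimators compared in the selection rule at
    [(theta0, nu)] have the same [be], so their difference is small.

    The noise is controlled uniformly in [p] and [h] by chaining over dyadic
    grids: the exponential moments of the squared Gaussian links, weighted and
    summed over all grids, form one variable [V] of mean at most 2 such that
    [V <= exp u] implies that the normalised noise is at most
    [2 |K|^2 sqrt (u + entropy)]. On [V <= eps ^ (- r)] the thresholds dominate
    the noise, the pair ([theta0], oracle bandwidth) is admissible and
    Lepski's comparison of the selected pair with it gives the first term.
    Outside, the error is of order [sqrt (ln V)], whose [r]-th power is at
    most a multiple of [V * eps ^ r]; integrating gives the second term. *)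

Require Import Defs.
From HB Require Import structures.
From mathcomp Require Import measurable_realfun ess_sup_inf hoelder ring lra zify.

Set Implicit Arguments.
Unset Strict Implicit.
Unset Printing Implicit Defensive.

Local Open Scope classical_set_scope.
Local Open Scope ring_scope.

(** * Integration *)

(** Measurability and uncountable suprema shape the argument. The measurability of the risk
    integrand is not established, so the integrand is bounded pointwise by an affine function of the
    measurable [V], and only this bound is computed. The directions form a continuum, while each
    observed integral is tied to the sheet only up to a null set of its own; moment bounds are
    therefore taken on countable grids, and the almost sure continuity of [Y] carries them to all
    parameters. As this continuity is given on invertible matrices, [sqnorm p] is kept away from 0:
    for a half-sum window it is [1 / (2 (1 + |nu . theta|))], at least 1/4.

    The Gaussian input is a single estimate, [E exp (3/8 Z^2) <= 2] for centered [Z] of variance at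
    most 1. Apart from the mean of [V], the rest concerns one realization.

    A half-sum window has steps up to [2 h], so the oracle bandwidth must control the bias at [2 h];
    together with dyadic rounding this costs a factor 4 against [hstar]. *)

Section integral_facts.
Context d (T : measurableType d) (R : realType) (mu : {measure set T -> \bar R}).
Local Open Scope ereal_scope.
Import HBNNSimple.

(** The integral of a nonnegative function is a supremum over the simple functions below it, hence
    monotone for arbitrary functions. It serves for functions such as [Delta] and the risk
    integrand, whose measurability is not established. *)
Lemma ge0_le_integral_nomeas (D : set T) (f g : T -> \bar R) :
  (forall x, D x -> 0 <= f x) -> (forall x, D x -> f x <= g x) ->
  \int[mu]_(x in D) f x <= \int[mu]_(x in D) g x.
Proof.
move=> f0 fg.
have g0 x : D x -> 0 <= g x by move=> Dx; exact: le_trans (f0 x Dx) (fg x Dx).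
rewrite !ge0_integralE//; apply: le_ereal_sup => _ [h hf <-].
exists h => // x; apply: le_trans (hf x) _; rewrite /patch.
by case: ifPn => // /set_mem; exact: fg.
Qed.

(* On a null set the majorant is modified to be infinite. *)
Lemma ge0_le_integral_ae (f g : T -> \bar R) :
  (forall x, 0 <= f x) -> measurable_fun setT g -> (forall x, 0 <= g x) ->
  {ae mu, forall x, f x <= g x} ->
  \int[mu]_x f x <= \int[mu]_x g x.
Proof.
move=> f0 mg g0 [N [mN N0 fgN]].
pose i x : \bar R := +oo * (\1_N x)%:E.
have i0 x : 0 <= i x by rewrite /i indicE; case: (x \in N); rewrite ?mule1 ?mule0.
have mi : measurable_fun setT i.
  by apply: measurable_funeM; exact/measurable_EFinP/measurable_indic.
apply: (@le_trans _ _ (\int[mu]_x (g x + i x))).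
  apply: ge0_le_integral_nomeas => // x _.
  have [xN|xN] := boolP (x \in N).
    by rewrite /i indicE xN mule1 addey ?leey// gt_eqF// (lt_le_trans _ (g0 x)).
  rewrite /i indicE (negbTE xN) mule0 adde0.
  by apply: contrapT => h; move: xN; rewrite notin_setE; apply; exact: fgN.
rewrite ge0_integralD// [X in _ + X](_ : _ = 0) ?adde0//.
rewrite /i ge0_integralZl//; last exact/measurable_EFinP/measurable_indic.
by rewrite integral_indic// setIT N0 mule0.
Qed.

End integral_facts.

Section affine.
Context {R : realType}.
Notation mu := (@lebesgue_measure R).
Local Open Scope ereal_scope.

Lemma measurable_affine (a b : R) : measurable_fun setT (fun t : R => (a * t + b)%R).
Proof. by apply: measurable_funD => //; exact: measurable_funM. Qed.

(** The pushforward under the affine map, scaled by [|a|], is a measure that agrees with Lebesgue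
    measure on half-open intervals, which determine it. For [a < 0] the preimage is closed at the
    other end, with the same length. *)
Lemma lebesgue_measure_affine (a b : R) (A : set R) : a != 0%R -> measurable A ->
  mu A = (`|a|%R%:E * mu ((fun t : R => (a * t + b)%R) @^-1` A)).
Proof.
move=> a0 mA.
have ma : measurable_fun setT
    ((fun t => (a * t + b)%R) : measurableTypeR R -> measurableTypeR R).
  exact: measurable_affine.
pose aff : {mfun measurableTypeR R >-> measurableTypeR R} :=
  HB.pack (fun t : R => (a * t + b)%R) (isMeasurableFun.Build _ _ _ _ _ ma).
pose nu : {measure set (measurableTypeR R) -> \bar R} :=
  measure_function_pushforward__canonical__measure_function_Measure mu ma.
suff : forall X, ocitv X -> mu X = mscale (NngNum (normr_ge0 a)) nu X.
  by move=> /lebesgue_measure_unique; exact.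
move=> _ [[u v]/= _ <-].
rewrite /mscale/= /pushforward lebesgue_measure_itv/= lte_fin.
have [a_gt0|a_lt0] : (0 < a \/ a < 0)%R by move: a0; rewrite neq_lt => /orP[]; [right|left].
- have -> : aff @^-1` `]u, v] = `]((u - b) / a)%R, ((v - b) / a)%R]%classic.
    apply/seteqP; split => t /=; rewrite !in_itv/= ltr_pdivrMr// ler_pdivlMr//.
      by move=> /andP[? ?]; apply/andP; split; lra.
    by move=> /andP[? ?]; apply/andP; split; lra.
  rewrite lebesgue_measure_itv/= lte_fin ltr_pM2r ?invr_gt0// ltrD2r.
  case: ifPn; rewrite ?mule0// => _; rewrite -EFinB -EFinM; congr EFin.
  by rewrite gtr0_norm//; field.
- have -> : aff @^-1` `]u, v] = `[((v - b) / a)%R, ((u - b) / a)%R[%classic.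
    apply/seteqP; split => t /=; rewrite !in_itv/= ltr_ndivlMr// ler_ndivrMr//.
      by move=> /andP[? ?]; apply/andP; split; lra.
    by move=> /andP[? ?]; apply/andP; split; lra.
  rewrite lebesgue_measure_itv/= lte_fin ltr_nM2r ?invr_lt0// ltrD2r.
  case: ifPn; rewrite ?mule0// => _; rewrite -EFinB -EFinM; congr EFin.
  by rewrite ltr0_norm//; field.
Qed.

Lemma ge0_integral_affine (a b : R) (f : R -> \bar R) : a != 0%R ->
  measurable_fun setT f -> (forall t, 0 <= f t) ->
  \int[mu]_t f (a * t + b)%R = (`|a|^-1)%R%:E * \int[mu]_t f t.
Proof.
move=> a0 mf f0.
have ma : measurable_fun setT
    ((fun t => (a * t + b)%R) : measurableTypeR R -> measurableTypeR R).
  exact: measurable_affine.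
pose aff : {mfun measurableTypeR R >-> measurableTypeR R} :=
  HB.pack (fun t : R => (a * t + b)%R) (isMeasurableFun.Build _ _ _ _ _ ma).
pose nu : {measure set (measurableTypeR R) -> \bar R} :=
  measure_function_pushforward__canonical__measure_function_Measure mu ma.
have -> : \int[mu]_t f t = `|a|%R%:E * \int[nu]_t f t.
  rewrite -(@ge0_integral_mscale _ _ _ nu _ measurableT (NngNum (normr_ge0 a)))//.
  apply: eq_measure_integral => A mA _.
  exact: lebesgue_measure_affine.
rewrite muleA -EFinM mulVf ?normr_eq0// mul1e.
by rewrite (ge0_integral_pushforward ma).
Qed.

End affine.

Section linear_change_of_variables.
Context {R : realType}.
Notation mu := (@lebesgue_measure R).
Implicit Types (a b c d e g : R) (phi : R * R -> \bar R).

Definition aff2 a b c d e g (t : R * R) : R * R :=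
  (a * t.1 + b * t.2 + e, c * t.1 + d * t.2 + g).

Lemma measurable_aff2 a b c d e g : measurable_fun setT (aff2 a b c d e g).
Proof.
apply: measurable_fun_pair => /=;
  by apply: measurable_funD => //; apply: measurable_funD => //;
     apply: measurable_funM => //; exact: measurableT_comp.
Qed.

Local Open Scope ereal_scope.

(** For [a = 0] the map exchanges the axes and each variable is substituted separately. Otherwise
    one step of Gaussian elimination factors it: a substitution of slope [a] in the first variable
    leaves a shear whose second variable has slope [m], the determinant divided by [a]. *)
Lemma ge0_integral_aff2 a b c d e g phi : (a * d - b * c)%R != 0%R ->
  measurable_fun setT phi -> (forall t, 0 <= phi t) ->
  \int[leb2]_t phi (aff2 a b c d e g t) =
  (`|a * d - b * c|^-1)%R%:E * \int[leb2]_t phi t.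
Proof.
move=> D0 mphi phi0.
have mT := measurable_aff2 a b c d e g.
have m1 (f : R -> R) (h : R -> R) : measurable_fun setT f -> measurable_fun setT h ->
    measurable_fun setT (fun s => phi (f s, h s)).
  by move=> mf mh; apply: (measurableT_comp mphi); exact: measurable_fun_pair.
rewrite fubini_tonelli2//; last exact: measurableT_comp mphi mT.
have [a0|a0] := eqVneq a 0%R.
- rewrite a0 mul0r sub0r.
  have [b0 c0] : (b != 0 /\ c != 0)%R.
    by move: D0; rewrite a0 mul0r sub0r oppr_eq0 mulf_eq0 negb_or => /andP[].
  under eq_integral => y _.
    rewrite /fubini_G/= /aff2/=.
    under eq_integral => x _ do rewrite mul0r add0r -addrA.
    rewrite (@ge0_integral_affine _ c (d * y + g)%R (fun v => phi (b * y + e, v)%R))//; last exact: m1.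
    over.
  have mF : measurable_fun setT (fubini_F mu phi) by exact: measurable_fun_fubini_tonelli_F.
  have F0 x : 0 <= fubini_F mu phi x by apply: integral_ge0.
  rewrite ge0_integralZl//=.
  + rewrite (@ge0_integral_affine _ b e (fubini_F mu phi))// muleA -EFinM.
    by rewrite -invfM normrN normrM -fubini_tonelli1// mulrC.
  + by apply: (measurableT_comp mF); exact: measurable_affine.
  + by move=> x _; apply: integral_ge0.
- pose m := ((a * d - b * c) / a)%R.
  have m0 : m != 0%R by rewrite mulf_neq0// invr_eq0.
  pose phi' := phi \o aff2 1 0 (c / a) m 0 (g - c / a * e).
  have mphi' : measurable_fun setT phi' by apply: measurableT_comp mphi _; exact: measurable_aff2.
  have phi'0 t : 0 <= phi' t by exact: phi0.
  transitivity (\int[mu]_y (`|a|^-1%R%:E * fubini_G mu phi' y)).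
    apply: eq_integral => y _; rewrite /fubini_G.
    rewrite -(@ge0_integral_affine _ a (b * y + e)%R (fun x => phi' (x, y)))//; last first.
      by apply: (measurableT_comp mphi'); exact: measurable_fun_pair.
    apply: eq_integral => x _; rewrite /phi'/= /aff2/=; congr phi; congr pair.
      by ring.
    by rewrite /m; field.
  rewrite ge0_integralZl//=; last 2 first.
    exact: measurable_fun_fubini_tonelli_G.
    by move=> x _; apply: integral_ge0.
  rewrite -fubini_tonelli2// fubini_tonelli1//.
  transitivity (`|a|^-1%R%:E * \int[mu]_x (`|m|^-1%R%:E * fubini_F mu phi x)).
    congr (_ * _); apply: eq_integral => x _; rewrite /fubini_F.
    rewrite -(@ge0_integral_affine _ m (c / a * x + (g - c / a * e))%R (fun y => phi (x, y)))//; last exact: m1.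
    apply: eq_integral => y _; rewrite /phi'/= /aff2/=; congr phi; congr pair.
      by ring.
    by ring.
  have -> : \int[mu]_x ((`|m|^-1)%R%:E * fubini_F mu phi x) =
      (`|m|^-1)%R%:E * \int[mu]_x fubini_F mu phi x.
    apply: ge0_integralZl => //.
      exact: measurable_fun_fubini_tonelli_F.
    by move=> x _; apply: integral_ge0.
  rewrite -fubini_tonelli1// muleA -EFinM -invfM -normrM.
  by congr ((`|_|^-1)%R%:E * _); rewrite /m; field.
Qed.

End linear_change_of_variables.

(** * Gaussian vectors and the Wiener integral *)

Section density.
Context d (T : measurableType d) (R : realType).
Variables (mu nu : {measure set T -> \bar R}) (p : T -> R).
Local Open Scope ereal_scope.
Import HBNNSimple.
Hypotheses (mp : measurable_fun setT p) (p0 : forall x, (0 <= p x)%R)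
  (nup : forall A, measurable A -> nu A = \int[mu]_(x in A) (p x)%:E).

Let density_nnsfun (h : {nnsfun T >-> R}) :
  \int[nu]_x (h x)%:E = \int[mu]_x ((h x)%:E * (p x)%:E).
Proof.
have mA r : measurable (h @^-1` [set r]) by exact: measurable_sfunP.
have hr0 r x : (0 <= r * \1_(h @^-1` [set r]) x)%R by exact: nnfun_muleindic_ge0.
rewrite integral_nnsfun// patch_setT sintegralE.
transitivity (\int[mu]_x (\sum_(r \in range h) (r * \1_(h @^-1` [set r]) x)%:E * (p x)%:E)).
  rewrite ge0_integral_fsum//; last 2 first.
  - move=> r; apply: emeasurable_funM; apply/measurable_EFinP => //.
    exact: measurable_funM.
  - by move=> r x _; rewrite mule_ge0// lee_fin.
  apply: eq_fsbigr => r /[!inE] -[x _ hx].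
  have r0 : (0 <= r)%R by rewrite -hx.
  under eq_integral do rewrite EFinM -muleA.
  rewrite ge0_integralZl//; last 2 first.
  - by apply: emeasurable_funM; apply/measurable_EFinP.
  - by move=> y _; rewrite mule_ge0// lee_fin.
  rewrite nup// integral_mkcond; congr (_ * _); apply: eq_integral => y _.
  by rewrite patchE indicE; case: ifPn; rewrite ?mul1e ?mul0e.
apply: eq_integral => x _; rewrite fimfunE -fsumEFin// ge0_mule_fsuml//.
by move=> r; rewrite lee_fin.
Qed.

Lemma ge0_integral_density (f : T -> \bar R) :
  measurable_fun setT f -> (forall x, 0 <= f x) ->
  \int[nu]_x f x = \int[mu]_x (f x * (p x)%:E).
Proof.
move=> mf f0.
pose f_ := nnsfun_approx measurableT mf.
transitivity (limn (fun n => \int[nu]_x (f_ n x)%:E)).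
  rewrite -monotone_convergence//.
  - by apply: eq_integral => y _; apply/esym/cvg_lim => //; exact: cvg_nnsfun_approx.
  - by move=> n; exact/measurable_EFinP/measurable_funP.
  - by move=> n y _; rewrite lee_fin.
  - by move=> y _ m n mn; rewrite lee_fin; exact/lefP/nd_nnsfun_approx.
under eq_fun do rewrite density_nnsfun.
rewrite -monotone_convergence//; last 3 first.
- by move=> n; apply: emeasurable_funM; apply/measurable_EFinP => //; exact: measurable_funP.
- by move=> n y _; rewrite mule_ge0// lee_fin.
- move=> y _ m n mn; rewrite lee_wpmul2r ?lee_fin//; exact/lefP/nd_nnsfun_approx.
apply: eq_integral => y _; apply/cvg_lim => //.
by apply: cvgeZr => //; exact: cvg_nnsfun_approx.
Qed.

End density.

Section gaussian_moment.
Context {R : realType}.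
Local Open Scope ereal_scope.

Lemma ge0_integral_normal_prob (s : R) (f : R -> \bar R) :
  measurable_fun setT f -> (forall x, 0 <= f x) ->
  \int[normal_prob 0%R s]_z f z =
  \int[lebesgue_measure]_z (f z * (normal_pdf 0 s z)%:E).
Proof.
move=> mf f0; apply: ge0_integral_density => //.
- exact: measurable_normal_pdf.
- by move=> x; exact: normal_pdf_ge0.
Qed.

(* The weight [3/8 < 1/2] turns N(0, v) into a multiple of N(0, s^2) with [1 / s^2 = 1 / v - 3 / 4]. *)
Lemma normal_expsq_le2 (v : R) : (0 < v <= 1)%R ->
  \int[normal_prob 0%R (Num.sqrt v)]_z (expR (3 / 8 * z ^+ 2))%:E <= 2.
Proof.
move=> /andP[v0 v1].
have mf : measurable_fun [set: R] (fun z : R => (expR (3 / 8 * z ^+ 2))%:E).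
  apply/measurable_EFinP; apply: measurableT_comp => //.
  by apply: measurable_funM => //; exact: measurable_funX.
rewrite ge0_integral_normal_prob//.
pose s2 : R := (v / (1 - 3 / 4 * v))%R.
have den : (0 < 1 - 3 / 4 * v)%R by lra.
have s20 : (0 < s2)%R by rewrite divr_gt0.
pose s := Num.sqrt s2.
have s_neq0 : s != 0%R by rewrite gt_eqF// sqrtr_gt0.
have sv_neq0 : Num.sqrt v != 0%R by rewrite gt_eqF// sqrtr_gt0.
pose k : R := (normal_peak (Num.sqrt v) / normal_peak s)%R.
have ps0 := normal_peak_gt0 s_neq0.
rewrite (_ : (fun z => _) = (fun z => k%:E * (normal_pdf 0 s z)%:E)); last first.
  apply/funext => z; rewrite -!EFinM /normal_pdf (negbTE s_neq0) (negbTE sv_neq0) /normal_fun /k.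
  rewrite mulrCA -expRD [in RHS]mulrA divfK ?gt_eqF//; congr ((_ * expR _)%:E).
  rewrite !sqr_sqrtr ?ltW// subr0 /s2.
  by field; rewrite !gt_eqF//; lra.
rewrite ge0_integralZl//; last 3 first.
- by apply/measurable_EFinP; exact: measurable_normal_pdf.
- by move=> x _; rewrite lee_fin normal_pdf_ge0.
- by rewrite lee_fin divr_ge0 ?normal_peak_ge0.
have pi0 := pi_gt0 R.
have vpi : (0 <= v * pi *+ 2)%R by rewrite mulrn_wge0// mulr_ge0 ?ltW.
have spi : (0 <= s2 * pi *+ 2)%R by rewrite mulrn_wge0// mulr_ge0 ?ltW.
(* What remains is the ratio of the two peaks, the square root of [s2 / v = 1 / (1 - 3/4 v)]; this
   quotient is at most 4 for [v <= 1]. *)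
rewrite integral_normal_pdf mule1 lee_fin /k /normal_peak invrK mulrC.
rewrite (sqr_sqrtr (ltW v0)) (sqr_sqrtr (ltW s20)) -sqrtrV// -sqrtrM//.
rewrite -[leRHS](@ger0_norm _ 2)// -[leRHS]sqrtr_sqr ler_sqrt; last by rewrite exprn_ge0.
rewrite (_ : (_ / _)%R = (1 - 3 / 4 * v)^-1%R); last first.
  have -> (q a b : R) : (q != 0)%R -> (b != 0)%R -> (a * q *+ 2 / (b * q *+ 2) = a / b)%R.
    by move=> q0 b0; field; rewrite q0 b0.
  - by rewrite /s2 mulrAC divff ?mul1r// gt_eqF.
  - by rewrite gt_eqF.
  - by rewrite gt_eqF.
rewrite -[leRHS]invrK lef_pV2 ?posrE ?invr_gt0 ?exprn_gt0//.
by rewrite -(@ler_pM2r _ (2 ^+ 2)) ?exprn_gt0// mulVf ?expf_neq0//; lra.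
Qed.

End gaussian_moment.

(** * Wiener isometry for step functions *)

Section steps.
Context {R : realType}.
Implicit Types (s : @step R) (p q : R * ((R * R) * (R * R))).

Definition overlap (a b a' b' : R) : R := Num.max 0 (Num.min b b' - Num.max a a').

(** The distances to the origin cancel, leaving half of [|a - b'| + |b - a'| - |b - b'| - |a - a'|],
    which is the length of the intersection of the two intervals. *)
Lemma bm_cov_increments (a b a' b' : R) : a <= b -> a' <= b' ->
  bm_cov b b' - bm_cov b a' - bm_cov a b' + bm_cov a a' = overlap a b a' b'.
Proof.
move=> ab ab'; rewrite /bm_cov /overlap.
have -> : (`|b| + `|b'| - `|b - b'|) / 2 - (`|b| + `|a'| - `|b - a'|) / 2 -
    (`|a| + `|b'| - `|a - b'|) / 2 + (`|a| + `|a'| - `|a - a'|) / 2 =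
    (`|a - b'| + `|b - a'| - `|b - b'| - `|a - a'|) / 2 by ring.
have [h1|h1] := leP 0 (a - b'); have [h2|h2] := leP 0 (b - a');
have [h3|h3] := leP 0 (b - b'); have [h4|h4] := leP 0 (a - a');
rewrite ?(ger0_norm h1) ?(ger0_norm h2) ?(ger0_norm h3) ?(ger0_norm h4)
  ?(ltr0_norm h1) ?(ltr0_norm h2) ?(ltr0_norm h3) ?(ltr0_norm h4);
rewrite /Order.max /Order.min; do !case: ifPn; lra.
Qed.

End steps.

Section steps.
Context {R : realType}.
Implicit Types (s : @step R) (p q : R * ((R * R) * (R * R))).

Lemma boxE (a b : R * R) : box a b = `]a.1, b.1] `*` `]a.2, b.2].
Proof. by apply/seteqP; split=> t /=; rewrite !in_itv. Qed.

Lemma measurable_box (a b : R * R) : measurable (box a b).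
Proof. by rewrite boxE; exact: measurableX. Qed.

Lemma leb2_boxI (a b a' b' : R * R) :
  leb2 (box a b `&` box a' b') =
  (overlap a.1 b.1 a'.1 b'.1 * overlap a.2 b.2 a'.2 b'.2)%:E.
Proof.
have I (u v u' v' : R) : `]u, v]%classic `&` `]u', v'] =
    `]Num.max u u', Num.min v v']%classic.
  apply/seteqP; split=> t /=; rewrite !in_itv/= gt_max le_min.
    by move=> [/andP[-> ->] /andP[-> ->]].
  by move=> /andP[/andP[-> ->] /andP[-> ->]].
have L (u v : R) : lebesgue_measure (`]u, v] : set R) = (Num.max 0 (v - u))%:E.
  rewrite lebesgue_measure_itv/= lte_fin; case: ltP => uv.
    by rewrite -EFinB max_r// subr_ge0 ltW.
  by rewrite max_l// subr_le0.
rewrite !boxE -setXI !I /leb2 product_measure1E//.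
by rewrite EFinM -!L.
Qed.

Lemma integral_leb2_boxI (a b a' b' : R * R) :
  (\int[leb2]_t (\1_(box a b `&` box a' b') t)%:E =
  (overlap a.1 b.1 a'.1 b'.1 * overlap a.2 b.2 a'.2 b'.2)%:E)%E.
Proof.
rewrite integral_indic; [|exact: measurableT|]; last first.
  by apply: measurableI; exact: measurable_box.
by rewrite (@setIT (R * R)%type); exact: leb2_boxI.
Qed.

Lemma measurable_step_fun s : measurable_fun setT (step_fun s).
Proof.
rewrite /step_fun; apply: measurable_sum => p; apply: measurable_funM => //.
apply: measurable_indic. exact: measurable_box.
Qed.

(** At once the area of the intersection of two boxes and the covariance of the increments of the
    sheet over them. This coincidence is the isometry between step functions and their integrals. *)
Definition box_cov p q : R :=
  overlap p.2.1.1 p.2.2.1 q.2.1.1 q.2.2.1 * overlap p.2.1.2 p.2.2.2 q.2.1.2 q.2.2.2.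

Lemma integral_step_fun_sq s :
  (\int[leb2]_t ((step_fun s t) ^+ 2)%:E)%E =
  (\sum_(p <- s) \sum_(q <- s) p.1 * q.1 * box_cov p q)%:E.
Proof.
have mB p q : measurable (box p.2.1 p.2.2 `&` box q.2.1 q.2.2).
  by apply: measurableI; exact: measurable_box.
pose F p q t : \bar R := ((p.1 * q.1)%:E * (\1_(box p.2.1 p.2.2 `&` box q.2.1 q.2.2) t)%:E)%E.
have I p q : (@leb2 R).-integrable setT
    (EFin \o \1_(box p.2.1 p.2.2 `&` box q.2.1 q.2.2)).
  apply/integrableP; split.
    by apply/measurable_EFinP; apply: measurable_indic; exact: mB.
  under eq_integral do rewrite /= ger0_norm//.
  by rewrite integral_leb2_boxI ltry.
have iF p q : (@leb2 R).-integrable setT (F p q).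
  by apply: integrableZl; [exact: measurableT|exact: I].
transitivity (\int[leb2]_t (\sum_(p <- s) \sum_(q <- s) F p q t))%E.
  apply: eq_integral => t _; rewrite expr2 /step_fun mulr_suml -sumEFin.
  apply: eq_bigr => p _; rewrite mulr_sumr -sumEFin.
  apply: eq_bigr => q _; rewrite /F indicI /= -EFinM; congr EFin.
  by rewrite mulrACA.
rewrite integral_sum//; last by move=> p; apply: integrable_sum => //; exact: measurableT.
rewrite -sumEFin; apply: eq_bigr => p _.
rewrite integral_sum// -sumEFin; apply: eq_bigr => q _.
rewrite /box_cov EFinM -integral_leb2_boxI.
by apply: integralZl; [exact: measurableT|exact: I].
Qed.

End steps.

Section sheet.
Context {d : measure_display} {T : measurableType d} {R : realType}.
Variables (P : probability T R) (W : R * R -> {RV P >-> R}).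
Hypothesis hW : brownian_sheet W.
Implicit Types (s : @step R) (l : seq (R * (R * R))).

Lemma sheet_gaussian_seq l :
  centered_gaussian P (fun w => \sum_(p <- l) p.1 * W p.2 w)
    (\sum_(p <- l) \sum_(q <- l) p.1 * q.1 * sheet_cov p.2 q.2).
Proof.
have := hW (fun i => (tnth (in_tuple l) i).1) (fun i => (tnth (in_tuple l) i).2).
rewrite (_ : (fun w => _) = fun w => \sum_(p <- l) p.1 * W p.2 w); last first.
  by apply/funext => w; rewrite [RHS]big_tnth.
congr centered_gaussian; rewrite [RHS]big_tnth; apply: eq_bigr => i _.
by rewrite [RHS]big_tnth.
Qed.

Definition corners (p : R * ((R * R) * (R * R))) : seq (R * (R * R)) :=
  [:: (p.1, p.2.2); (- p.1, (p.2.1.1, p.2.2.2)); (- p.1, (p.2.2.1, p.2.1.2));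
      (p.1, p.2.1)].

Lemma step_integral_gaussian s : step_wf s ->
  centered_gaussian P (step_integral (fun t => W t) s)
    (\sum_(p <- s) \sum_(q <- s) p.1 * q.1 * box_cov p q).
Proof.
move=> /allP wfs.
have := sheet_gaussian_seq (flatten [seq corners p | p <- s]).
rewrite (_ : (fun w => _) = step_integral (fun t => W t) s); last first.
  apply/funext => w; rewrite big_flatten/= big_map; apply: eq_bigr => p _.
  by rewrite /corners !big_cons big_nil /box_increment/=; ring.
congr centered_gaussian.
rewrite big_flatten/= big_map; apply: eq_big_seq => -[c [[a1 a2] [b1 b2]]] /wfs/= /andP[ab1 ab2].
under eq_bigr do rewrite big_flatten/= big_map.
rewrite exchange_big/=; apply: eq_big_seq => -[c' [[a1' a2'] [b1' b2']]] /wfs/= /andP[ab1' ab2'].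
(* The sixteen signed corner terms of a pair of boxes factor into one increment of [bm_cov] per
   axis. *)
rewrite /box_cov/= -!bm_cov_increments// /corners !big_cons !big_nil /sheet_cov/=.
ring.
Qed.

Lemma measurable_step_integral s :
  measurable_fun setT (step_integral (fun t => W t) s).
Proof.
rewrite /step_integral; apply: measurable_sum => p; apply: measurable_funM => //.
by rewrite /box_increment; apply: measurable_funD => //; apply: measurable_funB => //; apply: measurable_funB.
Qed.

Lemma centered_gaussian_expsq (X : T -> R) v : measurable_fun setT X ->
  centered_gaussian P X v -> 0 <= v <= 1 ->
  (\int[P]_w (expR (3 / 8 * X w ^+ 2))%:E <= 2)%E.
Proof.
move=> mX gX /andP[v0 v1].
have mf : measurable_fun [set: R] (fun z : R => (expR (3 / 8 * z ^+ 2))%:E).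
  apply/measurable_EFinP; apply: measurableT_comp => //.
  by apply: measurable_funM => //; exact: measurable_funX.
have mX' : measurable_fun setT (X : T -> measurableTypeR R) by exact: mX.
pose X' : {mfun T >-> measurableTypeR R} := HB.pack X (isMeasurableFun.Build _ _ _ _ _ mX').
have -> : (\int[P]_w (expR (3 / 8 * X w ^+ 2))%:E =
    \int[distribution P X']_z (expR (3 / 8 * z ^+ 2))%:E)%E.
  by rewrite ge0_integral_distribution.
have [v_eq0|v_neq0] := eqVneq v 0.
  rewrite (@eq_measure_integral _ _ _ _ \d_((0 : R) : measurableTypeR R)); last first.
    by move=> A mA _; rewrite /= /distribution /pushforward gX// v_eq0 eqxx.
  by rewrite integral_dirac// diracE in_setT mul1e expr0n/= mulr0 expR0 lee_fin ler1n.
rewrite (@eq_measure_integral _ _ _ _ (normal_prob 0 (Num.sqrt v))); last first.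
  by move=> A mA _; rewrite /= /distribution /pushforward gX// (negbTE v_neq0).
by apply: normal_expsq_le2; rewrite lt_neqAle eq_sym v_neq0 v0.
Qed.

Lemma step_integral_expsq s : step_wf s ->
  (\int[leb2]_t ((step_fun s t) ^+ 2)%:E <= 1)%E ->
  (\int[P]_w (expR (3 / 8 * step_integral (fun t => W t) s w ^+ 2))%:E <= 2)%E.
Proof.
move=> wfs s1.
apply: (centered_gaussian_expsq (measurable_step_integral s) (step_integral_gaussian wfs)).
rewrite -!lee_fin -integral_step_fun_sq s1 andbT.
by apply: integral_ge0 => t _; rewrite lee_fin sqr_ge0.
Qed.

End sheet.

Section square_mean.
Context d (T : measurableType d) (R : realType) (mu : {measure set T -> \bar R}).
Implicit Types (u v z : nat -> T -> R).
Local Open Scope ereal_scope.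

Lemma measurable_sq (X : T -> R) : measurable_fun setT X ->
  measurable_fun setT (fun x => (X x ^+ 2)%:E).
Proof. by move=> mX; apply/measurable_EFinP; exact: measurable_funX. Qed.

Lemma integral_sq_le_comb (x y z : T -> R) (a b : R) :
  measurable_fun setT x -> measurable_fun setT y -> (0 <= a)%R -> (0 <= b)%R ->
  (forall t, (z t ^+ 2 <= a * x t ^+ 2 + b * y t ^+ 2)%R) ->
  \int[mu]_t (z t ^+ 2)%:E <=
  a%:E * \int[mu]_t (x t ^+ 2)%:E + b%:E * \int[mu]_t (y t ^+ 2)%:E.
Proof.
move=> mx my a0 b0 zxy.
have sq0 (w : T -> R) t : 0 <= (w t ^+ 2)%:E by rewrite lee_fin sqr_ge0.
rewrite -!ge0_integralZl//; [|exact: measurable_sq|exact: measurable_sq].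
rewrite -ge0_integralD//; last 4 first.
- by move=> t _; rewrite mule_ge0.
- by apply: measurable_funeM; exact: measurable_sq.
- by move=> t _; rewrite mule_ge0.
- by apply: measurable_funeM; exact: measurable_sq.
apply: ge0_le_integral_nomeas => // t _.
by rewrite -!EFinM -EFinD lee_fin.
Qed.

Lemma cvg_integral_sq_comb u v z (a b : R) :
  (forall n, measurable_fun setT (u n)) -> (forall n, measurable_fun setT (v n)) ->
  (0 <= a)%R -> (0 <= b)%R ->
  (forall n t, (z n t ^+ 2 <= a * u n t ^+ 2 + b * v n t ^+ 2)%R) ->
  \int[mu]_t (u n t ^+ 2)%:E @[n --> \oo] --> 0 ->
  \int[mu]_t (v n t ^+ 2)%:E @[n --> \oo] --> 0 ->
  \int[mu]_t (z n t ^+ 2)%:E @[n --> \oo] --> 0.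
Proof.
move=> mu_ mv a0 b0 zuv u0 v0.
have : a%:E * \int[mu]_t (u n t ^+ 2)%:E + b%:E * \int[mu]_t (v n t ^+ 2)%:E @[n --> \oo] --> 0.
  rewrite (_ : 0 = a%:E * 0 + b%:E * 0); last by rewrite !mule0 adde0.
  apply: cvgeD; [by rewrite !mule0|exact: cvgeZl|exact: cvgeZl].
apply: squeeze_cvge; last exact: cvg_cst.
apply: nearW => n; rewrite integral_ge0/=; last by move=> t _; rewrite lee_fin sqr_ge0.
exact: integral_sq_le_comb.
Qed.

(* A subsequence along which the square errors are summable converges almost everywhere. *)
Lemma L2_cvg_ae_subseq (X : T -> R) (Xn : nat -> T -> R) :
  measurable_fun setT X -> (forall n, measurable_fun setT (Xn n)) ->
  \int[mu]_t ((X t - Xn n t) ^+ 2)%:E @[n --> \oo] --> 0 ->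
  exists phi : nat -> nat, (forall k, (k <= phi k)%N) /\
    {ae mu, forall t, Xn (phi k) t @[k --> \oo] --> X t}.
Proof.
move=> mX mXn XnX.
have mD n : measurable_fun setT (fun t => (X t - Xn n t)%R) by exact: measurable_funB.
have sel k : exists n, (k <= n)%N /\
    \int[mu]_t ((X t - Xn n t) ^+ 2)%:E <= (1 / (2 ^ k.+1)%:R)%:E.
  have e0 : (0 < 1 / (2 ^ k.+1)%:R :> R)%R by rewrite divr_gt0// ltr0n expn_gt0.
  have /fine_cvgP[fin_near /cvgrPdist_le/(_ _ e0) small] := XnX.
  have [n] := @filter_ex _ (\oo)%classic _ _ (filterI (nbhs_infty_ge k) (filterI fin_near small)).
  move=> [kn [finn smalln]]; exists n; split=> //.
  rewrite -(fineK finn) lee_fin; apply: le_trans smalln.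
  by rewrite sub0r normrN ler_norm.
have [phi phiP] := choice sel.
exists phi; split; first by move=> k; have [] := phiP k.
pose a k t : \bar R := ((X t - Xn (phi k) t) ^+ 2)%:E.
have a0 k t : 0 <= a k t by rewrite lee_fin sqr_ge0.
have ma k : measurable_fun setT (a k) by exact: measurable_sq.
have : mu.-integrable setT (fun t => \sum_(0 <= k <oo) a k t).
  apply/integrableP; split.
    by apply: ge0_emeasurable_sum.
  under eq_integral do rewrite gee0_abs ?nneseries_ge0//.
  rewrite integral_nneseries//.
  apply: (@le_lt_trans _ _ 1); last exact: ltry.
  apply: le_trans (@epsilon_trick0 R 1 xpredT ler01).
  apply: lee_nneseries => k *; first by apply: integral_ge0.
  by have [] := phiP k.
move=> /(integrable_ae measurableT); apply: filterS => t /(_ I) fint.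
have cvs : cvgn (series (fun k => (X t - Xn (phi k) t) ^+ 2)%R).
  apply: nnseries_is_cvg; first by move=> k; exact: sqr_ge0.
  by rewrite ltey_eq fint.
have /cvgrPdist_le c0 := cvg_series_cvg_0 cvs.
apply/cvgrPdist_le => e e0.
have e2 : (0 < e ^+ 2)%R by rewrite exprn_gt0.
apply: filterS (c0 _ e2) => k.
by rewrite sub0r normrN ger0_norm ?sqr_ge0// -real_normK ?num_real// ler_pXn2r ?nnegrE// ltW.
Qed.

End square_mean.

Section wiener.
Context {d : measure_display} {T : measurableType d} {R : realType}.
Variables (P : probability T R) (W : R * R -> {RV P >-> R}).
Hypothesis hW : brownian_sheet W.
Variable D : set (R * R).

(** A copy of [is_wiener_integral] for a bare function [X], so that linear combinations need not be
    packed as random variables. *)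
Definition wiener_limit (g : R * R -> R) (X : T -> R) : Prop :=
  exists s : nat -> step,
    [/\ forall n, step_wf (s n),
        (\int[leb2]_t ((g t * \1_D t - step_fun (s n) t) ^+ 2)%:E)%E
          @[n --> \oo] --> 0%E
      & (\int[P]_w ((X w - step_integral (fun t => W t) (s n) w) ^+ 2)%:E)%E
          @[n --> \oo] --> 0%E].

Let step_scale (a : R) (s : @step R) : @step R := [seq (a * p.1, p.2) | p <- s].

Lemma wiener_limit_lincomb (a b : R) (g1 g2 : R * R -> R) (X1 X2 : T -> R) :
  measurable_fun setT (fun t => g1 t * \1_D t) ->
  measurable_fun setT (fun t => g2 t * \1_D t) ->
  measurable_fun setT X1 -> measurable_fun setT X2 ->
  wiener_limit g1 X1 -> wiener_limit g2 X2 ->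
  wiener_limit (fun t => a * g1 t + b * g2 t) (fun w => a * X1 w + b * X2 w).
Proof.
move=> mg1 mg2 mX1 mX2 [s1 [wf1 sg1 sX1]] [s2 [wf2 sg2 sX2]].
have sq (x y : R) : (a * x + b * y) ^+ 2 <= 2 * a ^+ 2 * x ^+ 2 + 2 * b ^+ 2 * y ^+ 2.
  have := sqr_ge0 (a * x - b * y); nra.
exists (fun n => step_scale a (s1 n) ++ step_scale b (s2 n)); split.
- by move=> n; rewrite /step_wf all_cat !all_map; apply/andP; split; [exact: wf1|exact: wf2].
- apply: (cvg_integral_sq_comb (a := 2 * a ^+ 2) (b := 2 * b ^+ 2) _ _ _ _ _ sg1 sg2).
  + by move=> n; apply: measurable_funB => //; exact: measurable_step_fun.
  + by move=> n; apply: measurable_funB => //; exact: measurable_step_fun.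
  + by rewrite mulr_ge0// sqr_ge0.
  + by rewrite mulr_ge0// sqr_ge0.
  + move=> n t; apply: le_trans (sq _ _); rewrite le_eqVlt; apply/orP; left; apply/eqP.
    rewrite /step_fun big_cat/= !big_map/=; congr (_ ^+ 2).
    under eq_bigr do rewrite -mulrA.
    under [X in _ - (_ + X)]eq_bigr do rewrite -mulrA.
    by rewrite -!mulr_sumr; ring.
- apply: (cvg_integral_sq_comb (a := 2 * a ^+ 2) (b := 2 * b ^+ 2) _ _ _ _ _ sX1 sX2).
  + by move=> n; apply: measurable_funB => //; exact: measurable_step_integral.
  + by move=> n; apply: measurable_funB => //; exact: measurable_step_integral.
  + by rewrite mulr_ge0// sqr_ge0.
  + by rewrite mulr_ge0// sqr_ge0.
  + move=> n t; apply: le_trans (sq _ _); rewrite le_eqVlt; apply/orP; left; apply/eqP.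
    rewrite /step_integral big_cat/= !big_map/=; congr (_ ^+ 2).
    under eq_bigr do rewrite -mulrA.
    under [X in _ - (_ + X)]eq_bigr do rewrite -mulrA.
    by rewrite -!mulr_sumr; ring.
Qed.

(** Fatou along an almost surely convergent subsequence passes the moment bound from the step
    integrals to their limit. The strict bound on the norm of [g] leaves room for nearby step
    functions to have norm at most 1. *)
Lemma wiener_limit_expsq (g : R * R -> R) (X : T -> R) :
  measurable_fun setT (fun t => g t * \1_D t) -> measurable_fun setT X ->
  wiener_limit g X -> (\int[leb2]_t ((g t * \1_D t) ^+ 2)%:E < 1)%E ->
  (\int[P]_w (expR (3 / 8 * X w ^+ 2))%:E <= 2)%E.
Proof.
move=> mg mX [s [wfs sg sX]] g1.
have mS n := @measurable_step_integral _ _ _ P W (s n).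
have mE (Z : T -> R) : measurable_fun setT Z ->
    measurable_fun setT (fun w => (expR (3 / 8 * Z w ^+ 2))%:E).
  move=> mZ; apply/measurable_EFinP; apply: measurableT_comp => //.
  by apply: measurable_funM => //; exact: measurable_funX.
have [N bound] : exists N, forall n, (N <= n)%N ->
    (\int[leb2]_t ((step_fun (s n) t) ^+ 2)%:E <= 1)%E.
  set v : \bar R := (\int[leb2]_t ((g t * \1_D t) ^+ 2)%:E)%E in g1 *.
  have v0 : (0 <= v)%E by apply: integral_ge0 => t _; rewrite lee_fin sqr_ge0.
  have [w vw] : exists w, v = w%:E.
    by exists (fine v); rewrite fineK// ge0_fin_numE// (lt_trans g1)// ltry.
  move: g1 v0; rewrite vw lte_fin lee_fin => w1 w0.
  (* Half the available gap. By Young, [y^2 <= (1 + dl) x^2 + (1 + 1/dl) (x - y)^2]; the error [e]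
     is chosen to make the last term contribute [dl], so the total is at most [w + 2 dl = 1]. *)
  pose dl : R := (1 - w) / 2.
  have dl0 : 0 < dl by rewrite /dl; lra.
  pose e : R := dl / (1 + dl^-1).
  have dlV0 : 0 < dl^-1 by rewrite invr_gt0.
  have e0 : 0 < e by rewrite divr_gt0// addr_gt0.
  have /fine_cvgP[[N1 _ finN] /cvgrPdist_le/(_ _ e0)[N2 _ small]] := sg.
  exists (maxn N1 N2) => n; rewrite geq_max => /andP[/finN fin_n /small small_n].
  have := @integral_sq_le_comb _ _ _ (@leb2 R) _ _ (step_fun (s n)) (1 + dl) (1 + dl^-1)
    mg (measurable_funB mg (measurable_step_fun (s n))).
  move=> /(_ _ _ _)/le_trans; apply.
  - by rewrite addr_ge0// ltW.
  - by rewrite addr_ge0// ltW.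
  - move=> t /=; set x := g t * _; set y := step_fun _ _.
    have -> : (1 + dl) * x ^+ 2 + (1 + dl^-1) * (x - y) ^+ 2 =
        y ^+ 2 + dl^-1 * (dl * x + (x - y)) ^+ 2.
      by field; rewrite gt_eqF.
    by rewrite lerDl mulr_ge0 ?sqr_ge0// ltW.
  rewrite -/v vw -(fineK fin_n) -!EFinM -EFinD lee_fin.
  have {small_n} : fine (\int[leb2]_t ((g t * \1_D t - step_fun (s n) t) ^+ 2)%:E)%E <= e.
    by apply: le_trans small_n; rewrite sub0r normrN ler_norm.
  move=> /(ler_wpM2l (ltW (addr_gt0 ltr01 dlV0))) h.
  have : (1 + dl^-1) * e = dl by rewrite /e mulrC divfK// gt_eqF// addr_gt0.
  move=> he; rewrite he in h.
  have dlE : 1 = w + 2 * dl by rewrite /dl; field.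
  have : dl * w <= dl by rewrite ler_piMr ?ltW.
  rewrite mulrDl mul1r; lra.
have [phi [phik aephi]] := L2_cvg_ae_subseq mX mS sX.
pose F n w : \bar R := (expR (3 / 8 * step_integral (fun t => W t) (s (phi n)) w ^+ 2))%:E.
have mF n : measurable_fun setT (F n) by exact: mE.
have F0 n w : (0 <= F n w)%E by rewrite lee_fin expR_ge0.
apply: (@le_trans _ _ (\int[P]_w limn_einf (F ^~ w))%E).
  apply: ge0_le_integral_ae.
  - by move=> w; rewrite lee_fin expR_ge0.
  - apply: (emeasurable_fun_cvg (fun n w => einfs (F ^~ w) n)).
      by move=> n; exact: measurable_fun_einfs.
    by move=> w _; rewrite limn_einf_lim; exact: is_cvg_einfs.
  - move=> w; rewrite limn_einf_lim; apply: lime_ge; first exact: is_cvg_einfs.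
    by apply: nearW => n; apply: le_ereal_inf_tmp => _ [k _ <-].
  apply: filterS aephi => w cw.
  have : F n w @[n --> \oo] --> (expR (3 / 8 * X w ^+ 2))%:E.
    apply: cvg_EFin; first by apply: nearW.
    apply: continuous_cvg; first exact: continuous_expR.
    by apply: cvgMr; under eq_fun do rewrite expr2; apply: cvgM.
  by move=> /cvg_limn_einf_sup[-> _].
apply: le_trans (fatou P measurableT mF _) _; first by move=> n w _; exact: F0.
rewrite limn_einf_lim; apply: lime_le; first exact: is_cvg_einfs.
exists N => // n Nn; apply: ereal_inf_le; exists (\int[P]_w F n w)%E; first by exists n => /=.
apply: step_integral_expsq => //.
by apply: bound; exact: leq_trans Nn (phik n).
Qed.

End wiener.

(** * The kernel and the bias of directional averages *)

Section kernel.
Context {R : realType}.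
Variables (K : R -> R) (Q : R).
Hypothesis hK : K1 K Q.
Notation mu := (@lebesgue_measure R).

Lemma kernel_even u : K (- u) = K u. Proof. by case: hK. Qed.

Lemma kernel_lip u v : `|K u - K v| <= Q * `|u - v|. Proof. by case: hK. Qed.

Lemma lip_gt0 : 0 < Q. Proof. by case: hK. Qed.

Lemma kernel_out u : 1 / 2 < `|u| -> K u = 0.
Proof.
case: hK => _ supp _ _ _ u2; apply/eqP/negPn/negP => Ku.
have : `[- (1 / 2), 1 / 2]%classic u by apply/supp/subset_closure.
by rewrite /= in_itv/= => /andP[? ?]; move: u2; rewrite ltNge ler_norml => /negP; apply; apply/andP.
Qed.

Lemma kernel_continuous : continuous K.
Proof.
move=> u; apply/cvgrPdist_le => e e0.
have /cvgrPdist_le idu : v @[v --> u] --> u by exact: cvg_id.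
have Q0 := lip_gt0.
have /idu : 0 < Q^-1 * e by rewrite mulr_gt0// invr_gt0.
apply: filterS => v uv; apply: le_trans (kernel_lip _ _) _.
by rewrite -ler_pdivlMl.
Qed.

Lemma measurable_kernel : measurable_fun setT K.
Proof. apply: continuous_measurable_fun. exact: kernel_continuous. Qed.

Let kernel_le_lip u : `|K u| <= 3 / 2 * Q.
Proof.
have Q0 := lip_gt0.
have [u2|u2] := ltP (1 / 2) `|u|.
  by rewrite kernel_out// normr0 mulr_ge0// ltW.
(* The point 1 lies outside the support and within 3/2 of each of its points. *)
have K1 : K 1 = 0 by apply: kernel_out; rewrite normr1; lra.
rewrite -[K u]subr0 -K1; apply: le_trans (kernel_lip _ _) _.
rewrite mulrC ler_wpM2r ?(ltW Q0)//.
by move: u2; rewrite ler_norml => /andP[? ?]; rewrite ler_norml; apply/andP; split; lra.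
Qed.

Let norm_infE : (ess_sup mu (abse \o (EFin \o K)) = (norm_inf K)%:E)%E.
Proof.
have mu0 : (0 < mu setT)%E.
  apply: (@lt_le_trans _ _ (mu (ball 0 1))).
    by rewrite lebesgue_measure_ball// lte_fin.
  by apply: le_measure; rewrite ?inE//; exact: measurable_ball.
rewrite /norm_inf /Lp_norm unlock mu0 fineK// fin_numElt; apply/andP; split.
  apply: (@lt_le_trans _ _ 0%E); first exact: ltNyr.
  by apply: ess_sup_gee => //; apply: nearW => u /=.
apply: (@le_lt_trans _ _ (3 / 2 * Q)%:E); last exact: ltry.
by apply/ess_supP; apply: nearW => u /=; rewrite lee_fin.
Qed.

Lemma norm_inf_le_lip : norm_inf K <= 3 / 2 * Q.
Proof.
by rewrite -lee_fin -norm_infE; apply/ess_supP; apply: nearW => u /=; rewrite lee_fin.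
Qed.

(** Continuity turns the essential supremum into a pointwise bound: a strict excess at one point
    would persist on a ball, which has positive measure. *)
Lemma kernel_le u : `|K u| <= norm_inf K.
Proof.
rewrite leNgt; apply/negP => Ku.
have : {ae mu, forall u, (abse \o (EFin \o K)) u <= (norm_inf K)%:E}%E.
  by rewrite -norm_infE; exact: ess_sup_ge.
move=> [N [mN N0 subN]].
have cK : continuous (fun v => `|K v|).
  by move=> v; apply: continuous_comp; [exact: kernel_continuous|exact: norm_continuous].
have /nbhs_ballP[e e0 ball_e] : nbhs u [set v | norm_inf K < `|K v|].
  exact: (cvgr_gt _ (cK u) _ Ku).
have : (mu (ball u e) <= mu N)%E.
  apply: le_measure; rewrite ?inE//; first exact: measurable_ball.
  by move=> v /ball_e/= Kv; apply: subN => /=; rewrite lee_fin leNgt Kv.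
by rewrite N0 (lebesgue_measure_ball _ (ltW e0)) lee_fin leNgt pmulrn_rgt0// e0.
Qed.

Lemma norm_inf_ge0 : 0 <= norm_inf K.
Proof. exact: le_trans (normr_ge0 _) (kernel_le 0). Qed.

Let ind (u : R) : R := \1_`[- (1 / 2), 1 / 2]%classic u.

Lemma kernel_le_indic u : `|K u| <= norm_inf K * ind u.
Proof.
have [u2|u2] := ltP (1 / 2) `|u|.
  by rewrite kernel_out// normr0 mulr_ge0 ?norm_inf_ge0.
rewrite /ind indicE mem_set ?mulr1 ?kernel_le//.
by rewrite /= in_itv/= -ler_norml.
Qed.

Let integral_ind (c : R) : 0 <= c -> (\int[mu]_u (c * ind u)%:E)%E = c%:E.
Proof.
move=> c0; under eq_integral do rewrite EFinM.
rewrite ge0_integralZl//; last 2 first.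
- exact/measurable_EFinP/measurable_indic.
- by move=> u _; rewrite lee_fin /ind indicE.
rewrite integral_indic// setIT /= lebesgue_measure_itv/= lte_fin ifT; last by lra.
by rewrite -EFinB -EFinM; congr EFin; lra.
Qed.

Lemma integral_abs_kernel_le : (\int[mu]_u `|K u|%:E <= (norm_inf K)%:E)%E.
Proof.
rewrite -[leRHS]integral_ind ?norm_inf_ge0//.
by apply: ge0_le_integral_nomeas => u _; rewrite lee_fin// kernel_le_indic.
Qed.

Lemma integrable_kernel : mu.-integrable setT (EFin \o K).
Proof.
apply/integrableP; split; first by apply/measurable_EFinP; exact: measurable_kernel.
by apply: le_lt_trans integral_abs_kernel_le _; exact: ltry.
Qed.

Lemma Lp_norm1_kernel : (\int[mu]_u `|K u|%:E)%E = (Lp_norm 1%E K)%:E.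
Proof.
rewrite /Lp_norm Lnorm1 fineK// ge0_fin_numE; last exact: integral_ge0.
by apply: le_lt_trans integral_abs_kernel_le _; exact: ltry.
Qed.

Lemma Lp_norm1_kernel_le : Lp_norm 1%E K <= norm_inf K.
Proof. by rewrite -lee_fin -Lp_norm1_kernel; exact: integral_abs_kernel_le. Qed.

Lemma Lp_norm1_kernel_ge0 : 0 <= Lp_norm 1%E K.
Proof. by rewrite -lee_fin -Lp_norm1_kernel; apply: integral_ge0. Qed.

(** Unit mass on a support of length 1 forces [1 <= |K|_1 <= |K|_oo]. Powers of [norm_inf K] can
    therefore be raised freely in upper bounds. *)
Lemma norm_inf_ge1 : 1 <= norm_inf K.
Proof.
case: hK => _ _ intK _ _; rewrite -intK.
apply: le_trans (Lp_norm1_kernel_le); rewrite -lee_fin -Lp_norm1_kernel.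
rewrite /Rintegral fineK; last exact: (integrable_fin_num measurableT integrable_kernel).
apply: le_integral => //; first exact: integrable_kernel.
  exact: (integrable_abse integrable_kernel).
by move=> u _; rewrite /= lee_fin ler_norm.
Qed.

End kernel.

Section Rintegral_change_of_variables.
Context {R : realType}.
Notation mu := (@lebesgue_measure R).

Let fine_scaleB (k : R) (A B : \bar R) : A \is a fin_num -> B \is a fin_num ->
  fine (k%:E * A - k%:E * B)%E = k * fine (A - B)%E.
Proof. by move: A B => [A| |] [B| |]//= _ _; rewrite mulrBr. Qed.

Lemma Rintegral_affine (a b : R) (g : R -> R) : a != 0 ->
  mu.-integrable setT (EFin \o g) ->
  \int[mu]_t g (a * t + b) = `|a|^-1 * \int[mu]_t g t.
Proof.
move=> a0 ig; have mg := measurable_int _ ig.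
rewrite /Rintegral integralE [in RHS]integralE.
rewrite -fine_scaleB; [|exact: integrable_pos_fin_num ig|exact: integrable_neg_fin_num ig].
rewrite -(ge0_integral_affine (f := (EFin \o g)^\+%E) b a0); last 2 first.
  exact: measurable_funepos.
  by move=> t; exact: funepos_ge0.
rewrite -(ge0_integral_affine (f := (EFin \o g)^\-%E) b a0)//; last first.
  exact: measurable_funeneg.
by congr (fine (_ - _)%E); apply: eq_integral => t _; rewrite ?funeposE ?funenegE.
Qed.

Lemma Rintegral_aff2 (a b c d e l : R) (g : R * R -> R) : a * d - b * c != 0 ->
  leb2.-integrable setT (EFin \o g) ->
  \int[leb2]_t g (aff2 a b c d e l t) = `|a * d - b * c|^-1 * \int[leb2]_t g t.
Proof.
move=> D0 ig; have mg := measurable_int _ ig.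
rewrite /Rintegral integralE [in RHS]integralE.
rewrite -fine_scaleB; [|exact: integrable_pos_fin_num ig|exact: integrable_neg_fin_num ig].
rewrite -(ge0_integral_aff2 (phi := (EFin \o g)^\+%E) e l D0); last 2 first.
  exact: measurable_funepos.
  by move=> t; exact: funepos_ge0.
rewrite -(ge0_integral_aff2 (phi := (EFin \o g)^\-%E) e l D0)//; last first.
  exact: measurable_funeneg.
by congr (fine (_ - _)%E); apply: eq_integral => t _; rewrite ?funeposE ?funenegE.
Qed.

End Rintegral_change_of_variables.

Section smoothing.
Context {R : realType}.
Variables (K : R -> R) (Q : R).
Hypothesis hK : K1 K Q.
Variables (M : R) (f : R -> R).
Hypothesis hf : FM M f.
Notation mu := (@lebesgue_measure R).
Notation nK := (Lp_norm 1%E K).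
Notation kap := (norm_inf K).

Lemma FM_ge0 : 0 <= M.
Proof. by case: hf => _ /(_ 0); exact: le_trans. Qed.

Lemma integrable_kernel_mul (B : R) (g : R -> R) : measurable_fun setT g ->
  (forall u, `|g u| <= B) -> mu.-integrable setT (EFin \o (fun u => K u * g u)).
Proof.
move=> mg gB.
have iB : mu.-integrable setT (fun u => (B * `|K u|)%:E).
  under [X in integrable _ _ X]eq_fun do rewrite EFinM.
  by apply: integrableZl => //; exact: (integrable_abse (integrable_kernel hK)).
apply: (le_integrable measurableT _ _ iB).
- apply/measurable_EFinP; apply: measurable_funM => //; exact: (measurable_kernel hK).
- move=> u _ /=; rewrite lee_fin !normrM normr_id mulrC ler_wpM2r//.
  by apply: le_trans (gB u) _; exact: ler_norm.
Qed.

Lemma Rintegral_abs_kernel : \int[mu]_u `|K u| = nK.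
Proof. by rewrite /Rintegral (Lp_norm1_kernel hK). Qed.

Lemma Rintegral_kernel : \int[mu]_u K u = 1. Proof. by case: hK. Qed.

Lemma abs_Rintegral_kernel_mul_le (B : R) (g : R -> R) : measurable_fun setT g ->
  (forall u, `|g u| <= B) -> `|\int[mu]_u (K u * g u)| <= B * nK.
Proof.
move=> mg gB; have ig := integrable_kernel_mul mg gB.
apply: le_trans (le_normr_Rintegral measurableT ig) _.
rewrite -Rintegral_abs_kernel -RintegralZl//; last exact: (integrable_abse (integrable_kernel hK)).
apply: le_Rintegral => //.
- exact: (integrable_abse ig).
- under [X in integrable _ _ X]eq_fun do rewrite /= EFinM.
  by apply: integrableZl => //; exact: (integrable_abse (integrable_kernel hK)).
- by move=> u _; rewrite normrM mulrC ler_wpM2r.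
Qed.

Let measurable_shift (z a : R) (g : R -> R) : measurable_fun setT g ->
  measurable_fun setT (fun u => g (z + a * u)).
Proof.
move=> mg; apply: (measurableT_comp mg).
by apply: measurable_funD => //; exact: measurable_funM.
Qed.

(** The kernel average in the rescaled variable. This form makes sense for steps of any sign and for
    step 0, where it returns [f]; both occur because the steps are scalar products with the unknown
    direction. *)
Definition smooth (al z : R) : R := \int[mu]_u (K u * f (z + al * u)).

Lemma integrable_smooth (al z : R) :
  mu.-integrable setT (EFin \o (fun u => K u * f (z + al * u))).
Proof.
by case: hf => mf fM; apply: (@integrable_kernel_mul M) => //; exact: measurable_shift.
Qed.

Lemma smooth0 z : smooth 0 z = f z.
Proof.
rewrite /smooth; under eq_Rintegral do rewrite mul0r addr0.
by rewrite RintegralZr ?Rintegral_kernel ?mul1r//; exact: (integrable_kernel hK).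
Qed.

Lemma smoothN al z : smooth (- al) z = smooth al z.
Proof.
rewrite /smooth.
have N1 : (-1 : R) != 0 by rewrite oppr_eq0 oner_eq0.
have := Rintegral_affine 0 N1 (integrable_smooth al z).
rewrite normrN1 invr1 mul1r => <-; apply: eq_Rintegral => u _.
by rewrite addr0 !mulN1r (kernel_even hK) mulNr mulrN.
Qed.

Lemma abs_smooth_le al z : `|smooth al z| <= M * nK.
Proof.
by case: hf => mf fM; apply: abs_Rintegral_kernel_mul_le => //; exact: measurable_shift.
Qed.

Let fB z : measurable_fun setT (fun u => f u - f z) /\ forall u, `|f u - f z| <= 2 * M.
Proof.
case: hf => mf fM; split; first exact: measurable_funB.
move=> u; apply: le_trans (ler_normB _ _) _.
by have := fM u; have := fM z; lra.
Qed.

Lemma smoothB (al z : R) :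
  smooth al z - f z = \int[mu]_u (K u * (f (z + al * u) - f z)).
Proof.
have [mB bB] := fB z; case: hf => mf fM.
rewrite -{1}(mul1r (f z)) -Rintegral_kernel /smooth -RintegralZr//; last exact: (integrable_kernel hK).
rewrite -RintegralB//; [|exact: integrable_smooth|].
  by apply: eq_Rintegral => u _; rewrite mulrBr.
by apply: (@integrable_kernel_mul M).
Qed.

Lemma smooth_sub (al z : R) : 0 < al ->
  smooth al z - f z = al^-1 * \int[mu]_u (K ((u - z) / al) * (f u - f z)).
Proof.
move=> al0; have [mB bB] := fB z; case: hf => mf fM.
have al_neq0 : al != 0 by rewrite gt_eqF.
pose g u := K u * (f (z + al * u) - f z).
have ig : mu.-integrable setT (EFin \o g).
  by apply: (@integrable_kernel_mul (2 * M)) => [|u]; [exact: (measurable_shift z al mB)|exact: bB].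
rewrite smoothB.
have alV : al^-1 != 0 by rewrite invr_eq0.
have := Rintegral_affine (- z / al) alV ig.
rewrite gtr0_norm ?invr_gt0// invrK => /(congr1 (fun w => al^-1 * w)).
rewrite mulrA mulVf// mul1r => <-; congr (_ * _); apply: eq_Rintegral => u _.
rewrite /g (_ : al^-1 * u + - z / al = (u - z) / al); last by field.
by congr (_ * (f _ - _)); field.
Qed.

Definition Delta_set (h z : R) : set R :=
  [set `| delta^-1 * \int[mu]_u (K ((u - z) / delta) * (f u - f z)) |
    | delta in [set delta | 0 < delta <= h]].

Lemma abs_smooth_sub_le al z : `|smooth al z - f z| <= 2 * M * nK.
Proof.
have [mB bB] := fB z; rewrite smoothB; apply: abs_Rintegral_kernel_mul_le => //.
exact: (measurable_shift z al mB).
Qed.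

(** A real [sup] is informative only on bounded sets; this bound is what allows single averages to
    be compared with [Delta]. *)
Lemma Delta_set_ubound h z : ubound (Delta_set h z) (2 * M * nK).
Proof.
move=> _ [de /= /andP[de0 _] <-]; rewrite -smooth_sub//; exact: abs_smooth_sub_le.
Qed.

Lemma Delta_le h z : 0 < h -> Delta K f h z <= 2 * M * nK.
Proof.
move=> h0; apply: ge_sup; last exact: Delta_set_ubound.
by eexists; exists h => //=; rewrite h0 lexx.
Qed.

Lemma Delta_ge0 h z : 0 < h -> 0 <= Delta K f h z.
Proof.
move=> h0; apply: (@le_trans _ _ `|h^-1 * \int[mu]_u (K ((u - z) / h) * (f u - f z))|) => //.
apply: ub_le_sup; first by exists (2 * M * nK); exact: Delta_set_ubound.
by exists h => //=; rewrite h0 lexx.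
Qed.

Lemma abs_smooth_sub_Delta al h z : 0 < h -> `|al| <= h ->
  `|smooth al z - f z| <= Delta K f h z.
Proof.
move=> h0.
wlog al0 : al / 0 <= al.
  move=> H; have [|al0] := leP 0 al; first exact: H.
  by rewrite -smoothN -normrN => /H; apply; rewrite oppr_ge0 ltW.
move=> alh; have [->|al_neq0] := eqVneq al 0.
  by rewrite smooth0 subrr normr0 Delta_ge0.
have al_gt0 : 0 < al by rewrite lt_neqAle eq_sym al_neq0.
apply: ub_le_sup; first by exists (2 * M * nK); exact: Delta_set_ubound.
by exists al; rewrite /= ?smooth_sub// al_gt0 -(ger0_norm al0).
Qed.

End smoothing.

Section bias.
Context {R : realType}.
Variables (K : R -> R) (Q : R).
Hypothesis hK : K1 K Q.
Variables (M : R) (f : R -> R).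
Hypothesis hf : FM M f.
Notation mu := (@lebesgue_measure R).
Notation nK := (Lp_norm 1%E K).
Notation kap := (norm_inf K).
Notation smooth := (smooth K f).

Lemma measurable_smooth al : measurable_fun setT (smooth al).
Proof.
case: (hf) => mf _.
pose phi (t : R * R) : \bar R := (K t.2 * f (t.1 + al * t.2))%:E.
have mphi : measurable_fun setT phi.
  apply/measurable_EFinP; apply: measurable_funM.
    exact: (measurableT_comp (measurable_kernel hK) measurable_snd).
  apply: (measurableT_comp mf); apply: measurable_funD; first exact: measurable_fst.
  by apply: measurable_funM => //; exact: measurable_snd.
have mF (psi : R * R -> \bar R) : measurable_fun setT psi -> (forall t, (0 <= psi t)%E) ->
    measurable_fun setT (fun z => \int[mu]_u psi (z, u))%E.
  move=> mpsi psi0; exact: (@measurable_fun_fubini_tonelli_F _ _ _ _ R mu psi).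
apply: (measurableT_comp (f := fine)) => //.
rewrite (_ : (fun z => _) = (fun z => \int[mu]_u phi^\+ (z, u) - \int[mu]_u phi^\- (z, u))%E).
  apply: emeasurable_funB.
      exact: (mF _ (measurable_funepos mphi) (funepos_ge0 phi)).
  exact: (mF _ (measurable_funeneg mphi) (funeneg_ge0 phi)).
apply/funext => z; rewrite integralE.
by congr (_ - _)%E; apply: eq_integral => u _; rewrite ?funeposE ?funenegE.
Qed.

Definition smooth2 (al be y : R) : R := \int[mu]_v (K v * smooth al (y + be * v)).

Let msm (al be y : R) : measurable_fun setT (fun v : R => smooth al (y + be * v)).
Proof.
apply: (measurableT_comp (measurable_smooth al)).
by apply: measurable_funD => //; exact: measurable_funM.
Qed.

Lemma integrable_smooth2 al be y :
  mu.-integrable setT (EFin \o (fun v => K v * smooth al (y + be * v))).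
Proof.
apply: (integrable_kernel_mul hK (B := M * nK)) => // u.
exact: (abs_smooth_le hK hf).
Qed.

Lemma smooth2N al be y : smooth2 al (- be) y = smooth2 al be y.
Proof.
rewrite /smooth2.
have N1 : (-1 : R) != 0 by rewrite oppr_eq0 oner_eq0.
have := Rintegral_affine 0 N1 (integrable_smooth2 al be y).
rewrite normrN1 invr1 mul1r => <-; apply: eq_Rintegral => u _.
by rewrite addr0 !mulN1r (kernel_even hK) mulNr mulrN.
Qed.

Lemma smooth2_0r al y : smooth2 al 0 y = smooth al y.
Proof.
rewrite /smooth2; under eq_Rintegral do rewrite mul0r addr0.
by rewrite RintegralZr ?(Rintegral_kernel hK) ?mul1r//; exact: (integrable_kernel hK).
Qed.

Definition kernel2 al be y (t : R * R) : R := K t.1 * K t.2 * f (y + al * t.1 + be * t.2).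

Lemma measurable_kernel2 al be y : measurable_fun setT (kernel2 al be y).
Proof.
case: (hf) => mf _.
have m1 : measurable_fun setT (fun t : R * R => t.1) by exact: measurable_fst.
have m2 : measurable_fun setT (fun t : R * R => t.2) by exact: measurable_snd.
apply: measurable_funM.
  apply: measurable_funM; apply: (measurableT_comp (measurable_kernel hK)) => //.
apply: (measurableT_comp mf); apply: measurable_funD; last exact: measurable_funM.
by apply: measurable_funD => //; exact: measurable_funM.
Qed.

Lemma integrable_kernel2 al be y : leb2.-integrable setT (EFin \o kernel2 al be y).
Proof.
case: (hf) => _ fM.
have nK0 := Lp_norm1_kernel_ge0 hK.
have mk : measurable_fun setT (fun v => `|K v|%:E).
  by apply/measurable_EFinP; apply: measurableT_comp => //; exact: (measurable_kernel hK).
apply/integrable21ltyP.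
  by apply/measurable_EFinP; exact: measurable_kernel2.
apply: (@le_lt_trans _ _ (M * nK * nK)%:E); last exact: ltry.
apply: (@le_trans _ _ (\int[mu]_v (`|K v|%:E * (M * nK)%:E))%E); last first.
  rewrite ge0_integralZr//; last by rewrite lee_fin mulr_ge0// (FM_ge0 hf).
  by rewrite (Lp_norm1_kernel hK) -EFinM lee_fin mulrC.
apply: ge0_le_integral_nomeas => v _; first exact: integral_ge0.
apply: (@le_trans _ _ (\int[mu]_u (`|K u|%:E * (`|K v| * M)%:E))%E).
  apply: ge0_le_integral_nomeas => u _ //.
  rewrite /= -EFinM lee_fin /kernel2 !normrM -mulrA !ler_wpM2l//.
rewrite ge0_integralZr//; last by rewrite lee_fin mulr_ge0// (FM_ge0 hf).
rewrite (Lp_norm1_kernel hK) -!EFinM lee_fin le_eqVlt; apply/orP; left; apply/eqP; ring.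
Qed.

Lemma Rintegral_kernel2 al be y : \int[leb2]_t kernel2 al be y t = smooth2 al be y.
Proof.
rewrite /Rintegral.
have -> : (\int[leb2]_t (kernel2 al be y t)%:E)%E =
    (\int[mu]_v fubini_G mu (EFin \o kernel2 al be y) v)%E.
  by symmetry; apply: integral21_prod_meas1; exact: integrable_kernel2.
rewrite /smooth2 /Rintegral; congr fine; apply: eq_integral => v _.
rewrite /fubini_G /(smooth _ _) /Rintegral EFinM.
rewrite fineK; last exact: (integrable_fin_num measurableT (integrable_smooth hK hf al (y + be * v))).
rewrite -integralZl//; last exact: (integrable_smooth hK hf al (y + be * v)).
apply: eq_integral => u _; rewrite -EFinM; congr EFin.
by rewrite /kernel2/= (addrAC y); ring.
Qed.

Let norm2 (p : R * R) : R := p.1 ^+ 2 + p.2 ^+ 2.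

(** In the window coordinates [u = E (t - x)] one has [t - x = (h p u_1 + p' u_2) / |p|^2] with
    [p' = (- p.2, p.1)], so [t . theta0] is affine in [u] with the two displayed steps. The Jacobian
    cancels the prefactor. *)
Lemma mean_window (p x theta0 : R * R) (h : R) : 0 < h -> 0 < norm2 p ->
  norm2 p / h * \int[leb2]_t (window K (Emx p h) x t * f (dotp t theta0)) =
  smooth2 (h * dotp p theta0 / norm2 p)
    ((- p.2 * theta0.1 + p.1 * theta0.2) / norm2 p) (dotp x theta0).
Proof.
move=> h0 p0; rewrite -Rintegral_kernel2.
set al := h * _ / _; set be := _ / norm2 p; set y := dotp x theta0.
have h_neq0 : h != 0 by rewrite gt_eqF.
have p_neq0 : norm2 p != 0 by rewrite gt_eqF.
pose a := h^-1 * p.1; pose b := h^-1 * p.2.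
have DE : a * p.1 - b * - p.2 = norm2 p / h by rewrite /a /b /norm2; field.
have D0 : 0 < norm2 p / h by rewrite divr_gt0.
have D_neq0 : a * p.1 - b * - p.2 != 0 by rewrite DE gt_eqF.
have := Rintegral_aff2 (- (a * x.1 + b * x.2)) (p.2 * x.1 - p.1 * x.2) D_neq0
  (integrable_kernel2 al be y).
rewrite DE gtr0_norm// => /(congr1 (fun w => norm2 p / h * w)).
rewrite mulrA divff ?gt_eqF// mul1r => <-; congr (_ * _); apply: eq_Rintegral => t _.
rewrite /window /Kprod /mxact /Emx /mx2 !mxE/= /kernel2 /aff2/=.
congr (K _ * K _ * f _); rewrite /a /b /al /be /y /dotp; first by ring.
  by ring.
by move: p_neq0; rewrite /norm2 => p_neq0; field; rewrite h_neq0 p_neq0.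
Qed.

Let Dset_ub h z : 0 < h -> Delta K f h z <= 2 * M * nK.
Proof. exact: (Delta_le hK hf). Qed.

Lemma integral_Delta_le (h y a : R) : 0 < h -> 0 < a ->
  (\int[mu]_(z in `[(y - a)%R, (y + a)%R]) (Delta K f h z)%:E <= (2 * M * nK * (2 * a))%:E)%E.
Proof.
move=> h0 a0.
apply: (@le_trans _ _ (\int[mu]_(z in `[(y - a)%R, (y + a)%R]) (cst (2 * M * nK)%R%:E z))%E).
  apply: ge0_le_integral_nomeas => z _; rewrite lee_fin.
    exact: (Delta_ge0 hK hf).
  exact: Dset_ub.
rewrite integral_cst//= lebesgue_measure_itv/= lte_fin ifT; last by lra.
by rewrite -EFinB -EFinM lee_fin le_eqVlt; apply/orP; left; apply/eqP; ring.
Qed.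

Lemma Delta_bar_ubound (h y : R) : 0 < h ->
  ubound [set (2 * a)^-1 * \int[mu]_(z in `[(y - a)%R, (y + a)%R]) Delta K f h z
       | a in [set a | 0 < a]] (2 * M * nK).
Proof.
move=> h0 _ [a /= a0 <-].
rewrite mulrC ler_pdivrMr ?mulr_gt0// -lee_fin fineK; first exact: integral_Delta_le.
rewrite ge0_fin_numE; last by apply: integral_ge0 => z _; rewrite lee_fin (Delta_ge0 hK hf).
by apply: le_lt_trans (integral_Delta_le y h0 a0) _; exact: ltry.
Qed.

(** The average in [Delta_bar] is the finite part of an extended integral; here that integral is
    shown finite, so that later comparisons can use monotonicity of nonnegative integrals only. *)
Lemma Delta_bar_ge (h y a : R) : 0 < h -> 0 < a ->
  (\int[mu]_(z in `[(y - a)%R, (y + a)%R]) (Delta K f h z)%:E <= (2 * a * Delta_bar K f h y)%:E)%E.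
Proof.
move=> h0 a0.
have fin_int : (\int[mu]_(z in `[(y - a)%R, (y + a)%R]) (Delta K f h z)%:E \is a fin_num)%E.
  rewrite ge0_fin_numE; last by apply: integral_ge0 => z _; rewrite lee_fin (Delta_ge0 hK hf).
  by apply: le_lt_trans (integral_Delta_le y h0 a0) _; exact: ltry.
rewrite -(fineK fin_int) lee_fin -ler_pdivrMl ?mulr_gt0//.
apply: ub_le_sup; first by exists (2 * M * nK); exact: Delta_bar_ubound.
by exists a.
Qed.

Lemma Delta_star_le (h y : R) : 0 < h -> Delta_star K f h y <= 2 * M * nK.
Proof.
move=> h0; rewrite /Delta_star ge_max Dset_ub// andbT.
apply: ge_sup; last exact: Delta_bar_ubound.
by eexists; exists 1 => //=; exact: ltr01.
Qed.

Lemma Delta_star_ge0 (h y : R) : 0 < h -> 0 <= Delta_star K f h y.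
Proof. by move=> h0; rewrite /Delta_star le_max (Delta_ge0 hK hf)// orbT. Qed.

(** On the support of [K] the outer variable moves by at most [|be| / 2], and [|K| <= kap]. Hence
    the difference is at most [kap] times the average of [Delta] over an interval centered at [y] of
    length [|be|], one of those in the maximal function, and the bound is free of [be]. For [be = 0]
    the average degenerates to the value at [y], which is why [Delta_star] also contains [Delta]. *)
Lemma smooth2_bias (al be h y : R) : 0 < h -> `|al| <= h ->
  `|smooth2 al be y - smooth2 0 be y| <= kap * Delta_star K f h y.
Proof.
move=> h0 alh.
have [mf fM] := hf.
have kap0 := norm_inf_ge0 hK.
pose G (z : R) : R := `|smooth al z - f z|.
have mG : measurable_fun setT G.
  apply: measurableT_comp => //; apply: measurable_funB => //; exact: measurable_smooth.
have GD z : G z <= Delta K f h z by exact: (abs_smooth_sub_Delta hK hf).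
have [->|be0] := eqVneq be 0.
  rewrite !smooth2_0r (smooth0 hK); apply: le_trans (GD y) _.
  apply: (@le_trans _ _ (Delta_star K f h y)); first by rewrite /Delta_star le_max lexx orbT.
  by rewrite ler_peMl ?Delta_star_ge0// (norm_inf_ge1 hK).
pose a := `|be| / 2.
have a0 : 0 < a by rewrite divr_gt0// normr_gt0.
pose phi z : \bar R := ((\1_`[(y - a)%R, (y + a)%R] z)%:E * (G z)%:E)%E.
have phi0 z : (0 <= phi z)%E by rewrite mule_ge0 ?lee_fin// /G.
have mphi : measurable_fun setT phi.
  apply: emeasurable_funM; apply/measurable_EFinP => //.
have ig : mu.-integrable setT (EFin \o (fun v => K v * smooth al (y + be * v) - K v * smooth 0 (y + be * v))).
  exact: (integrableB measurableT (integrable_smooth2 al be y) (integrable_smooth2 0 be y)).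
rewrite /smooth2 -RintegralB//; [|exact: integrable_smooth2|exact: integrable_smooth2].
apply: le_trans (le_normr_Rintegral measurableT ig) _.
rewrite -lee_fin fineK; last exact: (integrable_fin_num measurableT (integrable_abse ig)).
apply: (@le_trans _ _ (\int[mu]_v (kap%:E * phi (be * v + y)%R))%E).
  apply: ge0_le_integral_nomeas => v _; first by rewrite lee_fin.
  rewrite -mulrBr normrM (smooth0 hK) -/(G (y + be * v)) /phi [(be * v + y)%R]addrC.
  have [v2|v2] := ltP (1 / 2) `|v|.
    by rewrite (kernel_out hK)// normr0 mul0r mule_ge0 ?lee_fin// ?phi0 mulr_ge0// /G.
  rewrite indicE mem_set; last first.
    rewrite /= in_itv/= -ler_distlC opprD addrA subrr add0r normrN normrM /a mulrC.
    by rewrite -ler_pdivlMr ?normr_gt0// mulrC mulKf ?normr_eq0// -div1r.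
  by rewrite mul1e -EFinM lee_fin ler_wpM2r ?(kernel_le hK)// /G.
rewrite ge0_integralZl//; last first.
  by apply: (measurableT_comp mphi); apply: measurable_funD => //; exact: measurable_funM.
rewrite (ge0_integral_affine y be0)// EFinM lee_wpmul2l ?lee_fin//.
have -> : (\int[mu]_z phi z = \int[mu]_(z in `[(y - a)%R, (y + a)%R]) (G z)%:E)%E.
  rewrite [RHS]integral_mkcond; apply: eq_integral => z _.
  by rewrite patchE /phi indicE; case: ifPn; rewrite ?mul1e ?mul0e.
apply: (@le_trans _ _ (`|be|^-1%:E * (2 * a * Delta_bar K f h y)%:E)%E).
  rewrite lee_wpmul2l ?lee_fin//.
  apply: le_trans (Delta_bar_ge y h0 a0).
  by apply: ge0_le_integral_nomeas => z _; rewrite lee_fin// /G.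
rewrite -EFinM lee_fin /a [2 * _]mulrC divfK// mulKf ?normr_eq0//.
by rewrite /Delta_star le_max lexx.
Qed.

Lemma smooth_bias (al h y : R) : 0 < h -> `|al| <= h ->
  `|smooth2 al 0 y - f y| <= Delta_star K f h y.
Proof.
move=> h0 alh; rewrite smooth2_0r; apply: le_trans (abs_smooth_sub_Delta hK hf y h0 alh) _.
by rewrite /Delta_star le_max lexx orbT.
Qed.

Lemma smooth2_bound al be y : `|smooth2 al be y - f y| <= 2 * M * kap ^+ 2.
Proof.
have [mf fM] := hf.
have kap0 := norm_inf_ge0 hK.
have k1 := Lp_norm1_kernel_le hK.
have nK0 := Lp_norm1_kernel_ge0 hK.
have M0 := FM_ge0 hf.
have kap1 := norm_inf_ge1 hK.
apply: le_trans (ler_normB _ _) _.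
have h1 : `|smooth2 al be y| <= M * nK * nK.
  by apply: (abs_Rintegral_kernel_mul_le hK) => // u; exact: (abs_smooth_le hK hf).
have h2 := fM y.
have : M * nK * nK <= M * kap ^+ 2 by rewrite -mulrA ler_wpM2l// expr2 ler_pM.
have : M <= M * kap ^+ 2 by rewrite ler_peMr// exprn_ege1.
lra.
Qed.

End bias.

(** * Maximal inequality for the noise *)

Section window.
Context {R : realType}.
Variables (K : R -> R) (Q : R).
Hypothesis hK : K1 K Q.
Notation mu := (@lebesgue_measure R).
Notation kap := (norm_inf K).
Implicit Types (p x t : R * R) (h : R).

Definition sqnorm p : R := p.1 ^+ 2 + p.2 ^+ 2.

Definition dist1 p q : R := `|p.1 - q.1| + `|p.2 - q.2|.

Lemma det_Emx p h : \det (Emx p h) = sqnorm p / h.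
Proof.
rewrite (expand_det_row _ 0) !big_ord_recl big_ord0 addr0 /cofactor !det_mx11.
rewrite /Emx /mx2 !mxE/= /sqnorm; ring.
Qed.

Lemma Emx_unit p h : 0 < h -> 0 < sqnorm p -> Emx p h \in unitmx.
Proof. by move=> h0 p0; rewrite unitmxE det_Emx unitfE gt_eqF// divr_gt0. Qed.

Definition scaled_window p h x t : R := sqnorm p / h * window K (Emx p h) x t.

Lemma windowE p h x t : window K (Emx p h) x t =
  K ((p.1 * (t.1 - x.1) + p.2 * (t.2 - x.2)) / h) *
  K (- p.2 * (t.1 - x.1) + p.1 * (t.2 - x.2)).
Proof. by rewrite /window /Kprod /mxact /Emx /mx2 !mxE/=; congr (K _ * K _); ring. Qed.

Lemma window_aff2 p h x t : window K (Emx p h) x t =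
  (fun u : R * R => K u.1 * K u.2)
    (aff2 (h^-1 * p.1) (h^-1 * p.2) (- p.2) p.1
       (- (h^-1 * p.1 * x.1 + h^-1 * p.2 * x.2)) (p.2 * x.1 - p.1 * x.2) t).
Proof. by rewrite windowE /aff2/=; congr (K _ * K _); ring. Qed.

Lemma measurable_window p h x : measurable_fun setT (window K (Emx p h) x).
Proof.
rewrite (_ : window K (Emx p h) x = (fun u : R * R => K u.1 * K u.2) \o
    (aff2 (h^-1 * p.1) (h^-1 * p.2) (- p.2) p.1
       (- (h^-1 * p.1 * x.1 + h^-1 * p.2 * x.2)) (p.2 * x.1 - p.1 * x.2))); last first.
  by apply/funext => t; rewrite window_aff2.
apply: measurableT_comp; last exact: measurable_aff2.
apply: measurable_funM.
  exact: (measurableT_comp (measurable_kernel hK) measurable_fst).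
exact: (measurableT_comp (measurable_kernel hK) measurable_snd).
Qed.

Lemma measurable_scaled_window p h x : measurable_fun setT (scaled_window p h x).
Proof. by apply: measurable_funM => //; exact: measurable_window. Qed.

Let integral_kernel_sq : (\int[mu]_u (K u ^+ 2)%:E <= (kap ^+ 2)%:E)%E.
Proof.
have k0 := norm_inf_ge0 hK.
apply: (@le_trans _ _ (\int[mu]_u (kap%:E * `|K u|%:E))%E).
  apply: ge0_le_integral_nomeas => u _; first by rewrite lee_fin sqr_ge0.
  by rewrite -EFinM lee_fin -real_normK ?num_real// expr2 ler_wpM2r// (kernel_le hK).
rewrite ge0_integralZl//; last 1 first.
  by apply/measurable_EFinP; apply: measurableT_comp => //; exact: (measurable_kernel hK).
rewrite (Lp_norm1_kernel hK) -EFinM lee_fin expr2 ler_wpM2l//.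
exact: (Lp_norm1_kernel_le hK).
Qed.

(** The Jacobian cancels one of the two determinant factors, and each variable contributes the
    integral of [K^2], at most [|K|_oo |K|_1 <= kap^2]. *)
Lemma integral_scaled_window_sq p h x : 0 < h -> 0 < sqnorm p ->
  (\int[leb2]_t (scaled_window p h x t ^+ 2)%:E <= (sqnorm p / h * kap ^+ 4)%:E)%E.
Proof.
move=> h0 p0.
have mK := measurable_kernel hK.
have D0 : 0 < sqnorm p / h by rewrite divr_gt0.
pose phi (u : R * R) : \bar R := (K u.1 ^+ 2 * K u.2 ^+ 2)%:E.
have mphi : measurable_fun setT phi.
  apply/measurable_EFinP; apply: measurable_funM; apply: measurable_funX.
    exact: (measurableT_comp mK measurable_fst).
  exact: (measurableT_comp mK measurable_snd).
have phi0 u : (0 <= phi u)%E by rewrite lee_fin mulr_ge0 ?sqr_ge0.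
pose A t := aff2 (h^-1 * p.1) (h^-1 * p.2) (- p.2) p.1
       (- (h^-1 * p.1 * x.1 + h^-1 * p.2 * x.2)) (p.2 * x.1 - p.1 * x.2) t.
have mphiA : measurable_fun setT (fun t => phi (A t)).
  by apply: (measurableT_comp mphi); exact: measurable_aff2.
have -> : (\int[leb2]_t (scaled_window p h x t ^+ 2)%:E =
    ((sqnorm p / h) ^+ 2)%:E * \int[leb2]_t phi (A t))%E.
  rewrite -ge0_integralZl//; last by rewrite lee_fin sqr_ge0.
  apply: eq_integral => t _; rewrite /phi -EFinM; congr EFin.
  by rewrite /scaled_window window_aff2 !exprMn.
have DE : h^-1 * p.1 * p.1 - h^-1 * p.2 * - p.2 = sqnorm p / h.
  by rewrite /sqnorm; ring.
rewrite ge0_integral_aff2//; last by rewrite DE gt_eqF.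
rewrite DE gtr0_norm// muleA -EFinM expr2 mulfK ?gt_eqF// [leRHS]EFinM.
rewrite lee_wpmul2l ?lee_fin ?(ltW D0)//.
rewrite fubini_tonelli1//.
apply: (@le_trans _ _ (\int[mu]_u ((K u ^+ 2)%:E * (kap ^+ 2)%:E))%E).
  apply: ge0_le_integral_nomeas => u _; first exact: integral_ge0.
  rewrite /fubini_F /phi/=; under eq_integral do rewrite EFinM.
  rewrite ge0_integralZl//.
  - by rewrite lee_wpmul2l// lee_fin sqr_ge0.
  - by apply/measurable_EFinP; exact: measurable_funX.
  - by move=> v _; rewrite lee_fin sqr_ge0.
  - by rewrite lee_fin sqr_ge0.
rewrite ge0_integralZr//; last 3 first.
- by apply/measurable_EFinP; exact: measurable_funX.
- by move=> v _; rewrite lee_fin sqr_ge0.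
- by rewrite lee_fin sqr_ge0.
by rewrite [leRHS](_ : _ = (kap ^+ 2)%:E * (kap ^+ 2)%:E)%E ?lee_wpmul2r ?lee_fin ?sqr_ge0// -EFinM -exprD.
Qed.

Let bigbox x : set (R * R) := box (x.1 - 4, x.2 - 4) (x.1 + 4, x.2 + 4).

(** The two kernel arguments satisfy [a^2 + b^2 = sqnorm p |t - x|^2 <= 1/2], so
    [|t - x|^2 <= 8 < 16]. A single box for all matrices makes the Lipschitz bounds below
    integrable. *)
Lemma window_out p h x t : 0 < h <= 1 -> 1 / 16 <= sqnorm p -> ~ bigbox x t ->
  window K (Emx p h) x t = 0.
Proof.
move=> /andP[h0 h1] p0 nbox; rewrite windowE.
set a := _ + p.2 * _; set b := _ + p.1 * _.
have [ah|ah] := ltP (1 / 2) `|a / h|; first by rewrite (kernel_out hK ah) mul0r.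
have [bh|bh] := ltP (1 / 2) `|b|; first by rewrite (kernel_out hK bh) mulr0.
exfalso; apply: nbox.
have ah' : `|a| <= 1 / 2.
  move: ah; rewrite normrM normfV (gtr0_norm h0) ler_pdivrMr// => ah.
  by apply: le_trans ah _; rewrite ler_piMr.
have : a ^+ 2 + b ^+ 2 = sqnorm p * ((t.1 - x.1) ^+ 2 + (t.2 - x.2) ^+ 2).
  by rewrite /a /b /sqnorm; ring.
have : a ^+ 2 <= 1 / 4 by move: ah'; rewrite ler_norml => /andP[? ?]; nra.
have : b ^+ 2 <= 1 / 4 by move: bh; rewrite ler_norml => /andP[? ?]; nra.
move=> hb ha hab.
have tau : (t.1 - x.1) ^+ 2 + (t.2 - x.2) ^+ 2 <= 8.
  have := sqr_ge0 (t.1 - x.1); have := sqr_ge0 (t.2 - x.2); nra.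
have h1' : `|t.1 - x.1| < 4.
  rewrite -(@ltr_pXn2r _ 2) ?nnegrE// real_normK ?num_real//.
  by have := sqr_ge0 (t.2 - x.2); lra.
have h2' : `|t.2 - x.2| < 4.
  rewrite -(@ltr_pXn2r _ 2) ?nnegrE// real_normK ?num_real//.
  by have := sqr_ge0 (t.1 - x.1); lra.
move: h1' h2'; rewrite !ltr_norml => /andP[? ?] /andP[? ?].
by split; apply/andP; split => /=; lra.
Qed.

(** The determinant and the two kernel values each vary with [p]; their contributions 15/4, 8 and 8
    sum to less than 20, the first using [kap <= 3/2 Q]. One power of [1 / h] comes from the
    determinant and one from the argument divided by [h]. *)
Lemma scaled_window_lip p q h x t : 0 < h <= 1 ->
  1 / 16 <= sqnorm p <= 25 / 16 -> 1 / 16 <= sqnorm q <= 25 / 16 ->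
  `|scaled_window p h x t - scaled_window q h x t| <=
  20 * h^-1 ^+ 2 * (kap * Q) * dist1 p q * \1_(bigbox x) t.
Proof.
move=> h01 /andP[p0 p1] /andP[q0 q1].
have /andP[h0 h1] := h01.
have [tb|tb] := boolP (t \in bigbox x); last first.
  rewrite indicE (negbTE tb) mulr0 /scaled_window !window_out ?mulr0 ?subrr ?normr0//.
    by move=> /mem_set; rewrite (negbTE tb).
  by move=> /mem_set; rewrite (negbTE tb).
rewrite indicE tb mulr1.
have k0 := norm_inf_ge0 hK; have kQ := norm_inf_le_lip hK; have Q0 := lip_gt0 hK.
have {tb} [t1 t2] : `|t.1 - x.1| <= 4 /\ `|t.2 - x.2| <= 4.
  move: tb; rewrite inE => -[/= /andP[? ?] /andP[? ?]].
  by split; rewrite ler_norml; apply/andP; split; lra.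
rewrite /scaled_window !windowE.
set s1 := t.1 - x.1 in t1 *; set s2 := t.2 - x.2 in t2 *.
set a := (p.1 * _ + _) / h; set b := - p.2 * _ + _.
set a' := (q.1 * _ + _) / h; set b' := - q.2 * _ + _.
have hV1 : 1 <= h^-1 by rewrite invf_ge1.
have hV0 : 0 <= h^-1 by rewrite invr_ge0 ltW.
set dl := dist1 p q.
have dl0 : 0 <= dl by rewrite addr_ge0.
have hA : `|K a - K a'| <= 4 * Q * h^-1 * dl.
  apply: le_trans (kernel_lip hK _ _) _.
  have -> : a - a' = h^-1 * ((p.1 - q.1) * s1 + (p.2 - q.2) * s2).
    by rewrite /a /a'; ring.
  rewrite [X in _ <= X](_ : _ = Q * (h^-1 * (4 * dl))); last by ring.
  rewrite ler_wpM2l ?(ltW Q0)// normrM (ger0_norm hV0) ler_wpM2l//.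
  apply: le_trans (ler_normD _ _) _; rewrite !normrM /dl /dist1 mulrDr.
  by apply: lerD; rewrite mulrC ler_wpM2r.
have hB : `|K b - K b'| <= 4 * Q * dl.
  apply: le_trans (kernel_lip hK _ _) _.
  have -> : b - b' = (q.2 - p.2) * s1 + (p.1 - q.1) * s2 by rewrite /b /b'; ring.
  rewrite [X in _ <= X](_ : _ = Q * (4 * dl)); last by ring.
  rewrite ler_wpM2l ?(ltW Q0)//.
  apply: le_trans (ler_normD _ _) _; rewrite !normrM /dl /dist1 mulrDr addrC.
  rewrite (distrC q.2).
  by apply: lerD; rewrite mulrC ler_wpM2r.
have coord (z : R * R) : sqnorm z <= 25 / 16 -> `|z.1| <= 5 / 4 /\ `|z.2| <= 5 / 4.
  rewrite /sqnorm => z1; have := sqr_ge0 z.1; have := sqr_ge0 z.2.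
  by split; rewrite -(@ler_pXn2r _ 2) ?nnegrE// real_normK ?num_real//; lra.
have [p1' p2'] := coord _ p1; have [q1' q2'] := coord _ q1.
have hN : `|sqnorm p - sqnorm q| <= 5 / 2 * dl.
  have -> : sqnorm p - sqnorm q = (p.1 - q.1) * (p.1 + q.1) + (p.2 - q.2) * (p.2 + q.2).
    by rewrite /sqnorm; ring.
  apply: le_trans (ler_normD _ _) _; rewrite !normrM /dl /dist1 mulrDr.
  apply: lerD; rewrite mulrC ler_wpM2r//; apply: le_trans (ler_normD _ _) _; lra.
have -> : sqnorm p / h * (K a * K b) - sqnorm q / h * (K a' * K b') =
    h^-1 * ((sqnorm p - sqnorm q) * (K a * K b) +
            sqnorm q * ((K a - K a') * K b) + sqnorm q * (K a' * (K b - K b'))).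
  by ring.
rewrite normrM (ger0_norm hV0).
have Ka := kernel_le hK a; have Kb := kernel_le hK b; have Ka' := kernel_le hK a'.
have sq0 : 0 <= sqnorm q by lra.
pose kd := kap * Q * dl.
have kd0 : 0 <= kd by rewrite !mulr_ge0// ltW.
have e1 : `|(sqnorm p - sqnorm q) * (K a * K b)| <= 15 / 4 * kd.
  rewrite !normrM; apply: (@le_trans _ _ (5 / 2 * dl * (kap * kap))).
    by apply: ler_pM; rewrite ?mulr_ge0//; apply: ler_pM.
  have : kap * kap <= kap * (3 / 2 * Q) by rewrite ler_wpM2l.
  move=> /(ler_wpM2l dl0); rewrite /kd; lra.
have e2 : `|sqnorm q * ((K a - K a') * K b)| <= 8 * (h^-1 * kd).
  rewrite !normrM (ger0_norm sq0).
  rewrite [X in _ <= X](_ : _ = 2 * ((4 * Q * h^-1 * dl) * kap)); last by rewrite /kd; ring.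
  apply: ler_pM; rewrite ?mulr_ge0//; first by lra.
  by apply: ler_pM.
have e3 : `|sqnorm q * (K a' * (K b - K b'))| <= 8 * kd.
  rewrite !normrM (ger0_norm sq0).
  rewrite [X in _ <= X](_ : _ = 2 * (kap * (4 * Q * dl))); last by rewrite /kd; ring.
  apply: ler_pM; rewrite ?mulr_ge0//; first by lra.
  by apply: ler_pM.
rewrite expr2 [X in _ <= X](_ : _ = h^-1 * (20 * h^-1 * (kap * Q) * dl)); last by ring.
rewrite ler_wpM2l//.
apply: le_trans (ler_normD _ _) _; apply: le_trans (lerD (ler_normD _ _) (lexx _)) _.
have : kd <= h^-1 * kd by rewrite ler_peMl.
have -> : 20 * h^-1 * (kap * Q) * dl = 20 * (h^-1 * kd) by rewrite /kd; ring.
lra.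
Qed.

End window.

Section noise.
Context {R : realType} {d : measure_display} {T : measurableType d}.
Variables (P : probability T R) (K : R -> R) (Q M eps : R).
Hypotheses (hK : K1 K Q) (heps : 0 < eps).
Variables (f : R -> R) (theta0 x : R * R).
Hypothesis hf : FM M f.
Variables (D : set (R * R)) (W : R * R -> {RV P >-> R}).
Hypotheses (mD : measurable D) (hW : brownian_sheet W).
Variable Y : 'M[R]_2 -> {RV P >-> R}.
Hypothesis hY : forall E : 'M[R]_2, E \in unitmx ->
  is_observed_integral W D eps (fun t => f (dotp t theta0)) (window K E x) (Y E).
Notation kap := (norm_inf K).
Implicit Types (p q : R * R) (h : R).

Definition mean_on_D p h : R :=
  sqnorm p / h * \int[leb2]_(t in D) (window K (Emx p h) x t * f (dotp t theta0)).

(** Obtained from [Y] by centering rather than as a Wiener integral: it equals one almost surely for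
    each fixed parameter, but this form inherits, on one common event, the continuity of [Y] in the
    matrix. *)
Definition noise p h (w : T) : R :=
  eps^-1 * (Fhat (fun E => Y E w) p h - mean_on_D p h).

Lemma measurable_noise p h : measurable_fun setT (noise p h).
Proof.
apply: measurable_funM => //; apply: measurable_funB => //.
by rewrite /Fhat /Fhat_mx; apply: measurable_funM => //; exact: measurable_funP.
Qed.

Lemma measurable_scaled_window_D p h :
  measurable_fun setT (fun t => scaled_window K p h x t * \1_D t).
Proof.
apply: measurable_funM; first exact: (measurable_scaled_window hK).
by apply: measurable_indic.
Qed.

Lemma noise_wiener p h : 0 < h -> 0 < sqnorm p ->
  wiener_limit W D (scaled_window K p h x) (noise p h).
Proof.
move=> h0 p0; have [X [hX aeY]] := hY (Emx_unit h0 p0).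
pose c := sqnorm p / h.
have mw : measurable_fun setT (fun t => window K (Emx p h) x t * \1_D t).
  by apply: measurable_funM; [exact: (measurable_window hK)|apply: measurable_indic].
have [s [wf sg sX]] : wiener_limit W D (fun t => c * window K (Emx p h) x t + 0 * window K (Emx p h) x t)
    (fun w => c * X w + 0 * X w).
  by apply: wiener_limit_lincomb => //; exact: measurable_funP.
exists s; split => //.
  rewrite (_ : (fun n => _) = (fun n => \int[leb2]_t
    (((c * window K (Emx p h) x t + 0 * window K (Emx p h) x t) * \1_D t - step_fun (s n) t) ^+ 2)%:E)%E)//.
  apply/funext => n; apply: eq_integral => t _.
  by rewrite mul0r addr0 /scaled_window -/c.
rewrite (_ : (fun n => _) = (fun n => \int[P]_w
    ((c * X w + 0 * X w - step_integral (fun t => W t) (s n) w) ^+ 2)%:E)%E)//.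
apply/funext => n; have mS := @measurable_step_integral _ _ _ P W (s n).
apply: ge0_ae_eq_integral => //.
- apply: measurable_sq; apply: measurable_funB => //; exact: measurable_noise.
- apply: measurable_sq; apply: measurable_funB => //.
  by apply: measurable_funD; apply: measurable_funM => //; exact: measurable_funP.
- by move=> w _; rewrite lee_fin sqr_ge0.
- by move=> w _; rewrite lee_fin sqr_ge0.
apply: filterS aeY => w Yw _; congr ((_ - _) ^+ 2)%:E.
rewrite /noise /Fhat /Fhat_mx det_Emx Yw /mean_on_D -/c mul0r addr0.
by field; rewrite gt_eqF.
Qed.

Let indD_le (u : R) t : (u * \1_D t) ^+ 2 <= u ^+ 2.
Proof.
rewrite indicE; case: (t \in D); rewrite ?mulr1// mulr0 expr0n/=.
exact: sqr_ge0.
Qed.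

Let sqrtrK h : 0 < h -> Num.sqrt h ^+ 2 = h.
Proof. by move=> h0; rewrite sqr_sqrtr// ltW. Qed.

Let scale_comb (a b : R) (g1 g2 : R * R -> R) t :
  (a * g1 t + b * g2 t) * \1_D t = a * (g1 t * \1_D t) + b * (g2 t * \1_D t).
Proof. by ring. Qed.

Let measurable_comb a b p q h :
  measurable_fun setT (fun t => (a * scaled_window K p h x t + b * scaled_window K q h x t) * \1_D t).
Proof.
apply: measurable_funM; last by apply: measurable_indic.
by apply: measurable_funD; apply: measurable_funM => //; exact: (measurable_scaled_window hK).
Qed.

Lemma noise_comb_expsq (a b : R) p q h : 0 < h -> 0 < sqnorm p -> 0 < sqnorm q ->
  (\int[leb2]_t ((a * scaled_window K p h x t + b * scaled_window K q h x t) ^+ 2)%:E < 1)%E ->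
  (\int[P]_w (expR (3 / 8 * (a * noise p h w + b * noise q h w) ^+ 2))%:E <= 2)%E.
Proof.
move=> h0 p0 q0 lt1.
apply: (wiener_limit_expsq hW (D := D)
  (g := fun t => a * scaled_window K p h x t + b * scaled_window K q h x t)) => //.
- by apply: measurable_funD; apply: measurable_funM => //; exact: measurable_noise.
- apply: wiener_limit_lincomb; rewrite ?measurable_scaled_window_D//;
    by [exact: measurable_scaled_window_D|exact: measurable_noise|exact: noise_wiener].
apply: le_lt_trans lt1; apply: ge0_le_integral_nomeas => t _; rewrite lee_fin//.
exact: sqr_ge0.
Qed.

(** The kernel has squared norm at most [5/4 kap^4 / h], and [(23/20)^2 > 5/4] supplies the strict
    inequality that the passage to the limit asks for. *)
Lemma noise_expsq p h : 0 < h -> 0 < sqnorm p <= 5 / 4 ->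
  (\int[P]_w (expR (3 / 8 * (Num.sqrt h / (23 / 20 * kap ^+ 2) * noise p h w) ^+ 2))%:E <= 2)%E.
Proof.
move=> h0 /andP[p0 p1]; have k1 := norm_inf_ge1 hK.
have k0 : 0 < kap by apply: lt_le_trans k1.
set a := Num.sqrt h / _.
have E0 (u : R) : a * u = a * u + 0 * u by ring.
under eq_integral => w _ do rewrite (E0 (noise p h w)).
apply: noise_comb_expsq => //.
under eq_integral => t _ do rewrite -E0 exprMn EFinM.
rewrite ge0_integralZl//; last 3 first.
- by apply: measurable_sq; exact: (measurable_scaled_window hK).
- by move=> t _; rewrite lee_fin sqr_ge0.
- by rewrite lee_fin sqr_ge0.
apply: (@le_lt_trans _ _ ((a ^+ 2)%:E * (sqnorm p / h * kap ^+ 4)%:E)%E).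
  by rewrite lee_wpmul2l ?lee_fin ?sqr_ge0//; exact: (integral_scaled_window_sq hK).
rewrite -EFinM lte_fin /a expr_div_n sqrtrK//.
have -> : h / (23 / 20 * kap ^+ 2) ^+ 2 * (sqnorm p / h * kap ^+ 4) = sqnorm p / (23 / 20) ^+ 2.
  by field; rewrite !gt_eqF.
by rewrite ltr_pdivrMr ?exprn_gt0// mul1r; apply: le_lt_trans p1 _; lra.
Qed.

(** The difference of the kernels is bounded by the Lipschitz constant 20 on a box of area 64, so
    its norm carries the factor [20 * 8 = 160]. *)
Lemma noise_diff_expsq p q h (s : R) : 0 < h <= 1 ->
  1 / 16 <= sqnorm p <= 25 / 16 -> 1 / 16 <= sqnorm q <= 25 / 16 ->
  0 < s -> 160 * h^-1 ^+ 2 * (kap * Q) * dist1 p q < s ->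
  (\int[P]_w (expR (3 / 8 * (Num.sqrt h / s * (noise p h w - noise q h w)) ^+ 2))%:E <= 2)%E.
Proof.
move=> h01 hp hq s0 hs.
have /andP[h0 h1] := h01; have /andP[p0 _] := hp; have /andP[q0 _] := hq.
set a := Num.sqrt h / _.
have cmb (u v : R) : a * (u - v) = a * u + - a * v by ring.
under eq_integral => w _ do rewrite cmb.
apply: noise_comb_expsq => //; [by lra|by lra|].
under eq_integral => t _ do rewrite -cmb.
set b := 20 * h^-1 ^+ 2 * (kap * Q) * dist1 p q.
have b0 : 0 <= b.
  by rewrite !mulr_ge0 ?addr_ge0 ?(norm_inf_ge0 hK) ?(ltW (lip_gt0 hK))// invr_ge0 ltW.
apply: (@le_lt_trans _ _ (\int[leb2]_t ((a ^+ 2 * b ^+ 2)%:E *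
    (\1_(box (x.1 - 4, x.2 - 4) (x.1 + 4, x.2 + 4)) t)%:E))%E).
  apply: ge0_le_integral_nomeas => t _; first by rewrite lee_fin sqr_ge0.
  rewrite -EFinM lee_fin exprMn -[leRHS]mulrA ler_wpM2l ?sqr_ge0//.
  have := scaled_window_lip hK x t h01 hp hq; rewrite -/b.
  rewrite indicE; case: (t \in _); rewrite ?mulr1 ?mulr0 => h2.
    by rewrite -real_normK ?num_real// ler_pXn2r ?nnegrE.
  have /eqP : `|scaled_window K p h x t - scaled_window K q h x t| == 0.
    by rewrite eq_le h2/=.
  by move=> /normr0_eq0 ->; rewrite expr0n.
rewrite ge0_integralZl; last 4 first.
- exact: measurableT.
- by apply/measurable_EFinP; apply: measurable_indic; exact: measurable_box.
- by move=> t _; rewrite lee_fin.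
- by rewrite lee_fin mulr_ge0// sqr_ge0.
rewrite -[X in \1_X]setIid integral_leb2_boxI -EFinM lte_fin /overlap/=.
rewrite !minxx !maxxx !max_r; [|lra|lra].
have -> : a ^+ 2 * b ^+ 2 * ((x.1 + 4 - (x.1 - 4)) * (x.2 + 4 - (x.2 - 4))) = h * (160 * h^-1 ^+ 2 * (kap * Q) * dist1 p q / s) ^+ 2.
  by rewrite /a /b expr_div_n sqrtrK//; field; rewrite !gt_eqF.
apply: (@le_lt_trans _ _ ((160 * h^-1 ^+ 2 * (kap * Q) * dist1 p q / s) ^+ 2)).
  by rewrite ler_piMl ?sqr_ge0.
rewrite expr_lt1// ?ltr_pdivrMr ?mul1r//.
apply: divr_ge0; last exact: ltW.
have -> : 160 * h^-1 ^+ 2 * (kap * Q) * dist1 p q = 8 * b by rewrite /b; ring.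
by rewrite mulr_ge0.
Qed.

Let B0 := box (x.1 - 4, x.2 - 4) (x.1 + 4, x.2 + 4).

Let integral_B0 : (\int[leb2]_t (\1_B0 t)%:E = 64%:E)%E.
Proof.
rewrite -[X in \1_X]setIid integral_leb2_boxI /overlap/=.
by rewrite !minxx !maxxx !max_r; [congr EFin; ring|lra|lra].
Qed.

Let integrable_B0 (B : R) : (@leb2 R).-integrable setT (EFin \o (fun t => B * \1_B0 t)).
Proof.
have mB0 : measurable_fun setT (fun t => (\1_B0 t)%:E : \bar R).
  by apply/measurable_EFinP; apply: measurable_indic; exact: measurable_box.
have iB0 : (@leb2 R).-integrable setT (fun t => (\1_B0 t)%:E).
  apply/integrableP; split => //.
  under eq_integral do rewrite /= ger0_norm//.
  by rewrite integral_B0 ltry.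
under [X in integrable _ _ X]eq_fun do rewrite /= EFinM.
by apply: integrableZl; [exact: measurableT|exact: iB0].
Qed.

Let integrable_le_B0 (B : R) (g : R * R -> R) : measurable_fun setT g ->
  (forall t, `|g t| <= B * \1_B0 t) -> (@leb2 R).-integrable D (EFin \o g).
Proof.
move=> mg gB.
have : (@leb2 R).-integrable setT (EFin \o g).
  apply: (le_integrable measurableT _ _ (integrable_B0 B)).
    by apply/measurable_EFinP; exact: mg.
  by move=> t _; rewrite /= lee_fin; apply: le_trans (gB t) _; exact: ler_norm.
exact: integrableS.
Qed.

Let measurable_F : measurable_fun setT (fun t => f (dotp t theta0)).
Proof.
case: hf => mf _; apply: (measurableT_comp mf); rewrite /dotp.
apply: measurable_funD; apply: measurable_funM => //.
Qed.

Let integrable_wF p h : 0 < h <= 1 -> 1 / 16 <= sqnorm p ->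
  (@leb2 R).-integrable D (EFin \o (fun t => window K (Emx p h) x t * f (dotp t theta0))).
Proof.
move=> h01 p0; apply: (integrable_le_B0 (B := kap ^+ 2 * M)).
  by apply: measurable_funM; [exact: (measurable_window hK)|exact: measurable_F].
move=> t; rewrite indicE; have [tb|tb] := boolP (t \in B0).
  rewrite mulr1 normrM; case: hf => _ fM; apply: ler_pM => //.
  by rewrite windowE normrM expr2; apply: ler_pM => //; exact: (kernel_le hK).
rewrite mulr0 (window_out hK h01 p0) ?mul0r ?normr0// => /mem_set.
by rewrite (negbTE tb).
Qed.

Let mean_on_DE p h : 0 < h <= 1 -> 1 / 16 <= sqnorm p ->
  mean_on_D p h = \int[leb2]_(t in D) (scaled_window K p h x t * f (dotp t theta0)).
Proof.
move=> h01 p0; rewrite /mean_on_D -RintegralZl; [|exact: mD|exact: integrable_wF].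
by apply: eq_Rintegral => t _; rewrite /scaled_window mulrA.
Qed.

Let integrable_sF p h : 0 < h <= 1 -> 1 / 16 <= sqnorm p ->
  (@leb2 R).-integrable D (EFin \o (fun t => scaled_window K p h x t * f (dotp t theta0))).
Proof.
move=> h01 p0.
under [X in integrable _ _ X]eq_fun do rewrite /= /scaled_window -mulrA EFinM.
by apply: integrableZl; [exact: mD|exact: integrable_wF].
Qed.

(** The Lipschitz bound integrated over the box: [20 * 64 = 1280]. It serves for the continuity of
    the noise in [p]. *)
Lemma mean_on_D_lip p q h : 0 < h <= 1 ->
  1 / 16 <= sqnorm p <= 25 / 16 -> 1 / 16 <= sqnorm q <= 25 / 16 ->
  `|mean_on_D p h - mean_on_D q h| <= 1280 * h^-1 ^+ 2 * (kap * Q) * M * dist1 p q.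
Proof.
move=> h01 hp hq; have /andP[p0 _] := hp; have /andP[q0 _] := hq.
rewrite !mean_on_DE// -RintegralB; [|exact: mD|exact: integrable_sF|exact: integrable_sF].
set b := 20 * h^-1 ^+ 2 * (kap * Q) * dist1 p q.
have /andP[h0 h1] := h01.
have b0 : 0 <= b.
  by rewrite !mulr_ge0 ?addr_ge0 ?(norm_inf_ge0 hK) ?(ltW (lip_gt0 hK))// invr_ge0 ltW.
have M0 := FM_ge0 hf.
pose g t := scaled_window K p h x t * f (dotp t theta0) - scaled_window K q h x t * f (dotp t theta0).
have gb t : `|g t| <= b * M * \1_B0 t.
  rewrite /g -mulrBl normrM mulrAC; case: hf => _ fM; apply: ler_pM => //.
  exact: (scaled_window_lip hK x t h01 hp hq).
have mg : measurable_fun setT g.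
  by apply: measurable_funB; apply: measurable_funM;
     by [exact: measurable_F|exact: (measurable_scaled_window hK)].
have ig := integrable_le_B0 mg gb.
apply: (@le_trans _ _ (\int[leb2]_(t in D) `|g t|)).
  by apply: le_normr_Rintegral; [exact: mD|exact: ig].
rewrite -lee_fin fineK; last first.
  by apply: integrable_fin_num; [exact: mD|exact: (integrable_abse ig)].
apply: (@le_trans _ _ (\int[leb2]_t (b * M * \1_B0 t)%:E)%E).
  rewrite integral_mkcond; apply: ge0_le_integral_nomeas => t _; rewrite patchE; case: ifP => _.
  - by rewrite lee_fin.
  - by [].
  - by rewrite lee_fin.
  - rewrite lee_fin.  apply: mulr_ge0; first exact: mulr_ge0.  by rewrite /B0 indicE.
under eq_integral do rewrite EFinM.
rewrite ge0_integralZl; last 4 first.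
- exact: measurableT.
- by apply/measurable_EFinP; apply: measurable_indic; exact: measurable_box.
- by move=> t _; rewrite lee_fin indicE.
- by rewrite lee_fin mulr_ge0.
by rewrite integral_B0 -EFinM lee_fin le_eqVlt; apply/orP; left; apply/eqP; rewrite /b; ring.
Qed.

End noise.

Section dominating_variable.
Context {R : realType} {d : measure_display} {T : measurableType d}.
Variables (P : probability T R).
Local Open Scope ereal_scope.

Lemma dominate_nat (V : nat -> T -> \bar R) (c : R) : (0 <= c)%R ->
  (forall n, measurable_fun setT (V n)) -> (forall n w, 0 <= V n w) ->
  (forall n, \int[P]_w V n w <= c%:E) ->
  exists U : T -> \bar R, [/\ measurable_fun setT U, forall w, 0 <= U w,
    \int[P]_w U w <= c%:E & forall n w, ((2 ^ n.+1)%:R^-1)%:E * V n w <= U w].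
Proof.
move=> c0 mV V0 Vc.
pose F n w : \bar R := ((2 ^ n.+1)%:R^-1)%:E * V n w.
have F0 n w : 0 <= F n w by rewrite mule_ge0// lee_fin invr_ge0.
have mF n : measurable_fun setT (F n) by exact: measurable_funeM.
exists (fun w => \sum_(0 <= n <oo) F n w); split.
- by apply: ge0_emeasurable_sum => // n w _ _; exact: F0.
- by move=> w; apply: nneseries_ge0 => n _ _; exact: F0.
- rewrite integral_nneseries//.
  apply: le_trans (@epsilon_trick0 R c xpredT c0).
  apply: lee_nneseries => n *; first exact: integral_ge0.
  rewrite /F ge0_integralZl//.
  by rewrite mulrC EFinM lee_wpmul2l// lee_fin invr_ge0.
- move=> n w; rewrite -/(F n w).
  apply: le_trans (nneseries_lim_ge n.+1 (fun i _ _ => F0 i w)).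
  by rewrite big_nat_recr//= leeDr// sume_ge0.
Qed.

Lemma dominate_ord (N : nat) (V : nat -> T -> \bar R) (c : R) :
  (forall n, measurable_fun setT (V n)) -> (forall n w, 0 <= V n w) ->
  (forall n, \int[P]_w V n w <= c%:E) ->
  exists U : T -> \bar R, [/\ measurable_fun setT U, forall w, 0 <= U w,
    \int[P]_w U w <= c%:E &
    forall n w, (n < N.+1)%N -> (N.+1%:R^-1)%:E * V n w <= U w].
Proof.
move=> mV V0 Vc.
have N0 : (0 <= (N.+1)%:R^-1 :> R)%R by rewrite invr_ge0.
exists (fun w => \sum_(n < N.+1) ((N.+1)%:R^-1)%:E * V n w); split.
- by apply: emeasurable_sum => n; exact: measurable_funeM.
- by move=> w; apply: sume_ge0 => n _; rewrite mule_ge0.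
- rewrite ge0_integral_sum//; last 2 first.
  + by move=> n; exact: measurable_funeM.
  + by move=> n w _; rewrite mule_ge0.
  apply: (@le_trans _ _ (\sum_(n < N.+1) ((N.+1)%:R^-1 * c)%:E)).
    apply: lee_sum => n _; rewrite ge0_integralZl// EFinM.
    by rewrite lee_wpmul2l// lee_fin.
  rewrite sumEFin lee_fin sumr_const card_ord -mulrnAl -mulr_natr mulVf ?mul1r//.
- move=> n w nN; rewrite (bigD1 (Ordinal nN))//= leeDl// sume_ge0// => i _.
  by rewrite mule_ge0.
Qed.

(** A weighted mean of all exponentials: uniform in the two grid indices, geometric in the level [n]
    and in the bandwidth exponent [k]. Each exponential is then at most [V] divided by its weight.
    This replaces a union bound and holds at every [w]. *)
Lemma dominating_variable (N : nat -> nat -> nat) (Z : nat -> nat -> nat -> nat -> T -> R) :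
  (forall k n i j, measurable_fun setT (Z k n i j)) ->
  (forall k n i j, \int[P]_w (expR (3 / 8 * Z k n i j w ^+ 2))%:E <= 2) ->
  exists V : T -> \bar R, [/\ measurable_fun setT V, forall w, 0 <= V w,
    \int[P]_w V w <= 2 &
    forall k n i j w, (i <= N k n)%N -> (j <= N k n)%N ->
      (expR (3 / 8 * Z k n i j w ^+ 2))%:E <=
      ((2 ^ k.+1)%:R * (2 ^ n.+1)%:R * (N k n).+1%:R ^+ 2)%:E * V w].
Proof.
move=> mZ Z2.
pose E k n i j w : \bar R := (expR (3 / 8 * Z k n i j w ^+ 2))%:E.
have mE k n i j : measurable_fun setT (E k n i j).
  apply/measurable_EFinP; apply: measurableT_comp => //.
  by apply: measurable_funM => //; exact: measurable_funX.
have E0 k n i j w : 0 <= E k n i j w by rewrite lee_fin expR_ge0.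
have [V1 V1P] := choice (fun x : nat * nat * nat =>
  @dominate_ord (N x.1.1 x.1.2) (fun j => E x.1.1 x.1.2 x.2 j) 2 (mE _ _ _) (E0 _ _ _) (Z2 _ _ _)).
have [V2 V2P] := choice (fun x : nat * nat =>
  @dominate_ord (N x.1 x.2) (fun i => V1 (x, i)) 2
    (fun i => let: And4 m _ _ _ := V1P (x, i) in m)
    (fun i => let: And4 _ m _ _ := V1P (x, i) in m)
    (fun i => let: And4 _ _ m _ := V1P (x, i) in m)).
have c2 : (0 <= 2 :> R)%R by [].
have [V3 V3P] := choice (fun k : nat =>
  @dominate_nat (fun n => V2 (k, n)) 2 c2
    (fun n => let: And4 m _ _ _ := V2P (k, n) in m)
    (fun n => let: And4 _ m _ _ := V2P (k, n) in m)
    (fun n => let: And4 _ _ m _ := V2P (k, n) in m)).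
have [V [mV V0 V2' VP]] := @dominate_nat V3 2 c2
    (fun n => let: And4 m _ _ _ := V3P n in m)
    (fun n => let: And4 _ m _ _ := V3P n in m)
    (fun n => let: And4 _ _ m _ := V3P n in m).
exists V; split => // k n i j w iN jN.
have [_ _ _ h1] := V1P (k, n, i); have [_ _ _ h2] := V2P (k, n).
have [_ _ _ h3] := V3P k.
have step (a : R) (x y : \bar R) : (0 < a)%R -> (a^-1)%:E * x <= y -> x <= a%:E * y.
  move=> a0 xy; have : a%:E * ((a^-1)%:E * x) <= a%:E * y by rewrite lee_wpmul2l// lee_fin ltW.
  by rewrite muleA -EFinM divff ?mul1e// gt_eqF.
have {}h1 := step _ _ _ (ltr0Sn R _) (h1 j w jN).
have {}h2 := step _ _ _ (ltr0Sn R _) (h2 i w iN).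
have p2 m : (0 < (2 ^ m)%:R :> R)%R by rewrite ltr0n expn_gt0.
have {}h3 := step _ _ _ (p2 _) (h3 n w).
have {}h4 := step _ _ _ (p2 _) (VP k w).
apply: le_trans h1 _.
rewrite [X in _ <= X * _](_ : _ = (N k n).+1%:R%:E * ((N k n).+1%:R%:E * ((2 ^ n.+1)%:R%:E * (2 ^ k.+1)%:R%:E))); last first.
  by rewrite -!EFinM; congr EFin; ring.
rewrite -!muleA lee_wpmul2l ?lee_fin//.
apply: le_trans h2 _; rewrite lee_wpmul2l ?lee_fin//.
by apply: le_trans h3 _; rewrite lee_wpmul2l ?lee_fin// ltW.
Qed.

End dominating_variable.

Section noise_continuity.
Context {R : realType} {d : measure_display} {T : measurableType d}.
Variables (P : probability T R) (K : R -> R) (Q M eps : R).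
Hypotheses (hK : K1 K Q).
Variables (f : R -> R) (theta0 x : R * R).
Hypothesis hf : FM M f.
Variables (D : set (R * R)).
Hypotheses (mD : measurable D).
Variable Y : 'M[R]_2 -> {RV P >-> R}.
Implicit Types (p q : R * R) (h : R).
Notation noise := (noise K eps f theta0 x D Y).

Lemma dist1_ge0 p q : 0 <= dist1 p q. Proof. by rewrite addr_ge0. Qed.

Lemma sqnorm_lip p q : sqnorm p <= 25 / 16 -> sqnorm q <= 25 / 16 ->
  `|sqnorm p - sqnorm q| <= 5 / 2 * dist1 p q.
Proof.
have coord (z : R * R) : sqnorm z <= 25 / 16 -> `|z.1| <= 5 / 4 /\ `|z.2| <= 5 / 4.
  rewrite /sqnorm => z1; have := sqr_ge0 z.1; have := sqr_ge0 z.2.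
  by split; rewrite -(@ler_pXn2r _ 2) ?nnegrE// real_normK ?num_real//; lra.
move=> /coord[p1 p2] /coord[q1 q2].
have -> : sqnorm p - sqnorm q = (p.1 - q.1) * (p.1 + q.1) + (p.2 - q.2) * (p.2 + q.2).
  by rewrite /sqnorm; ring.
apply: le_trans (ler_normD _ _) _; rewrite !normrM /dist1 mulrDr.
by apply: lerD; rewrite mulrC ler_wpM2r//; apply: le_trans (ler_normD _ _) _; lra.
Qed.

Let cvg_lip (u : nat -> R) (l C : R) (dl : nat -> R) : 0 <= C ->
  (forall n, `|l - u n| <= C * dl n) -> dl n @[n --> \oo] --> 0 ->
  u n @[n --> \oo] --> l.
Proof.
move=> C0 ul dl0; apply/cvgrPdist_le => e e0.
have Cd : C * dl n @[n --> \oo] --> 0.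
  by rewrite -(mulr0 C); apply: cvgMr.
have /cvgrPdist_le/(_ _ e0) := Cd.
apply: filterS => n; rewrite sub0r normrN => h.
by apply: le_trans (ul n) _; apply: le_trans h; exact: ler_norm.
Qed.

(** The determinant and the mean are Lipschitz in [p]; for the observed integral, the lower bound on
    [sqnorm] keeps the sequence and its limit among the invertible matrices, where [Y] is
    continuous. *)
Lemma noise_cvg (w : T) p (pn : nat -> R * R) h :
  {within [set E : 'M[R]_2 | E \in unitmx], continuous (fun E => Y E w)} ->
  0 < h <= 1 -> 1 / 16 <= sqnorm p <= 25 / 16 ->
  (forall n, 1 / 16 <= sqnorm (pn n) <= 25 / 16) ->
  dist1 p (pn n) @[n --> \oo] --> 0 ->
  noise (pn n) h w @[n --> \oo] --> noise p h w.
Proof.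
move=> cY h01 hp hpn pnp.
have /andP[h0 h1] := h01; have /andP[p0 p1] := hp.
have c0 : 0 <= 1280 * h^-1 ^+ 2 * (norm_inf K * Q) * M.
  apply: mulr_ge0 (FM_ge0 hf); apply: mulr_ge0.
    by apply: mulr_ge0; [exact: ler0n|exact: sqr_ge0].
  by apply: mulr_ge0; [exact: (norm_inf_ge0 hK)|exact: (ltW (lip_gt0 hK))].
have hV0 : 0 <= h^-1 by rewrite invr_ge0 ltW.
apply: cvgMr; apply: cvgB; last first.
  by apply: (cvg_lip c0 _ pnp) => n; apply: mean_on_D_lip.
rewrite /Fhat /Fhat_mx; under eq_fun do rewrite det_Emx.
rewrite det_Emx; apply: cvgM.
  apply: cvgMl; apply: (@cvg_lip _ _ (5 / 2) _ _ _ pnp) => // n.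
  by have /andP[_ ?] := hpn n; exact: sqnorm_lip.
have cE : Emx (pn n) h @[n --> \oo] --> Emx p h.
  apply/cvg_ballP => e e0.
  have e'0 : 0 < e / (h^-1 + 1) by rewrite divr_gt0// ltr_wpDl.
  have /cvgrPdist_lt/(_ _ e'0) := pnp; apply: filterS => n.
  rewrite sub0r normrN ger0_norm ?dist1_ge0// ltr_pdivlMr ?ltr_wpDl// => close.
  have d1 : `|p.1 - (pn n).1| <= dist1 p (pn n) by rewrite lerDl.
  have d2 : `|p.2 - (pn n).2| <= dist1 p (pn n) by rewrite lerDr.
  have big (u : R) : `|u| <= dist1 p (pn n) -> `|h^-1 * u| < e /\ `|u| < e.
    move=> ud; split; apply: le_lt_trans close.
      rewrite normrM (ger0_norm hV0) mulrDr mulr1 [leRHS]addrC mulrC.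
      by rewrite ler_wpDl ?dist1_ge0// ler_wpM2r.
    by rewrite mulrDr mulr1 ler_wpDl// mulr_ge0 ?dist1_ge0.
  have [b1 b1'] := big _ d1; have [b2 b2'] := big _ d2.
  have key (i j : 'I_2) : `|Emx p h i j - Emx (pn n) h i j| < e.
    rewrite /Emx /mx2 !mxE; case: ifP => _; case: ifP => _.
    - by rewrite -mulrBr.
    - by rewrite -mulrBr.
    - by rewrite opprK addrC distrC.
    - by [].
  by split.
have p_gt0 : 0 < sqnorm p by lra.
have /subspace_continuousP/(_ (Emx p h) (Emx_unit h0 p_gt0)) cYp := cY.
have cw : Emx (pn n) h @[n --> \oo] --> within [set E : 'M[R]_2 | E \in unitmx] (nbhs (Emx p h)).
  move=> A /cE; rewrite !nbhs_filterE !fmapE; apply: filterS => n; apply.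
  by rewrite /=; apply: Emx_unit => //; have /andP[? _] := hpn n; lra.
exact: cvg_comp cw cYp.
Qed.

End noise_continuity.

(** * Dyadic grids of window parameters *)

Section grid.
Context {R : realType}.
Implicit Types (m n i j : nat) (u : R) (p : R * R).

(** Halving an index gives the index of the parent cell. A link is thus determined by its finer end
    point, and the links of a level are as many as its grid points instead of pairs of them. *)
Lemma truncn_double_half u : 0 <= u -> (Num.truncn (2 * u))./2 = Num.truncn u.
Proof.
move=> u0; have u20 : 0 <= 2 * u by rewrite mulr_ge0.
have /andP[h1 h2] := truncn_itv u20.
set m := Num.truncn (2 * u) in h1 h2 *.
apply/esym/truncn_def.
have mE : m%:R = (odd m)%:R + 2 * (m./2)%:R :> R.
  by rewrite -[in LHS](odd_double_half m) natrD -mul2n natrM.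
have b01 : 0 <= ((odd m)%:R : R) <= 1 by case: (odd m); rewrite ler01 lexx.
move: b01 h1 h2; rewrite -[m.+1%:R]natr1 -[(m./2).+1%:R]natr1 mE => /andP[? ?] ? ?.
by apply/andP; split; lra.
Qed.

(** The number of grid points per unit length at level [n], that is, the inverse of the spacing. *)
Definition mesh m n : R := m%:R * 2 ^+ n.

Definition grid_index m n u : nat := Num.truncn ((u + 1) * mesh m n).

Definition grid_coord m n i : R := i%:R / mesh m n - 1.

Definition grid_point m n i j : R * R := (grid_coord m n i, grid_coord m n j).

Lemma mesh_gt0 m n : (0 < m)%N -> 0 < mesh m n.
Proof. by move=> m0; rewrite mulr_gt0 ?ltr0n// exprn_gt0. Qed.

Lemma meshS m n : mesh m n.+1 = 2 * mesh m n.
Proof. by rewrite /mesh exprS mulrCA. Qed.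

Lemma grid_index_half m n u : (0 < m)%N -> -1 <= u ->
  (grid_index m n.+1 u)./2 = grid_index m n u.
Proof.
move=> m0 u1; rewrite /grid_index meshS mulrCA truncn_double_half//.
by rewrite mulr_ge0 ?(ltW (mesh_gt0 _ m0))//; lra.
Qed.

Lemma grid_index_le m n u : (0 < m)%N -> u <= 1 ->
  (grid_index m n u <= 2 * m * 2 ^ n)%N.
Proof.
move=> m0 u1; rewrite /grid_index truncn_le_nat.
apply: (@le_lt_trans _ _ (2 * mesh m n)).
  by rewrite ler_wpM2r ?(ltW (mesh_gt0 _ m0))//; lra.
by rewrite -[ltRHS]natr1 !natrM natrX /mesh -mulrA ltrDl.
Qed.

Lemma grid_coord_itv m n u : (0 < m)%N -> -1 <= u ->
  0 <= u - grid_coord m n (grid_index m n u) < (mesh m n)^-1.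
Proof.
move=> m0 u1; have k0 := mesh_gt0 n m0.
have : 0 <= (u + 1) * mesh m n by rewrite mulr_ge0 ?(ltW k0)//; lra.
move=> /truncn_itv; rewrite -/(grid_index m n u) => /andP[h1 h2].
rewrite /grid_coord opprB addrA.
set i := grid_index m n u in h1 h2 *.
have e : u + 1 = (u + 1) * mesh m n / mesh m n by rewrite mulfK ?gt_eqF.
rewrite e -mulrBl; apply/andP; split.
  by rewrite divr_ge0 ?(ltW k0)// subr_ge0.
by rewrite -[ltRHS]mul1r ltr_pM2r ?invr_gt0// ltrBlDr [1 + _]addrC natr1.
Qed.

Definition grid_approx m n p : R * R :=
  grid_point m n (grid_index m n p.1) (grid_index m n p.2).

Lemma sqnorm_coord p : sqnorm p <= 1 -> -1 <= p.1 <= 1 /\ -1 <= p.2 <= 1.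
Proof.
move=> p1; rewrite -!ler_norml; have := sqr_ge0 p.1; have := sqr_ge0 p.2.
move: p1; rewrite /sqnorm => p1.
by split; rewrite -(@ler_pXn2r _ 2) ?nnegrE// real_normK ?num_real//; lra.
Qed.

Lemma dist1_grid_approx m n p : (0 < m)%N -> sqnorm p <= 1 ->
  dist1 p (grid_approx m n p) <= 2 / mesh m n.
Proof.
move=> m0 /sqnorm_coord[/andP[a1 a2] /andP[b1 b2]].
have /andP[h1 h2] := grid_coord_itv n m0 a1.
have /andP[h3 h4] := grid_coord_itv n m0 b1.
rewrite /dist1 /= (ger0_norm h1) (ger0_norm h3); lra.
Qed.

Lemma dist1_grid_approxS m n p : (0 < m)%N -> sqnorm p <= 1 ->
  dist1 (grid_approx m n.+1 p) (grid_approx m n p) <= 2 / mesh m n.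
Proof.
move=> m0 /sqnorm_coord[/andP[a1 a2] /andP[b1 b2]].
have /andP[h1 h2] := grid_coord_itv n m0 a1.
have /andP[h3 h4] := grid_coord_itv n m0 b1.
have /andP[k1 k2] := grid_coord_itv n.+1 m0 a1.
have /andP[k3 k4] := grid_coord_itv n.+1 m0 b1.
have m1 : (mesh m n.+1)^-1 <= (mesh m n)^-1.
  rewrite lef_pV2 ?posrE ?mesh_gt0// meshS; have := mesh_gt0 n m0; lra.
rewrite /dist1 /=.
set A := grid_coord _ _ _ in k1 k2 *; set B := grid_coord _ _ _ in h1 h2 *.
set A' := grid_coord _ _ _ in k3 k4 *; set B' := grid_coord _ _ _ in h3 h4 *.
have : `|A - B| <= (mesh m n)^-1 by rewrite ler_norml; apply/andP; split; lra.
have : `|A' - B'| <= (mesh m n)^-1 by rewrite ler_norml; apply/andP; split; lra.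
lra.
Qed.

Lemma sqnorm_grid_approx m n p : 100 <= m%:R :> R -> sqnorm p <= 1 ->
  `|sqnorm p - sqnorm (grid_approx m n p)| <= 1 / 10.
Proof.
move=> m100 p1; have [/andP[a1 a2] /andP[b1 b2]] := sqnorm_coord p1.
have m0 : (0 < m)%N by rewrite -(ltr0n R); lra.
have mV : (mesh m n)^-1 <= 1 / 100.
  rewrite -[leRHS]invrK div1r invrK lef_pV2 ?posrE ?mesh_gt0// /mesh.
  by apply: le_trans m100 _; rewrite ler_peMr// exprn_ege1// ler1n.
have /andP[h1 h2] := grid_coord_itv n m0 a1.
have /andP[h3 h4] := grid_coord_itv n m0 b1.
rewrite /sqnorm /=.
set A := grid_coord _ _ _ in h1 h2 *; set B := grid_coord _ _ _ in h3 h4 *.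
have -> : p.1 ^+ 2 + p.2 ^+ 2 - (A ^+ 2 + B ^+ 2) =
  (p.1 - A) * (2 * p.1 - (p.1 - A)) + (p.2 - B) * (2 * p.2 - (p.2 - B)) by ring.
have bnd (e c : R) : 0 <= e -> e <= 1 / 100 -> -1 <= c -> c <= 1 -> `|e * (2 * c - e)| <= 1 / 20.
  move=> e0 e1 c0 c1; rewrite normrM (ger0_norm e0).
  have : `|2 * c - e| <= 3 by rewrite ler_norml; apply/andP; split; lra.
  by move=> h; have := ler_pM e0 (normr_ge0 _) e1 h; lra.
apply: le_trans (ler_normD _ _) _.
have := bnd _ _ h1 (le_trans (ltW h2) mV) a1 a2.
have := bnd _ _ h3 (le_trans (ltW h4) mV) b1 b2.
lra.
Qed.

Lemma cvg_grid_approx m p : (0 < m)%N -> sqnorm p <= 1 ->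
  dist1 p (grid_approx m n p) @[n --> \oo] --> 0.
Proof.
move=> m0 p1.
have g0 : (2 / m%:R) * (1 / 2) ^+ n @[n --> \oo] --> (0 : R).
  rewrite -(mulr0 (2 / m%:R)); apply: cvgMr; apply: cvg_expr.
  by rewrite ger0_norm; lra.
apply: (squeeze_cvgr _ _ g0); last exact: cvg_cst.
apply: nearW => n; rewrite dist1_ge0/=; apply: le_trans (dist1_grid_approx n m0 p1) _.
by rewrite /mesh invfM mulrA expr_div_n expr1n div1r.
Qed.

End grid.

Section chaining.
Context {R : realType} {d : measure_display} {T : measurableType d}.
Variables (P : probability T R) (K : R -> R) (Q M eps : R).
Hypotheses (hK : K1 K Q) (heps : 0 < eps).
Variables (f : R -> R) (theta0 x : R * R).
Hypothesis hf : FM M f.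
Variables (D : set (R * R)) (W : R * R -> {RV P >-> R}).
Hypotheses (mD : measurable D) (hW : brownian_sheet W).
Variable Y : 'M[R]_2 -> {RV P >-> R}.
Hypothesis hY : forall E : 'M[R]_2, E \in unitmx ->
  is_observed_integral W D eps (fun t => f (dotp t theta0)) (window K E x) (Y E).
Hypothesis hYc : {ae P, forall w,
     {within [set E : 'M[R]_2 | E \in unitmx], continuous (fun E => Y E w)}}.
Notation kap := (norm_inf K).
Notation noise := (noise K eps f theta0 x D Y).

Definition bw (k : nat) : R := 2 ^- k.

Lemma bw_itv k : 0 < bw k <= 1.
Proof. by rewrite invr_gt0 exprn_gt0//= invf_le1 ?exprn_gt0// exprn_ege1// ler1n. Qed.

(* The factor [8 ^+ 5 * 4 ^+ k] makes consecutive grids so close that every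
   link is active: it offsets [h^-2] and the constants in [link_active]. *)
Definition meshsize_real k : R := 8 ^+ 5 * 4 ^+ k * (1 + 2 * Q * kap).

Definition meshsize k : nat := (Num.truncn (meshsize_real k)).+1.

Let one_le_C : 1 <= 1 + 2 * Q * kap.
Proof. by rewrite lerDl !mulr_ge0 ?(norm_inf_ge0 hK)// ltW// (lip_gt0 hK). Qed.

(** Here 320 is the constant 160 of the difference bound times the 2 in the distance of consecutive
    approximations, and 100 is the denominator in [link_scale]. *)
Let c5 : 320 * 100 <= 8 ^+ 5 :> R.
Proof. by rewrite !exprS expr0; lra. Qed.

Let meshsize_real_ge k : 100%:R <= meshsize_real k.
Proof.
rewrite /meshsize_real -mulrA; apply: (@le_trans _ _ (8 ^+ 5)); first by lra.
by rewrite ler_peMr ?exprn_ge0// mulr_ege1// exprn_ege1// ler1n.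
Qed.

Let meshsize_gt k : meshsize_real k < (meshsize k)%:R.
Proof. exact: truncnS_gt. Qed.

Definition link_scale n : R := kap ^+ 2 / 100 / 2 ^+ n.

(* With these scales the base point and all links together stay below [2 * kap ^+ 2]. *)
Definition base_scale : R := 23 / 20 * kap ^+ 2.

(** Pairs outside the range of the window estimates get the link 0, so that the moment bound holds
    for all indices at once. The grid approximations of points with [sqnorm] in [[1/4, 1]] change
    [sqnorm] by at most 1/10 and stay within this range. *)
Definition link_active k n (p q : R * R) : bool :=
  [&& 1 / 16 <= sqnorm p <= 25 / 16, 1 / 16 <= sqnorm q <= 25 / 16 &
   160 * (bw k)^-1 ^+ 2 * (kap * Q) * dist1 p q < link_scale n].

Definition link k n i j (w : T) : R :=
  if n is n'.+1 then
    let p := grid_point (meshsize k) n i j in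
    let q := grid_point (meshsize k) n' i./2 j./2 in
    if link_active k n' p q then
      Num.sqrt (bw k) / link_scale n' * (noise p (bw k) w - noise q (bw k) w)
    else 0
  else let p := grid_point (meshsize k) 0 i j in
    if 0 < sqnorm p <= 5 / 4 then Num.sqrt (bw k) / base_scale * noise p (bw k) w
    else 0.

Let kap_gt0 : 0 < kap. Proof. exact: lt_le_trans ltr01 (norm_inf_ge1 hK). Qed.

Lemma link_scale_gt0 n : 0 < link_scale n.
Proof. by rewrite /link_scale !divr_gt0 ?exprn_gt0. Qed.

Lemma measurable_link k n i j : measurable_fun setT (link k n i j).
Proof.
case: n => [|n]; rewrite /link/=; [case: (_ && _)|case: (link_active _ _ _ _)] => //.
  by apply: measurable_funM => //; exact: measurable_noise.
by apply: measurable_funM => //; apply: measurable_funB; exact: measurable_noise.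
Qed.

Lemma link_expsq k n i j : (\int[P]_w (expR (3 / 8 * link k n i j w ^+ 2))%:E <= 2)%E.
Proof.
have zero : (\int[P]_w (expR (3 / 8 * (0 : R) ^+ 2))%:E <= 2)%E.
  under eq_integral do rewrite expr0n/= mulr0 expR0.
  rewrite integral_cst// mul1e; apply: le_trans (probability_le1 P measurableT) _.
  by rewrite lee_fin ler1n.
have /andP[h0 h1] := bw_itv k.
case: n => [|n]; rewrite /link/=.
  case E: (_ && _) => //.
  exact: (noise_expsq hK heps mD hW hY).
case E: (link_active _ _ _ _) => //.
have /and3P[hp hq dpq] := E.
exact: (noise_diff_expsq hK heps mD hW hY (bw_itv k) hp hq (link_scale_gt0 n) dpq).
Qed.

Let bwV2 k : (bw k)^-1 ^+ 2 = 4 ^+ k.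
Proof. by rewrite /bw invrK -exprM mulnC exprM; congr (_ ^+ k); rewrite expr2; ring. Qed.

Lemma link_active_approx k n p : 1 / 4 <= sqnorm p <= 1 ->
  link_active k n (grid_approx (meshsize k) n.+1 p) (grid_approx (meshsize k) n p).
Proof.
move=> /andP[p0 p1].
have m100 : 100%:R <= (meshsize k)%:R :> R.
  exact: le_trans (meshsize_real_ge k) (ltW (meshsize_gt k)).
have m0 : (0 < meshsize k)%N by [].
have good m : 1 / 16 <= sqnorm (grid_approx (meshsize k) m p) <= 25 / 16.
  have := sqnorm_grid_approx m m100 p1; rewrite ler_norml => /andP[? ?].
  by apply/andP; split; lra.
rewrite /link_active !good/=.
have C0 : 0 <= 160 * (bw k)^-1 ^+ 2 * (kap * Q).
  apply: mulr_ge0; first by apply: mulr_ge0; [exact: ler0n|exact: sqr_ge0].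
  by apply: mulr_ge0; [exact: ltW|exact: (ltW (lip_gt0 hK))].
apply: le_lt_trans (ler_wpM2l C0 (dist1_grid_approxS n m0 p1)) _.
rewrite bwV2 /link_scale /mesh invfM.
have n2 : 0 < (2 ^+ n)^-1 :> R by rewrite invr_gt0 exprn_gt0.
rewrite !mulrA ltr_pM2r//.
have mk := meshsize_gt k; have mk0 : 0 < (meshsize k)%:R :> R by rewrite ltr0n.
rewrite ltr_pdivrMr//.
have k1 := norm_inf_ge1 hK.
apply: (@le_lt_trans _ _ (meshsize_real k * (1 / 100))); last first.
  have : 1 <= kap ^+ 2 by rewrite exprn_ege1.
  move: mk mk0; move: (meshsize k)%:R (meshsize_real k) => a b ab a0 k2.
  by have := ler_wpM2r (ltW a0) k2; lra.
rewrite /meshsize_real; move: c5; set c : R := 8 ^+ 5 => hc.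
set Z : R := 4 ^+ k; set y := kap * Q.
have y0 : 0 < y by rewrite mulr_gt0// (lip_gt0 hK).
have Z0 : 0 < Z by rewrite exprn_gt0.
have -> : 160 * Z * kap * Q * 2 = 320 * (Z * y) by rewrite /y; ring.
have -> : c * Z * (1 + 2 * Q * kap) * (1 / 100) = (c * Z + 2 * (c * (Z * y))) / 100.
  by rewrite /y; ring.
have cZ : 0 < c * Z by rewrite mulr_gt0//; lra.
have := ler_wpM2r (ltW (mulr_gt0 Z0 y0)) hc.
have := mulr_gt0 Z0 y0; lra.
Qed.

Definition grid_size k n : nat := (2 * meshsize k * 2 ^ n)%N.

(** Logarithm of the inverse weight, in the dominating variable, of the links of level 0 at
    bandwidth [bw k]. *)
Definition entropy k : R := ln (2 ^+ k.+2 * (grid_size k 0).+1%:R ^+ 2).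

Let weight0 k : R := 2 ^+ k.+2 * (grid_size k 0).+1%:R ^+ 2.

Let weight0_ge8 k : 8 <= weight0 k.
Proof.
have : 1 <= 2 ^+ k :> R by rewrite exprn_ege1// ler1n.
have : 2 <= (grid_size k 0).+1%:R :> R by rewrite ler_nat /grid_size.
rewrite /weight0 !exprS; nra.
Qed.

(** Each further level multiplies the inverse weight by at most 8: 2 for the level and 4 for the
    finer grid. Since [weight0 k >= 8], level [n] costs at most [n + 1] times the entropy of level
    0. *)
Let weight_le k n :
  (2 ^ k.+1)%:R * (2 ^ n.+1)%:R * (grid_size k n).+1%:R ^+ 2 <= weight0 k ^+ n.+1.
Proof.
have h : (grid_size k n).+1%:R <= 2 ^+ n * (grid_size k 0).+1%:R :> R.
  rewrite -natrX -natrM ler_nat /grid_size expn0 muln1 mulnS mulnC.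
  by rewrite -addn1 addnC leq_add2r expn_gt0.
apply: (@le_trans _ _ (weight0 k * 8 ^+ n)); last first.
  rewrite exprS ler_wpM2l//; first by apply: le_trans (weight0_ge8 k).
  by rewrite lerXn2r// nnegrE// (le_trans _ (weight0_ge8 k)).
rewrite /weight0 !natrX.
have h2 : (grid_size k n).+1%:R ^+ 2 <= 4 ^+ n * (grid_size k 0).+1%:R ^+ 2 :> R.
  have -> : 4 ^+ n = (2 ^+ n) ^+ 2 :> R by rewrite -exprM mulnC exprM; congr (_ ^+ n); ring.
  by rewrite -exprMn lerXn2r// nnegrE// mulr_ge0// exprn_ge0.
apply: (@le_trans _ _ (2 ^+ k.+1 * 2 ^+ n.+1 * (4 ^+ n * (grid_size k 0).+1%:R ^+ 2))).
  by rewrite ler_wpM2l// mulr_ge0// exprn_ge0.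
rewrite le_eqVlt; apply/orP; left; apply/eqP.
have -> : 8 ^+ n = 2 ^+ n * 4 ^+ n :> R by rewrite -exprMn; congr (_ ^+ n); ring.
by rewrite !exprS; ring.
Qed.

Lemma entropy_ge0 k : 0 <= entropy k.
Proof.
rewrite /entropy -/(weight0 k) ln_ge0//; have := weight0_ge8 k; lra.
Qed.

(** Where [V <= exp u], a link of level [n] satisfies [3/8 l^2 <= (n + 1) (u + entropy)], and the
    scales [2^-n] outweigh the growth [sqrt (n + 1)]. These inequalities hold at every [w]; the
    exceptional null set is only that of the continuity of [Y]. *)
Lemma noise_chaining : exists V : T -> \bar R, [/\ measurable_fun setT V,
    forall w, (0 <= V w)%E, (\int[P]_w V w <= 2)%E &
    {ae P, forall w, forall k p u, 1 / 4 <= sqnorm p <= 1 -> 0 <= u ->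
      (V w <= (expR u)%:E)%E ->
      Num.sqrt (bw k) * `|noise p (bw k) w| <= 2 * kap ^+ 2 * Num.sqrt (u + entropy k)}].
Proof.
have [V [mV V0 V2 VP]] := @dominating_variable _ _ _ P grid_size link measurable_link link_expsq.
exists V; split => //; apply: filterS hYc => w cY k p u hp u0 Vu.
have /andP[p0 p1] := hp.
have hk := bw_itv k; have /andP[h0 h1] := hk.
set L := u + entropy k.
have L0 : 0 <= L by rewrite addr_ge0// entropy_ge0.
have m0 : (0 < meshsize k)%N by [].
have [/andP[a1 a2] /andP[b1 b2]] := sqnorm_coord p1.
pose g q := Num.sqrt (bw k) * noise q (bw k) w.
pose pn n := grid_approx (meshsize k) n p.
pose a := Num.sqrt (8 / 3 * L).
have a_ge0 : 0 <= a by exact: sqrtr_ge0.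
have key n : `|link k n (grid_index (meshsize k) n p.1) (grid_index (meshsize k) n p.2) w| <=
    a * Num.sqrt n.+1%:R.
  set l := link _ _ _ _ _.
  have := VP k n _ _ w (grid_index_le n m0 a2) (grid_index_le n m0 b2); rewrite -/l => hl.
  have wt0 : 0 <= (2 ^ k.+1)%:R * (2 ^ n.+1)%:R * (grid_size k n).+1%:R ^+ 2 :> R.
    by rewrite !mulr_ge0// exprn_ge0.
  have : ((expR (3 / 8 * l ^+ 2))%:E <= (weight0 k ^+ n.+1 * expR u)%:E)%E.
    apply: le_trans hl _; apply: (@le_trans _ _ (((2 ^ k.+1)%:R * (2 ^ n.+1)%:R * (grid_size k n).+1%:R ^+ 2)%:E * (expR u)%:E)%E).
      by rewrite lee_wpmul2l// lee_fin.
    by rewrite -EFinM lee_fin ler_wpM2r ?expR_ge0// weight_le.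
  have w0 : 0 < weight0 k by apply: lt_le_trans (weight0_ge8 k).
  have -> : weight0 k ^+ n.+1 * expR u = expR (n.+1%:R * entropy k + u).
    by rewrite expRD expRM_natl /entropy -/(weight0 k) lnK// posrE.
  rewrite lee_fin ler_expR => hl2.
  rewrite /a -sqrtrM ?mulr_ge0// -sqrtr_sqr ler_sqrt ?mulr_ge0//.
  have n1 : 1 <= n.+1%:R :> R by rewrite ler1n.
  have : u <= n.+1%:R * u by rewrite ler_peMl.
  rewrite /L; lra.
have base : `|g (pn 0%N)| <= base_scale * a.
  have m100 : 100%:R <= (meshsize k)%:R :> R.
    exact: le_trans (meshsize_real_ge k) (ltW (meshsize_gt k)).
  have := key 0%N; rewrite sqrtr1 mulr1 /link -/(pn 0%N).
  have := sqnorm_grid_approx 0 m100 p1; rewrite ler_norml -/(pn 0%N) => /andP[? ?].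
  rewrite ifT; last by apply/andP; split; lra.
  have bs0 : 0 < base_scale by rewrite /base_scale mulr_gt0 ?exprn_gt0.
  by rewrite mulrAC -/(g _) normrM normfV (gtr0_norm bs0) ler_pdivrMr// mulrC.
have step n : `|g (pn n.+1) - g (pn n)| <= link_scale n * a * Num.sqrt n.+2%:R.
  have := key n.+1; rewrite /link !grid_index_half// -/(pn n.+1) -/(pn n).
  rewrite link_active_approx// mulrAC mulrBr -/(g _) -/(g _).
  have ls0 := link_scale_gt0 n.
  by rewrite normrM normfV (gtr0_norm ls0) ler_pdivrMr// mulrC mulrA.
(* A geometric majorant: with the scale [2^-n] the increments decay like [(3/4)^n]. *)
have sqrt_le n : Num.sqrt n.+2%:R <= (3 / 2) ^+ n.+1 :> R.
  have pow m : m.+1%:R <= (9 / 4) ^+ m :> R.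
    elim: m => [|m IHm]; first by rewrite expr0.
    have : 0 <= m%:R :> R by [].
    by move: IHm; rewrite exprS -[m.+2%:R]natr1 -[m.+1%:R]natr1; lra.
  rewrite -[leRHS]ger0_norm ?exprn_ge0// -sqrtr_sqr ler_sqrt ?exprn_ge0//.
  rewrite -exprM mulnC exprM (_ : (3 / 2) ^+ 2 = 9 / 4 :> R); first exact: pow.
  by rewrite expr2; field.
(* The increments are at most [3/200 (3/4)^n] in units of [kap^2 a], with sum 6/100; with the base
   23/20 the total stays below 121/100. *)
have sum n : `|g (pn n)| <= kap ^+ 2 * a * (23 / 20 + 6 / 100 * (1 - (3 / 4) ^+ n)).
  elim: n => [|n IH].
    by apply: le_trans base _; rewrite le_eqVlt; apply/orP; left; apply/eqP; rewrite /base_scale expr0; field.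
  have st : `|g (pn n.+1) - g (pn n)| <= kap ^+ 2 * a * (3 / 200 * (3 / 4) ^+ n).
    apply: le_trans (step n) _.
    have c0 : 0 <= link_scale n * a by rewrite mulr_ge0// ltW// link_scale_gt0.
    apply: le_trans (ler_wpM2l c0 (sqrt_le n)) _.
    have -> : (3 / 4) ^+ n = (3 / 2) ^+ n / 2 ^+ n :> R.
      by rewrite -expr_div_n; congr (_ ^+ n); field.
    rewrite /link_scale (exprS _ n) le_eqVlt; apply/orP; left; apply/eqP.
    move: ((3 / 2) ^+ n) => z; field.
    by rewrite expf_neq0.
  have -> : g (pn n.+1) = g (pn n) + (g (pn n.+1) - g (pn n)) by ring.
  apply: le_trans (ler_normD _ _) _; apply: le_trans (lerD IH st) _.
  by rewrite (exprS _ n) le_eqVlt; apply/orP; left; apply/eqP; field.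
have bound n : `|g (pn n)| <= 2 * kap ^+ 2 * Num.sqrt L.
  have ka0 : 0 <= kap ^+ 2 * a by rewrite mulr_ge0// sqr_ge0.
  apply: le_trans (sum n) _.
  apply: (@le_trans _ _ (kap ^+ 2 * a * (121 / 100))).
    rewrite ler_wpM2l//; have : 0 <= (3 / 4) ^+ n :> R by rewrite exprn_ge0.
    lra.
  rewrite /a sqrtrM//.
  (* The factor [sqrt (8/3)] is the weight 3/8 undone; times 121/100 it is at most the constant 2 of
     the claim. *)
  have s83 : Num.sqrt (8 / 3) <= 200 / 121 :> R.
    rewrite -[leRHS]ger0_norm// -sqrtr_sqr ler_sqrt ?exprn_ge0//.
    by rewrite expr2; lra.
  have := ler_wpM2l (sqr_ge0 kap) (ler_wpM2r (sqrtr_ge0 L) s83).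
  move: (kap ^+ 2) (Num.sqrt (8 / 3)) (Num.sqrt L) => k2 s l; lra.
have cg : `|g (pn n)| @[n --> \oo] --> `|g p|.
  apply: cvg_norm; apply: cvgMr.
  have m100 : 100%:R <= (meshsize k)%:R :> R.
    exact: le_trans (meshsize_real_ge k) (ltW (meshsize_gt k)).
  apply: (noise_cvg hK hf mD cY hk).
  - by apply/andP; split; lra.
  - move=> n; have := sqnorm_grid_approx n m100 p1; rewrite ler_norml => /andP[? ?].
    by apply/andP; split; lra.
  - exact: cvg_grid_approx.
rewrite -[X in X * _ <= _]ger0_norm ?sqrtr_ge0// -normrM -/(g p).
by apply: (cvgr_to_le cg); apply: nearW.
Qed.

End chaining.

(** * Constants *)

Section entropy.
Context {R : realType}.
Variables (K : R -> R) (Q eps : R).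
Hypotheses (hK : K1 K Q) (eps0 : 0 < eps).
Notation kap := (norm_inf K).
Notation ell := (ln (1 / eps)).

(** The weight is at most [2^36 (2^k)^5 C^2]. As [ln 2 <= 1 <= ell] and [k ln 2 <= 2 ell], its
    logarithm is at most [(36 + 5 * 2) ell + 2 ln C]. *)
Lemma entropy_le k : 1 <= ell -> eps ^+ 2 <= bw k ->
  entropy K Q k <= 46 * ell + 2 * ln (1 + 2 * Q * kap).
Proof.
move=> l1 hk.
set C := 1 + 2 * Q * kap.
have C1 : 1 <= C by rewrite /C lerDl !mulr_ge0 ?(norm_inf_ge0 hK)// ltW// (lip_gt0 hK).
have C0 : 0 < C by lra.
have ln2_le : ln (2 : R) <= 1 by have := @le_ln1Dx R 1; rewrite -natr1; apply; lra.
have ln2_ge : 0 <= ln (2 : R) by rewrite ln_ge0// ler1n.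
have kl : k%:R * ln 2 <= 2 * ell.
  have : (2 : R) ^+ k <= (1 / eps) ^+ 2.
    move: hk; rewrite /bw div1r exprVn -lef_pV2 ?posrE ?exprn_gt0 ?invr_gt0 ?exprn_gt0//.
    by rewrite invrK.
  rewrite -ler_ln ?posrE ?exprn_gt0 ?divr_gt0// !lnXn ?divr_gt0//.
  by rewrite -[ln 2 *+ k]mulr_natl -[ell *+ 2]mulr_natl.
have x1 : 3 <= meshsize_real K Q k.
  rewrite /meshsize_real -/C -mulrA; apply: (@le_trans _ _ (8 ^+ 5)).
    by rewrite !exprS expr0; lra.
  by rewrite ler_peMr ?exprn_ge0// mulr_ege1// exprn_ege1// ler1n.
have Nle : (grid_size K Q k 0).+1%:R <= 3 * meshsize_real K Q k.
  have : (Num.truncn (meshsize_real K Q k))%:R <= meshsize_real K Q k.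
    by rewrite truncn_le; lra.
  rewrite /grid_size expn0 muln1 /meshsize -[(_ * _).+1%:R]natr1 natrM -[_.+1%:R]natr1.
  lra.
have N0 : 0 < (grid_size K Q k 0).+1%:R :> R by [].
apply: (@le_trans _ _ (ln (2 ^+ 36 * (2 ^+ k) ^+ 5 * C ^+ 2))).
  have P1 : 0 < 2 ^+ k.+2 * (grid_size K Q k 0).+1%:R ^+ 2 :> R.
    by apply: mulr_gt0; apply: exprn_gt0.
  have P2 : 0 < 2 ^+ 36 * (2 ^+ k) ^+ 5 * C ^+ 2.
    by apply: mulr_gt0; [apply: mulr_gt0; apply: exprn_gt0 => //; exact: exprn_gt0|exact: exprn_gt0].
  rewrite /entropy ler_ln ?posrE//.
  apply: (@le_trans _ _ (2 ^+ k.+2 * (3 * meshsize_real K Q k) ^+ 2)).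
    by rewrite ler_wpM2l ?exprn_ge0// lerXn2r// nnegrE//; lra.
  rewrite /meshsize_real -/C.
  have -> : 4 ^+ k = (2 ^+ k) ^+ 2 :> R by rewrite -exprM mulnC exprM; congr (_ ^+ k); ring.
  have -> : 8 ^+ 5 = 2 ^+ 15 :> R by rewrite -[15%N]/(3 * 5)%N exprM; congr (_ ^+ 5); ring.
  rewrite 2!exprS; set z : R := 2 ^+ k.
  have z0 : 0 <= z by rewrite exprn_ge0.
  have -> : 2 * (2 * z) * (3 * (2 ^+ 15 * z ^+ 2 * C)) ^+ 2 = 36 * (2 ^+ 30 * (z ^+ 5 * C ^+ 2)).
    by rewrite -[30%N]/(15 * 2)%N (exprM _ 15); ring.
  have -> : 2 ^+ 36 * z ^+ 5 * C ^+ 2 = 64 * (2 ^+ 30 * (z ^+ 5 * C ^+ 2)).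
    rewrite -[36%N]/(6 + 30)%N exprD (_ : 2 ^+ 6 = 64); last by ring.
    by rewrite !mulrA.
  by rewrite ler_wpM2r ?mulr_ge0 ?exprn_ge0 ?(ltW C0)//; lra.
have lnM3 (a b c : R) : 0 < a -> 0 < b -> 0 < c -> ln (a * b * c) = ln a + ln b + ln c.
  by move=> a0 b0 c0; rewrite lnM ?posrE ?mulr_gt0// lnM ?posrE.
rewrite lnM3 ?exprn_gt0//.
rewrite !lnXn ?exprn_gt0//.
have -> : ln C *+ 2 = 2 * ln C by ring.
have -> : ln 2 *+ k *+ 5 = 5 * (k%:R * ln 2) :> R.
  by rewrite -[ln 2 *+ k]mulr_natl -[(k%:R * ln 2) *+ 5]mulr_natl.
have -> : ln 2 *+ 36 = 36 * ln 2 :> R by rewrite mulr_natl.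
lra.
Qed.

End entropy.

(** * Gaussian absolute moments: finiteness and lower bounds *)

Section gauss_moments.
Context {R : realType}.
Variable q : R.
Hypothesis q1 : 1 <= q.
Notation mu := (@lebesgue_measure R).
Notation gau := (normal_prob (0 : R) 1).

Let mp : measurable_fun setT (fun z : R => ((1 + `|z|) `^ q)%:E).
Proof.
apply/measurable_EFinP; apply: (measurableT_comp (measurable_powR q)).
by apply: measurable_funD => //; exact: measurableT_comp.
Qed.

Let powE (z : R) : (1 + `|z|) `^ q = expR (q * ln (1 + `|z|)).
Proof. by rewrite /powR gt_eqF// ltr_pwDl. Qed.

(** Since [ln (1 + |z|) <= |z|] and [q |z| <= 3/8 z^2 + 2/3 q^2], the known exponential moment
    dominates. Finiteness matters because [gauss_c] takes the finite part of this integral. *)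
Lemma gauss_integral_lty : (\int[gau]_z ((1 + `|z|) `^ q)%:E < +oo)%E.
Proof.
apply: (@le_lt_trans _ _ ((expR (2 / 3 * q ^+ 2))%:E * 2)%E); last by rewrite -EFinM ltry.
apply: (@le_trans _ _ (\int[gau]_z ((expR (2 / 3 * q ^+ 2))%:E * (expR (3 / 8 * z ^+ 2))%:E))%E).
  apply: ge0_le_integral_nomeas => z _; rewrite -?EFinM lee_fin ?powR_ge0// powE -expRD ler_expR.
  have h1 : ln (1 + `|z|) <= `|z| by apply: le_ln1Dx; apply: lt_le_trans (normr_ge0 z).
  have h2 : q * ln (1 + `|z|) <= q * `|z| by rewrite ler_wpM2l//; apply: le_trans q1.
  apply: le_trans h2 _; rewrite -[z ^+ 2]real_normK ?num_real//.
  have := sqr_ge0 (3 * `|z| - 4 * q); nra.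
have me : measurable_fun setT (fun z : R => (expR (3 / 8 * z ^+ 2))%:E).
  apply/measurable_EFinP; apply: measurableT_comp => //.
  by apply: measurable_funM => //; exact: measurable_funX.
rewrite ge0_integralZl ?lee_fin ?expR_ge0//.
rewrite lee_wpmul2l ?lee_fin ?expR_ge0//.
have := @normal_expsq_le2 R 1; rewrite sqrtr1; apply.
by rewrite ltr01 lexx.
Qed.

Definition gauss_moment : R := \int[gau]_z ((1 + `|z|) `^ q).

Lemma gauss_momentE : (gauss_moment%:E = \int[gau]_z ((1 + `|z|) `^ q)%:E)%E.
Proof.
rewrite fineK// ge0_fin_numE ?gauss_integral_lty//.
by apply: integral_ge0 => z _; rewrite lee_fin powR_ge0.
Qed.

Let q_gt0 : 0 < q. Proof. exact: lt_le_trans q1. Qed.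

Lemma gauss_moment_ge1 : 1 <= gauss_moment.
Proof.
rewrite -lee_fin gauss_momentE.
apply: (@le_trans _ _ (\int[gau]_z (cst 1%E z))%E).
  by rewrite integral_cst// mul1e [leRHS](_ : _ = 1%E)//; exact: integral_normal_pdf.
apply: ge0_le_integral_nomeas => z _ //; rewrite lee_fin powE -[leLHS]expR0 ler_expR.
by rewrite mulr_ge0 ?(ltW q_gt0)// ln_ge0// lerDl.
Qed.

Let gauss_c_E : gauss_c q = gauss_moment `^ q^-1. Proof. by []. Qed.

Let rt (a : R) : 0 <= a -> (a `^ q) `^ q^-1 = a.
Proof. by move=> a0; rewrite -powRrM divff ?gt_eqF// powRr1. Qed.

Let mono (a b : R) : 0 <= a -> a <= b -> a `^ q^-1 <= b `^ q^-1.
Proof.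
move=> a0 ab; apply: ge0_ler_powR; rewrite ?nnegrE ?invr_ge0 ?(ltW q_gt0)//.
exact: le_trans ab.
Qed.

Lemma gauss_c_ge1 : 1 <= gauss_c q.
Proof.
rewrite gauss_c_E [leLHS](_ : 1 = 1 `^ q^-1); first exact: mono gauss_moment_ge1.
by rewrite powR1.
Qed.

(* The normal density is at least exp(- q / 2) / 3 on [sqrt q - 1, sqrt q], where 1 + |z| >= sqrt q. *)
Lemma gauss_moment_ge : 1 / 3 * expR (- q / 2) * Num.sqrt q `^ q <= gauss_moment.
Proof.
set m := Num.sqrt q.
have m1 : 1 <= m by rewrite -[leLHS]sqrtr1 ler_sqrt// (le_trans ler01).
rewrite -lee_fin gauss_momentE ge0_integral_normal_prob//.

pose c := 1 / 3 * expR (- q / 2) * m `^ q.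
have c0 : 0 <= c by rewrite !mulr_ge0 ?expR_ge0 ?powR_ge0.
apply: (@le_trans _ _ (\int[mu]_z (c%:E * (\1_`[(m - 1)%R, m] z)%:E))%E).
  rewrite ge0_integralZl//; last exact/measurable_EFinP/measurable_indic.
  rewrite integral_indic// setIT /= lebesgue_measure_itv/= lte_fin ifT; last by lra.
  by rewrite -EFinB -EFinM lee_fin; apply: ler_peMr => //; lra.
apply: ge0_le_integral_nomeas => z _; first by rewrite mule_ge0.
rewrite -!EFinM lee_fin indicE; have [|] := boolP (z \in _); last first.
  by move=> _; rewrite mulr0 mulr_ge0 ?powR_ge0 ?normal_pdf_ge0.
rewrite inE/= in_itv/= mulr1 => /andP[z1 z2].
have z0 : 0 <= z by lra.
rewrite /c mulrC; apply: ler_pM.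
- by rewrite powR_ge0.
- by rewrite mulr_ge0 ?expR_ge0.
- apply: ge0_ler_powR; rewrite ?nnegrE ?(ltW q_gt0) ?addr_ge0//; first by lra.
  by rewrite (ger0_norm z0); lra.
rewrite /normal_pdf gt_eqF//; apply: ler_pM; rewrite ?expR_ge0//.
- rewrite /normal_peak div1r lef_pV2 ?posrE ?sqrtr_gt0//; last first.
    by rewrite mulrn_wgt0// mulr_gt0 ?pi_gt0.
  rewrite -[leRHS](@ger0_norm _ 3)// -[leRHS]sqrtr_sqr ler_sqrt ?exprn_ge0//.
  have [/andP[_ pi4] _] := pihalf_02_cos_pihalf R.
  rewrite expr1n mul1r -mulr_natr; lra.
- rewrite /normal_fun ler_expR subr0 expr1n.
  have : z ^+ 2 <= m ^+ 2 by rewrite lerXn2r ?nnegrE//; lra.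
  rewrite sqr_sqrtr ?(ltW q_gt0)// => h; lra.
Qed.

(** The factors lost in the root are [(1/3)^(1/q) >= 1/3] and [exp (- 1/2) >= 1/2]. The growth in
    [sqrt q] lets the constants of the statement absorb the deviation terms [sqrt r]. *)
Lemma gauss_c_ge_sqrt : Num.sqrt q / 6 <= gauss_c q.
Proof.
rewrite gauss_c_E; set m := Num.sqrt q.
have m0 : 0 <= m by exact: sqrtr_ge0.
have e0 : 0 <= 1 / 3 * expR (- q / 2) by rewrite mulr_ge0 ?expR_ge0.
apply: le_trans (mono _ gauss_moment_ge); last by rewrite mulr_ge0 ?powR_ge0.
rewrite powRM ?powR_ge0// rt// powRM ?expR_ge0//.
have qV0 : 0 < q^-1 by rewrite invr_gt0.
have h1 : (1 / 3 : R) <= (1 / 3) `^ q^-1.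
  rewrite -[leLHS]powRr1//; apply: ger_powR; first by apply/andP; split; lra.
  by rewrite invf_le1.
have h2 : (1 / 2 : R) <= expR (- q / 2) `^ q^-1.
  rewrite -expRM (_ : - q / 2 * q^-1 = - (1 / 2)); last by field; rewrite gt_eqF.
  by have := expR_ge1Dx (- (1 / 2) : R); lra.
rewrite mulrC ler_wpM2r//.
by have := ler_pM _ _ h1 h2; rewrite (_ : 1 / 3 * (1 / 2) = 6^-1 :> R); [apply; lra|field].
Qed.

End gauss_moments.

(** * The oracle bandwidth and the selection rule *)

Section oracle.
Context {R : realType}.
Variables (K : R -> R) (Q M eps : R) (f : R -> R).
Hypotheses (hK : K1 K Q) (hf : FM M f) (eps0 : 0 < eps).
Notation kap := (norm_inf K).
Notation nK := (Lp_norm 1%E K).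
Notation ell := (ln (1 / eps)).
Hypotheses (heps : eps <= expR (- Num.max 1 ((2 * M * nK / kap) ^+ 2))).

Let kap_gt0 : 0 < kap. Proof. exact: lt_le_trans ltr01 (norm_inf_ge1 hK). Qed.

Let max_le : Num.max 1 ((2 * M * nK / kap) ^+ 2) <= ell.
Proof.
rewrite div1r lnV ?posrE// lerNr -ler_expR lnK//.
Qed.

Lemma ell_ge1 : 1 <= ell.
Proof. by apply: le_trans max_le; rewrite le_max lexx. Qed.

Lemma eps_lt1 : eps < 1.
Proof.
apply: le_lt_trans heps _; rewrite -[ltRHS]expR0 ltr_expR oppr_lt0.
by rewrite lt_max ltr01.
Qed.

(** The form in which the smallness of [eps] enters the bias: the trivial bound [2 M |K|_1] on
    [Delta_star] is below the noise level at bandwidth [eps^2], so this bandwidth competes in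
    [hstar]. *)
Lemma signal_le_noise : 2 * M * nK <= kap * Num.sqrt ell.
Proof.
have h : (2 * M * nK / kap) ^+ 2 <= ell by apply: le_trans max_le; rewrite le_max lexx orbT.
have a0 : 0 <= 2 * M * nK / kap.
  by rewrite !mulr_ge0 ?invr_ge0 ?(ltW kap_gt0) ?(FM_ge0 hf) ?(Lp_norm1_kernel_ge0 hK).
rewrite [leRHS]mulrC -ler_pdivrMr// -(ger0_norm a0) -sqrtr_sqr ler_sqrt//.
by apply: le_trans ell_ge1.
Qed.

Lemma Delta_mono (h h' z : R) : 0 < h -> h <= h' -> Delta K f h z <= Delta K f h' z.
Proof.
move=> h0 hh'; apply: ge_sup; first by eexists; exists h => //=; rewrite h0 lexx.
move=> _ [de /= /andP[de0 deh] <-]; apply: ub_le_sup.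
  by exists (2 * M * nK); exact: (Delta_set_ubound hK hf).
by exists de => //=; rewrite de0 (le_trans deh).
Qed.

Lemma Delta_star_mono (h h' z : R) : 0 < h -> h <= h' ->
  Delta_star K f h z <= Delta_star K f h' z.
Proof.
move=> h0 hh'; have h'0 := lt_le_trans h0 hh'.
rewrite /Delta_star ge_max; apply/andP; split; rewrite le_max.
  apply/orP; left; apply: ge_sup.
    by eexists; exists 1 => //=; exact: ltr01.
  move=> _ [a /= a0 <-]; rewrite ler_pdivrMl ?mulr_gt0// -lee_fin fineK; last first.
    rewrite ge0_fin_numE; last by apply: integral_ge0 => t _; rewrite lee_fin (Delta_ge0 hK hf).
    by apply: le_lt_trans (Delta_bar_ge hK hf z h0 a0) _; exact: ltry.
  apply: le_trans (Delta_bar_ge hK hf z h'0 a0).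
  apply: ge0_le_integral_nomeas => t _; rewrite lee_fin; first exact: (Delta_ge0 hK hf).
  exact: Delta_mono.
by apply/orP; right; exact: Delta_mono.
Qed.

Variable y : R.
Notation hs := (hstar K f eps y).

Let Hset : set R := [set h | eps ^+ 2 <= h <= 1 /\
    Num.sqrt h * Delta_star K f h y <= kap * eps * Num.sqrt ell].

Let eps2_gt0 : 0 < eps ^+ 2. Proof. by rewrite exprn_gt0. Qed.

Let eps2_le1 : eps ^+ 2 <= 1. Proof. by rewrite exprn_ile1// ltW// eps_lt1. Qed.

Let Hset_eps2 : Hset (eps ^+ 2).
Proof.
split; first by rewrite lexx eps2_le1.
rewrite sqrtr_sqr ger0_norm ?(ltW eps0)// -mulrA mulrCA ler_wpM2l ?(ltW eps0)//.
exact: le_trans (Delta_star_le hK hf y eps2_gt0) signal_le_noise.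
Qed.

Let Hset_sup : has_sup Hset.
Proof.
by split; [exists (eps ^+ 2)|exists 1 => h -[/andP[]]].
Qed.

Lemma hstar_itv : eps ^+ 2 <= hs <= 1.
Proof.
apply/andP; split; first exact: (sup_upper_bound Hset_sup Hset_eps2).
by apply: ge_sup; [exists (eps ^+ 2)|move=> h -[/andP[]]].
Qed.

(** Both factors increase with the bandwidth, so the defining inequality is inherited from a
    competitor above [h]; it is not claimed at the supremum itself. *)
Lemma lt_hstar h : eps ^+ 2 <= h -> h < hs ->
  Num.sqrt h * Delta_star K f h y <= kap * eps * Num.sqrt ell.
Proof.
move=> h1 h2; have h0 : 0 < h := lt_le_trans eps2_gt0 h1.
have d0 : 0 < hs - h by rewrite subr_gt0.
have [h' [_ Hh'] hh'] := sup_adherent d0 Hset_sup.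
have {}hh' : h < h' by move: hh'; rewrite -/(hstar K f eps y); lra.
apply: le_trans Hh'; apply: ler_pM; rewrite ?sqrtr_ge0 ?(Delta_star_ge0 hK hf)//.
  by rewrite ler_sqrt ltW// (lt_trans h0).
by apply: Delta_star_mono => //; exact: ltW.
Qed.

(** The largest dyadic [h] with [2 h < hstar] is at least [hstar / 4], and the defining inequality
    holds at [2 h]. *)
Lemma oracle_bandwidth : exists k, [/\ eps ^+ 2 <= bw k, hs <= 4 * bw k &
  Num.sqrt (bw k) * Delta_star K f (2 * bw k) y <= Num.sqrt 2 * (kap * eps * Num.sqrt ell)].
Proof.
have /andP[hs0 hs1] := hstar_itv.
have hs_gt0 : 0 < hs := lt_le_trans eps2_gt0 hs0.
have bwS k : bw k.+1 = bw k / 2 :> R by rewrite /bw exprS invfM mulrC.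
have bw_gt0 k : 0 < bw k :> R by have /andP[] := bw_itv (R := R) k.
have kel0 : 0 <= kap * eps * Num.sqrt ell.
  by rewrite !mulr_ge0 ?(ltW kap_gt0) ?(ltW eps0) ?sqrtr_ge0.
have s2 : 1 <= Num.sqrt 2 :> R by rewrite -[leLHS]sqrtr1 ler_sqrt//; lra.
have exk : exists k, 2 * bw k < hs.
  exists (Num.truncn (2 / hs)); set m := Num.truncn _.
  rewrite /bw ltr_pdivrMr ?exprn_gt0// mulrC -ltr_pdivrMr//.
  apply: lt_le_trans (truncnS_gt _) _; rewrite -natrX ler_nat.
  exact: ltn_expl.
case: (ex_minnP exk) => K0 hK0 minK0.
have K0_gt0 : (0 < K0)%N.
  by case: (K0) hK0 => //; rewrite /bw expr0 invr1; lra.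
have [hk|hk] := leP (eps ^+ 2) (bw K0).
  exists K0; split => //.
    case: K0 K0_gt0 hK0 minK0 {hk} => // k _ hk mink.
    have : ~~ (2 * bw k < hs) by apply/negP => /mink; rewrite ltnn.
    by rewrite -leNgt bwS => h; lra.
  apply: (@le_trans _ _ (kap * eps * Num.sqrt ell)); last by rewrite ler_peMl.
  apply: le_trans (lt_hstar _ hK0); last by have := bw_gt0 K0; lra.
  rewrite ler_wpM2r// ?(Delta_star_ge0 hK hf) ?mulr_gt0//.
  by rewrite ler_sqrt; have := bw_gt0 K0; lra.
(* If that choice falls below [eps^2], the smallest dyadic bandwidth above is taken instead. It is
   at most [2 eps^2], where the trivial bias bound suffices at the cost of [sqrt 2]. *)
have exk' : exists k, bw k.+1 < eps ^+ 2 by exists K0.-1; rewrite prednK.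
case: (ex_minnP exk') => k1 hk1 mink1.
have k1K0 : (k1 < K0)%N by rewrite -[K0]prednK// ltnS mink1// prednK.
exists k1; split.
- case: k1 hk1 mink1 {k1K0} => [|k] _ mink; first by rewrite /bw expr0 invr1.
  by rewrite leNgt; apply/negP => /mink; rewrite ltnn.
- have : ~~ (2 * bw k1 < hs) by apply/negP => /minK0; rewrite leqNgt k1K0.
  by rewrite -leNgt; have := bw_gt0 k1; lra.
- have h2 : 0 < 2 * bw k1 :> R by rewrite mulr_gt0.
  have hD := le_trans (Delta_star_le hK hf y h2) signal_le_noise.
  have h3 : Num.sqrt (bw k1) <= Num.sqrt 2 * eps :> R.
    have -> : Num.sqrt 2 * eps = Num.sqrt (2 * eps ^+ 2).
      by rewrite sqrtrM// sqrtr_sqr (ger0_norm (ltW eps0)).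
    rewrite ler_sqrt; last by rewrite mulr_ge0 ?sqr_ge0.
    by move: hk1; rewrite bwS; lra.
  apply: (@le_trans _ _ (Num.sqrt 2 * eps * (kap * Num.sqrt ell))).
    by apply: ler_pM; rewrite ?sqrtr_ge0 ?(Delta_star_ge0 hK hf).
  by rewrite le_eqVlt; apply/orP; left; apply/eqP; ring.
Qed.

End oracle.

(** * Half-sums of two directions *)

Section geometry.
Context {R : realType}.
Implicit Types (p theta nu : R * R) (h : R).

Definition cross p q : R := - p.2 * q.1 + p.1 * q.2.

Lemma abs_dotp_le1 theta nu : S1 theta -> S1 nu -> `|dotp nu theta| <= 1.
Proof.
rewrite /S1 /= => ht hn; rewrite ler_norml /dotp.
have := sqr_ge0 (nu.1 - theta.1); have := sqr_ge0 (nu.2 - theta.2).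
have := sqr_ge0 (nu.1 + theta.1); have := sqr_ge0 (nu.2 + theta.2).
move: ht hn; case: theta => a b; case: nu => c e /= ht hn h1 h2 h3 h4.
by apply/andP; split; nra.
Qed.

(** With [c = nu . theta], the sum [theta + nu] has squared norm [2 (1 + c)] and scalar product
    [1 + c] with both directions. So both see the same step [h (1 + c)] along [p], and across [p]
    the step of each is its [cross] with the other. *)
Let Emx2_pos theta nu h : S1 theta -> S1 nu -> 0 <= dotp nu theta ->
  let p := ((2 * (1 + dotp nu theta))^-1 * (theta.1 + nu.1),
            (2 * (1 + dotp nu theta))^-1 * (theta.2 + nu.2)) in
  [/\ Emx_bar theta nu h = Emx p h, 1 / 4 <= sqnorm p <= 1,
      h * dotp p theta / sqnorm p = h * (1 + dotp nu theta),
      h * dotp p nu / sqnorm p = h * (1 + dotp nu theta) &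
      cross p theta / sqnorm p = cross nu theta /\ cross p nu / sqnorm p = cross theta nu].
Proof.
move=> ht hn c0 p.
have c1 : dotp nu theta <= 1 by have := abs_dotp_le1 ht hn; rewrite ger0_norm.
have k0 : 1 + dotp nu theta != 0 by rewrite gt_eqF//; lra.
have ww : (theta.1 + nu.1) ^+ 2 + (theta.2 + nu.2) ^+ 2 = 2 * (1 + dotp nu theta).
  transitivity ((theta.1 ^+ 2 + theta.2 ^+ 2) + (nu.1 ^+ 2 + nu.2 ^+ 2) + 2 * dotp nu theta).
    by rewrite /dotp; ring.
  by rewrite ht hn; ring.
set c := dotp nu theta in c0 c1 k0 ww *.
have sp : sqnorm p = (2 * (1 + c))^-1.
  rewrite /sqnorm /p /= -/c !exprMn -mulrDr ww; field.
  exact: k0.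
have hdt : dotp (theta.1 + nu.1, theta.2 + nu.2) theta = 1 + c.
  transitivity ((theta.1 ^+ 2 + theta.2 ^+ 2) + c); first by rewrite /c /dotp /=; ring.
  by rewrite ht.
have hdn : dotp (theta.1 + nu.1, theta.2 + nu.2) nu = 1 + c.
  transitivity ((nu.1 ^+ 2 + nu.2 ^+ 2) + c); first by rewrite /c /dotp /=; ring.
  by rewrite hn.
have sc q : dotp p q = (2 * (1 + c))^-1 * dotp (theta.1 + nu.1, theta.2 + nu.2) q.
  by rewrite /p /dotp /= -/c; ring.
have scr q : cross p q = (2 * (1 + c))^-1 * cross (theta.1 + nu.1, theta.2 + nu.2) q.
  by rewrite /p /cross /= -/c; ring.
split.
- rewrite /Emx_bar /Emx /mx2 -/c (ger0_norm c0); apply/matrixP => i j; rewrite !mxE /p /= -/c.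
  by case: ifP => _; case: ifP => _; ring.
- rewrite sp -[1 in X in _ <= _ <= X]invr1 div1r !lef_pV2 ?posrE//; lra.
- by rewrite sp sc hdt; field.
- by rewrite sp sc hdn; field.
split; rewrite sp scr /cross /=; field; exact: k0.
Qed.

(** For a negative scalar product [theta] is replaced by its opposite, which only changes signs of
    steps; they are harmless because [K] is even. Both directions are treated because the true one
    occurs in either slot. *)
Lemma Emx2_param theta nu h : S1 theta -> S1 nu -> 0 < h ->
  exists p, [/\ Emx2 theta nu h = Emx p h, 1 / 4 <= sqnorm p <= 1,
    `|h * dotp p theta / sqnorm p| <= 2 * h /\ `|h * dotp p nu / sqnorm p| <= 2 * h,
    cross p theta / sqnorm p = cross nu theta &
    cross p nu / sqnorm p = cross theta nu \/
    cross p nu / sqnorm p = - cross theta nu].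
Proof.
move=> ht hn h0; have c1 := abs_dotp_le1 ht hn.
have bnd (c : R) : `|c| <= 1 -> `|h * (1 + c)| <= 2 * h.
  rewrite ler_norml => /andP[? ?]; rewrite normrM (gtr0_norm h0) mulrC ler_wpM2r ?(ltW h0)//.
  by rewrite ler_norml; apply/andP; split; lra.
rewrite /Emx2; have [c0|c0] := leP 0 (dotp nu theta).
  have [E hp d1 d2 [cr1 cr2]] := Emx2_pos h ht hn c0.
  by eexists; split; [exact: E|exact: hp|rewrite d1 d2; split; exact: bnd|exact: cr1|left; exact: cr2].
set th' := (- theta.1, - theta.2).
have ht' : S1 th' by rewrite /S1 /= !sqrrN.
have cE : dotp nu th' = - dotp nu theta by rewrite /th' /dotp /=; ring.
have c0' : 0 <= dotp nu th' by rewrite cE; lra.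
have [E hp d1 d2 [cr1 cr2]] := Emx2_pos h ht' hn c0'.
set p := (_, _) in E hp d1 d2 cr1 cr2.
exists p; split; [exact: E|exact: hp| | |].
- split; last by rewrite d2 cE; apply: bnd; rewrite normrN.
  rewrite (_ : dotp p theta = - dotp p th'); last by rewrite /th' /dotp /=; ring.
  by rewrite mulrN mulNr normrN d1 cE; apply: bnd; rewrite normrN.
- rewrite (_ : cross p theta = - cross p th'); last by rewrite /th' /cross /=; ring.
  by rewrite mulNr cr1 /th' /cross /=; ring.
- by right; rewrite cr2 /th' /cross /=; ring.
Qed.

End geometry.

Section estimators.
Context {R : realType} {d : measure_display} {T : measurableType d}.
Variables (P : probability T R) (K : R -> R) (Q M eps : R).
Hypotheses (hK : K1 K Q) (eps0 : 0 < eps).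
Variables (f : R -> R) (theta0 x : R * R).
Hypotheses (hf : FM M f) (htheta0 : S1 theta0).
Variables (D : set (R * R)).
Hypothesis hD : windows_observed K eps x D.
Variable Y : 'M[R]_2 -> {RV P >-> R}.
Notation kap := (norm_inf K).
Notation y0 := (dotp x theta0).
Notation noise := (noise K eps f theta0 x D Y).
Variables (w : T) (B : nat -> R).
Hypothesis noise_B : forall k p, eps ^+ 2 <= bw k -> 1 / 4 <= sqnorm p <= 1 ->
  eps * `|noise p (bw k) w| <= B k.

Let Heps_bw k : eps ^+ 2 <= bw k -> Heps eps (bw k).
Proof.
move=> hk; split; first by exists k.
by rewrite hk; have /andP[_ ->] := bw_itv (R := R) k.
Qed.

(** The window lies in the observed domain, so the mean over [D] is the mean over the plane, which
    [mean_window] evaluates. *)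
Lemma Fhat_smooth2 k p : eps ^+ 2 <= bw k -> 1 / 4 <= sqnorm p <= 1 ->
  (forall t, window K (Emx p (bw k)) x t != 0 -> D t) ->
  `|Fhat_mx (fun E => Y E w) (Emx p (bw k)) -
    smooth2 K f (bw k * dotp p theta0 / sqnorm p) (cross p theta0 / sqnorm p) y0| <= B k.
Proof.
move=> hk hp pD; apply: le_trans (noise_B hk hp).
have /andP[h0 h1] := bw_itv (R := R) k; have /andP[p0 p1] := hp.
have p_gt0 : 0 < sqnorm p by lra.
rewrite -{1}(gtr0_norm eps0) -normrM /noise mulrA divff ?gt_eqF// mul1r.
rewrite le_eqVlt; apply/orP; left; apply/eqP; congr `|_ - _|.
rewrite -(mean_window hK hf x theta0 h0 p_gt0) /mean_on_D; congr (_ * _).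
rewrite [RHS]Rintegral_mkcond; apply: eq_Rintegral => t _; rewrite patchE.
case: ifPn => // tD; have [->|wt] := eqVneq (window K (Emx p (bw k)) x t) 0.
  by rewrite mul0r.
by have := pD t wt => /mem_set; rewrite (negbTE tD).
Qed.

Lemma S1_sqnorm (theta : R * R) : S1 theta -> 1 / 4 <= sqnorm theta <= 1.
Proof. by rewrite /S1 /sqnorm /= => ->; apply/andP; split; lra. Qed.

Lemma Fhat_approx k theta : eps ^+ 2 <= bw k -> S1 theta ->
  exists2 al, `|al| <= bw k &
    `|Fhat (fun E => Y E w) theta (bw k) - smooth2 K f al (cross theta theta0) y0| <= B k.
Proof.
move=> hk ht.
have /andP[h0 h1] := bw_itv (R := R) k.
exists (bw k * dotp theta theta0).
  rewrite normrM (gtr0_norm h0) ler_piMr ?(ltW h0)//; exact: abs_dotp_le1.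
have := Fhat_smooth2 hk (S1_sqnorm ht).
rewrite (_ : sqnorm theta = 1); last by exact: ht.
rewrite !divr1; apply => t wt.
by have [+ _] := hD t ht ht (Heps_bw hk); apply.
Qed.

(** The true direction in the first slot serves the admissibility of the oracle pair, in the second
    slot the use of the selected pair. Either way the transverse step is that of [Fhat] at [theta],
    up to a sign removed by [smooth2N]. *)
Lemma Fhat2_approx k theta : eps ^+ 2 <= bw k -> S1 theta ->
  (exists2 al, `|al| <= 2 * bw k &
    `|Fhat2 (fun E => Y E w) theta0 theta (bw k) - smooth2 K f al (cross theta theta0) y0| <= B k) /\
  (exists2 al, `|al| <= 2 * bw k &
    `|Fhat2 (fun E => Y E w) theta theta0 (bw k) - smooth2 K f al (cross theta theta0) y0| <= B k).
Proof.
move=> hk ht; have /andP[h0 h1] := bw_itv (R := R) k.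
split.
- have [p [E hp [al1 _] cr _]] := Emx2_param htheta0 ht h0.
  eexists; first exact: al1.
  rewrite /Fhat2 E -cr; apply: Fhat_smooth2 => // t.
  by rewrite -E; have [_ +] := hD t htheta0 ht (Heps_bw hk); apply.
- have [p [E hp [_ al2] _ cr]] := Emx2_param ht htheta0 h0.
  eexists; first exact: al2.
  have <- : smooth2 K f (bw k * dotp p theta0 / sqnorm p) (cross p theta0 / sqnorm p) y0 =
      smooth2 K f (bw k * dotp p theta0 / sqnorm p) (cross theta theta0) y0.
    by case: cr => ->//; rewrite (smooth2N hK hf).
  rewrite /Fhat2 E; apply: Fhat_smooth2 => // t.
  by rewrite -E; have [_ +] := hD t ht htheta0 (Heps_bw hk); apply.
Qed.

End estimators.

Section dyadic.
Context {R : realType}.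
Variable eps : R.

Lemma bw_le j k : (bw j <= bw k :> R) = (k <= j)%N.
Proof. by rewrite /bw lef_pV2 ?posrE ?exprn_gt0// ler_eXn2l// ltr1n. Qed.

Lemma Heps_max (A : set R) : A `<=` Heps eps -> A !=set0 ->
  A (sup A) /\ forall a, A a -> a <= sup A.
Proof.
move=> AH A0.
have hub : has_ubound A by exists 1 => a /AH [_ /andP[]].
split; last by move=> a Aa; exact: ub_le_sup.
have exk : exists k, `[< A (bw k) >].
  by case: A0 => a Aa; have [[k ak] _] := AH _ Aa; exists k; apply/asboolP; rewrite /bw -ak.
case: (ex_minnP exk) => k /asboolP Ak mink.
suff -> : sup A = bw k by [].
apply/eqP; rewrite eq_le; apply/andP; split; last exact: ub_le_sup.
apply: ge_sup => // a Aa; have [[j aj] _] := AH _ Aa.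
by rewrite aj -/(bw j) bw_le mink//; apply/asboolP; rewrite /bw -aj.
Qed.

(** The smallest bandwidth has only itself to be compared with, so the set defining [hhat] is not
    empty. *)
Lemma Heps_min : 0 < eps -> eps <= 1 -> exists2 h, Heps eps h & forall eta, Heps eps eta -> h <= eta.
Proof.
move=> eps0 eps1; have e20 : 0 < eps ^+ 2 by rewrite exprn_gt0.
have exk : exists k, bw k.+1 < eps ^+ 2.
  exists (Num.truncn (1 / eps ^+ 2)); set m := Num.truncn _.
  rewrite /bw -[ltLHS]div1r ltr_pdivrMr ?exprn_gt0// mulrC -ltr_pdivrMr//.
  apply: lt_le_trans (truncnS_gt _) _; rewrite -natrX ler_nat.
  by apply: ltnW; exact: ltn_expl.
case: (ex_minnP exk) => k hk mink; exists (bw k).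
  split; first by exists k.
  have /andP[_ ->] := bw_itv (R := R) k; rewrite andbT.
  case: k hk mink => [|k] _ mink; first by rewrite /bw expr0 invr1 exprn_ile1// ltW.
  by rewrite leNgt; apply/negP => /mink; rewrite ltnn.
move=> eta [[j ->] /andP[hj _]]; rewrite -/(bw j) bw_le leqNgt; apply/negP => kj.
have : bw j <= bw k.+1 :> R by rewrite bw_le.
by move: hj; rewrite -/(bw j) => h1 h2; have := lt_le_trans (le_lt_trans h2 hk) h1; rewrite ltxx.
Qed.

End dyadic.

Lemma dist_le_chain4 {R : realType} (a s c t b e D : R) :
  `|a - s| <= e -> `|b - t| <= e -> `|s - c| <= D -> `|t - c| <= D ->
  `|a - b| <= 2 * e + 2 * D.
Proof.
rewrite !ler_norml => /andP[? ?] /andP[? ?] /andP[? ?] /andP[? ?].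
by apply/andP; split; lra.
Qed.

Lemma dist_le_chain5 {R : realType} (a b c u s t e D1 D2 H : R) : D2 <= D1 ->
  `|a - b| <= H -> `|b - c| <= 2 * e + 2 * D1 -> `|c - u| <= H ->
  `|u - s| <= e -> `|s - t| <= D2 -> `|a - t| <= 2 * H + 3 * e + 3 * D1.
Proof.
rewrite !ler_norml => ? /andP[? ?] /andP[? ?] /andP[? ?] /andP[? ?] /andP[? ?].
by apply/andP; split; lra.
Qed.

(** * The selection rule for one realization, with noise bounds [B] *)

Section selection.
Context {R : realType}.
Variables (K : R -> R) (Q M eps r : R) (f : R -> R) (theta0 : R * R) (y0 : R).
Hypotheses (hK : K1 K Q) (eps0 : 0 < eps) (eps1 : eps <= 1).
Hypotheses (hf : FM M f) (htheta0 : S1 theta0).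
Notation kap := (norm_inf K).
Variables (obs : 'M[R]_2 -> R) (theta : R * R).
Hypothesis hsel : selected_direction K Q r eps obs theta.
Notation S al be := (smooth2 K f al be y0).
Variable B : nat -> R.
Hypothesis Fhat_near : forall k nu, eps ^+ 2 <= bw k -> S1 nu ->
  exists2 al, `|al| <= bw k & `|Fhat obs nu (bw k) - S al (cross nu theta0)| <= B k.
Hypothesis Fhat2_near : forall k nu, eps ^+ 2 <= bw k -> S1 nu ->
  (exists2 al, `|al| <= 2 * bw k &
    `|Fhat2 obs theta0 nu (bw k) - S al (cross nu theta0)| <= B k) /\
  (exists2 al, `|al| <= 2 * bw k &
    `|Fhat2 obs nu theta0 (bw k) - S al (cross nu theta0)| <= B k).

Let kap1 : 1 <= kap. Proof. exact: norm_inf_ge1 hK. Qed.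

Lemma TH_ge0 eta : 0 <= TH K Q r eps eta.
Proof.
have Q0 := lip_gt0 hK.
have L0 : 0 <= Lambda K Q by rewrite addr_ge0// mulr_ge0 ?sqrtr_ge0.
have s0 : 0 <= Num.sqrt (4 * r + 2) := sqrtr_ge0 _.
have c0 : 0 <= Lambda K Q + Num.sqrt (4 * r + 2) + 1 by lra.
by rewrite /TH !mulr_ge0 ?sqrtr_ge0 ?(ltW eps0) ?exprn_ge0 ?(norm_inf_ge0 hK).
Qed.

Lemma selected_S1 : S1 theta.
Proof.
have [h1 h2] := hsel; have [PO|] := eqVneq (Padm K Q r eps obs) set0.
  by rewrite (h1 PO) /S1 /= expr1n expr0n addr0.
by move/set0P => /h2[h [[]]].
Qed.

Notation hh := (hhat K Q r eps obs theta).

Let Hset : set R := [set h | Heps eps h /\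
         forall eta, Heps eps eta -> eta <= h ->
           `|Fhat obs theta h - Fhat obs theta eta| <= TH K Q r eps eta].

Lemma hhat_max : Hset hh /\ forall h, Hset h -> h <= hh.
Proof.
apply: (@Heps_max _ eps); first by move=> h [].
have [h Hh hmin] := Heps_min eps0 eps1; exists h; split => // eta He le.
by rewrite (@le_anti _ _ h eta) ?subrr ?normr0 ?TH_ge0// le hmin.
Qed.

Lemma hhat_Heps : exists2 k, eps ^+ 2 <= bw k & hh = bw k.
Proof. by have [[[[k hk] /andP[h _]] _] _] := hhat_max; exists k; rewrite // /bw -hk. Qed.

(** Valid for whatever direction and bandwidth were selected, hence also when the noise exceeds the
    thresholds. *)
Lemma selection_crude : exists2 k, eps ^+ 2 <= bw k &
  `|Fhat obs theta hh - f y0| <= B k + 2 * M * kap ^+ 2.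
Proof.
have [k hk hhE] := hhat_Heps; exists k => //.
have [al _ h] := Fhat_near hk selected_S1.
rewrite hhE; apply: le_trans (ler_distD (S al (cross theta theta0)) _ _) _.
by apply: lerD => //; exact: (smooth2_bound hK hf).
Qed.

Variable k0 : nat.
Hypothesis hk0 : eps ^+ 2 <= bw k0.
Notation h0 := (bw k0).
Notation Dl := (Delta_star K f (2 * h0) y0).
Hypothesis tol : forall k, eps ^+ 2 <= bw k -> bw k <= h0 :> R ->
  2 * B k + 2 * (kap * Dl) <= TH K Q r eps (bw k).
Hypothesis B_mono : forall k, bw k <= h0 :> R -> B k0 <= B k.

Let h0_gt0 : 0 < h0 :> R. Proof. by have /andP[] := bw_itv (R := R) k0. Qed.

Let le2 (a : R) : a <= h0 -> a <= 2 * h0.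
Proof. by move=> /le_trans; apply; rewrite ler_peMl ?ler1n// ltW. Qed.

Let h0_Heps : Heps eps h0.
Proof.
by split; [exists k0|rewrite hk0; have /andP[_ ->] := bw_itv (R := R) k0].
Qed.

Let bias al be : `|al| <= 2 * h0 -> `|S al be - S 0 be| <= kap * Dl.
Proof. by move=> h; apply: (smooth2_bias hK hf) h; rewrite mulr_gt0. Qed.

Let compare a b al al' be k : `|al| <= 2 * h0 -> `|al'| <= 2 * h0 ->
  `|a - S al be| <= B k -> `|b - S al' be| <= B k ->
  `|a - b| <= 2 * B k + 2 * (kap * Dl).
Proof.
move=> /(bias be) h1 /(bias be) h2 h3 h4; exact: dist_le_chain4 h3 h4 h1 h2.
Qed.

Let oracle_admissible : Padm K Q r eps obs (theta0, h0).
Proof.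
split => //=; apply: ge_ereal_sup => _ [eta [[[k ->] /andP[hk _]] le] <-].
rewrite -/(bw k) in hk le *.
rewrite leeBlDr// add0e; apply: ge_ereal_sup => _ [nu hnu <-]; rewrite lee_fin.
apply: le_trans (tol hk le).
have [[al al1 h1] _] := Fhat2_near hk hnu; have [al' al2 h2] := Fhat_near hk hnu.
apply: compare h1 h2; last exact: (le_trans al2 (le2 le)).
by apply: le_trans al1 _; rewrite ler_pM2l.
Qed.

(** The oracle pair being admissible, the selected pair has bandwidth at least [h0]; so [eta = h0]
    and [nu = theta0] occur in the suprema that bound its statistic. *)
Let selected_admissible :
  `|Fhat2 obs theta theta0 h0 - Fhat obs theta0 h0| <= TH K Q r eps h0.
Proof.
have [_ h2] := hsel; have [h [[hS [_ _] hR] hmax]] := h2 (ex_intro _ _ oracle_admissible).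
have /= le := hmax _ oracle_admissible.
have {hR} := le_trans (ereal_sup_ubound _) hR.
move=> /(_ _ (ex_intro2 _ _ h0 (conj h0_Heps le) erefl)).
rewrite leeBlDr// add0e => /(le_trans (ereal_sup_ubound _)).
move=> /(_ _ (ex_intro2 _ _ theta0 htheta0 erefl)).
by rewrite lee_fin.
Qed.

(** The path goes from the final estimator to [Fhat theta h0] by the bandwidth rule, to
    [Fhat2 theta theta0 h0] by the common transverse step, to [Fhat theta0 h0] by admissibility, and
    to [f y0] because the transverse step vanishes at the true direction. *)
Lemma selection_oracle :
  `|Fhat obs theta hh - f y0| <= 2 * TH K Q r eps h0 + 3 * B k0 + 3 * (kap * Dl).
Proof.
have hth := selected_S1.
have [[_ hsmall] hmax] := hhat_max.
(* The bandwidth [h0] passes the test at any direction, because estimators at one direction share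
   [be] and differ by noise and bias only. *)
have h0hh : h0 <= hh.
  apply: hmax; split => // eta [[k ->] /andP[hk _]] le; rewrite -/(bw k) in hk le *.
  have [al al1 h1] := Fhat_near hk0 hth; have [al' al2 h2] := Fhat_near hk hth.
  apply: le_trans (tol hk le); have Bk := B_mono le.
  apply: compare (le_trans h1 Bk) h2; apply: le2 => //; exact: le_trans le.
have h1 := hsmall _ h0_Heps h0hh; have h2 := selected_admissible.
have [al al1 h3] := Fhat_near hk0 hth.
have [_ [al' al2 h4]] := Fhat2_near hk0 hth.
have h7 := compare (le2 al1) al2 h3 h4.
have [be be1 h5] := Fhat_near hk0 htheta0.
have h20 : 0 < 2 * h0 :> R by rewrite mulr_gt0.
have c0 : cross theta0 theta0 = 0 by rewrite /cross; ring.
have h6 := smooth_bias hK hf y0 h20 (le2 be1).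
have D1 : Dl <= kap * Dl by rewrite ler_peMl// (Delta_star_ge0 hK hf).
by rewrite c0 in h5; exact: dist_le_chain5 D1 h1 h7 h2 h5 h6.
Qed.

End selection.

(** * Risk bound *)

Section powers.
Context {R : realType}.
Implicit Types (a b r u l : R).

Lemma sqrtrD_le a b : 0 <= a -> 0 <= b -> Num.sqrt (a + b) <= Num.sqrt a + Num.sqrt b.
Proof.
move=> a0 b0; have sa := sqrtr_ge0 a; have sb := sqrtr_ge0 b.
have s0 : 0 <= Num.sqrt a + Num.sqrt b by rewrite addr_ge0.
rewrite -(ger0_norm s0) -sqrtr_sqr ler_sqrt ?sqr_ge0//.
rewrite sqrrD !sqr_sqrtr// [_ + _ *+ 2]addrC -addrA lerDr mulrn_wge0// mulr_ge0.
Qed.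

Lemma powRD_superadd a b r : 0 <= a -> 0 <= b -> 1 <= r ->
  a `^ r + b `^ r <= (a + b) `^ r.
Proof.
move=> a0 b0 r1; have [->|rn1] := eqVneq r 1.
  by rewrite !powRr1 ?addr_ge0.
have r0 : r != 0 by rewrite gt_eqF// (lt_le_trans ltr01).
have split_pow t : 0 <= t -> t `^ r = t * t `^ (r - 1).
  rewrite le_eqVlt => /predU1P[<-|t0]; first by rewrite mul0r powR0.
  by rewrite -{2}(powRr1 (ltW t0)) -powRD ?subrK// ?(gt_eqF t0) ?implybT// addrC subrK.
rewrite (split_pow a)// (split_pow b)// (split_pow (a + b)) ?addr_ge0// mulrDl.
have r10 : 0 <= r - 1 by rewrite subr_ge0.
by apply: lerD; rewrite ler_wpM2l//; apply: ge0_ler_powR => //; rewrite ?nnegrE ?addr_ge0 ?lerDl ?lerDr.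
Qed.

(** Superadditivity of the power keeps the coefficient of the first term equal to 1. The 2 is the
    bound on the mean of [V] and becomes the factor [2^(1/r)] of [C2]. *)
Lemma powR_root_le a b r : 0 <= a -> 0 <= b -> 1 <= r ->
  (a `^ r + 2 * b `^ r) `^ r^-1 <= a + 2 `^ r^-1 * b.
Proof.
move=> a0 b0 r1; have r0 : 0 < r := lt_le_trans ltr01 r1.
have c0 : 0 <= 2 `^ r^-1 * b by rewrite mulr_ge0 ?powR_ge0.
have cE : 2 * b `^ r = (2 `^ r^-1 * b) `^ r.
  by rewrite powRM ?powR_ge0// -powRrM mulVf ?gt_eqF// powRr1.
have s0 : 0 <= a + 2 `^ r^-1 * b by rewrite addr_ge0.
have <- : ((a + 2 `^ r^-1 * b) `^ r) `^ r^-1 = a + 2 `^ r^-1 * b.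
  by rewrite -powRrM divff ?powRr1 ?gt_eqF.
apply: ge0_ler_powR; rewrite ?nnegrE ?powR_ge0 ?invr_ge0 ?(ltW r0)//.
  by rewrite addr_ge0 ?powR_ge0// mulr_ge0 ?powR_ge0.
by rewrite cE powRD_superadd.
Qed.

(** Write [u = q r l] with [q >= 1] and [l = ln (1 / e)]. The left side gains at most [q^(r/2)] over
    its value at [q = 1], while [e^r exp u = exp (r l (q - 1))]; compare by [ln q <= q - 1]. *)
Lemma tail_moment_trade (a e r u : R) : 0 <= a -> 0 < e -> 1 <= ln (1 / e) -> 1 <= r ->
  r * ln (1 / e) <= u ->
  (a + 2 * Num.sqrt u) `^ r <=
    (e * (a + 2 * Num.sqrt (r * ln (1 / e)))) `^ r * expR u.
Proof.
set l := ln (1 / e) => a0 e0 l1 r1 ru.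
have r0 : 0 < r := lt_le_trans ltr01 r1.
have l0 : 0 < l := lt_le_trans ltr01 l1.
have rl0 : 0 < r * l by rewrite mulr_gt0.
set q := u / (r * l).
have q1 : 1 <= q by rewrite /q ler_pdivlMr// mul1r.
have q0 : 0 < q := lt_le_trans ltr01 q1.
have uE : u = q * (r * l) by rewrite /q divfK// gt_eqF.
have sq1 : 1 <= Num.sqrt q by rewrite -[leLHS]sqrtr1 ler_sqrt ?(ltW q0).
set b := a + 2 * Num.sqrt (r * l).
have b0 : 0 <= b by rewrite addr_ge0// mulr_ge0// sqrtr_ge0.
have h1 : a + 2 * Num.sqrt u <= Num.sqrt q * b.
  rewrite uE sqrtrM ?(ltW q0)// /b mulrDr; apply: lerD; first by rewrite ler_peMl.
  by rewrite mulrCA.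
apply: (@le_trans _ _ ((Num.sqrt q * b) `^ r)).
  apply: ge0_ler_powR; rewrite ?nnegrE ?(ltW r0)//.
    by rewrite addr_ge0// mulr_ge0// sqrtr_ge0.
  by rewrite mulr_ge0// sqrtr_ge0.
rewrite !powRM ?sqrtr_ge0 ?(ltW e0)// mulrAC ler_wpM2r ?powR_ge0//.
have -> : e `^ r = expR (- (r * l)).
  by rewrite /powR gt_eqF// /l div1r lnV ?posrE// mulrN opprK.
rewrite -expRD {1}/powR gt_eqF ?sqrtr_gt0// ler_expR.
have -> : ln (Num.sqrt q) = ln q / 2.
  by rewrite -[in RHS](sqr_sqrtr (ltW q0)) lnXn ?sqrtr_gt0// -mulr_natl; field.
have hq : ln q <= q - 1 by rewrite -ler_expR lnK ?posrE//; have := expR_ge1Dx (q - 1); lra.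
rewrite uE (_ : _ + _ = r * (l * (q - 1))); last by ring.
rewrite ler_pM2l//.
have q10 : 0 <= q - 1 by lra.
apply: (@le_trans _ _ (q - 1)); last by rewrite ler_peMl.
lra.
Qed.

End powers.

Section constants.
Context {R : realType}.
Variables (K : R -> R) (Q r : R).
Hypotheses (hK : K1 K Q) (r1 : 1 <= r).
Notation kap := (norm_inf K).
Notation sC := (Num.sqrt (ln (1 + 2 * Q * kap))).

(* [68 / 5 >= 2 * sqrt 46] and [17 / 6 >= 2 * sqrt 2], from [entropy_le]. *)
Definition entropy_const : R := 68 / 5 + 17 / 6 * sC.
Notation A0 := entropy_const.
Notation N := (2 * Num.sqrt r + A0).

Let sC0 : 0 <= sC. Proof. exact: sqrtr_ge0. Qed.

Let sqrt2 : Num.sqrt 2 <= 17 / 12 :> R.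
Proof.
have h : 0 <= 17 / 12 :> R by lra.
rewrite -[leRHS](ger0_norm h) -sqrtr_sqr ler_sqrt ?sqr_ge0//; lra.
Qed.

Let sqrt2_ge : 7 / 5 <= Num.sqrt 2 :> R.
Proof.
have h : 0 <= 7 / 5 :> R by lra.
rewrite -[leLHS](ger0_norm h) -sqrtr_sqr ler_sqrt//; lra.
Qed.

Lemma entropy_const_ge0 : 0 <= A0.
Proof. rewrite /A0; have := sC0; lra. Qed.

Lemma sqrt_entropy_le (eps : R) k : 0 < eps -> 1 <= ln (1 / eps) -> eps ^+ 2 <= bw k ->
  2 * Num.sqrt (entropy K Q k) <= A0 * Num.sqrt (ln (1 / eps)).
Proof.
move=> eps0 l1 hk; have := entropy_le hK eps0 l1 hk; set l := ln (1 / eps).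
set C := ln (1 + 2 * Q * kap) => hE.
have C0 : 0 <= C.
  rewrite ln_ge0// lerDl !mulr_ge0// ?(norm_inf_ge0 hK)//; exact: ltW (lip_gt0 hK).
have l0 : 0 <= l by apply: le_trans l1.
set a := A0 / 2 * Num.sqrt l.
have a0 : 0 <= a by rewrite mulr_ge0 ?sqrtr_ge0// divr_ge0// entropy_const_ge0.
suff : Num.sqrt (entropy K Q k) <= a by rewrite /a; lra.
rewrite -(ger0_norm a0) -sqrtr_sqr ler_sqrt ?sqr_ge0//; apply: le_trans hE _.
rewrite /a exprMn sqr_sqrtr//.
apply: (@le_trans _ _ ((46 + 2 * C) * l)).
  by rewrite [leRHS]mulrDl lerD2l ler_peMr// mulr_ge0.
rewrite ler_wpM2r// /A0 -(sqr_sqrtr C0) -/C.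
have := sqrtr_ge0 C; set s := Num.sqrt C => s0.
nra.
Qed.

Let sqrt_4r2 : 2 * Num.sqrt r <= Num.sqrt (4 * r + 2).
Proof.
have h : 0 <= 2 * Num.sqrt r by rewrite mulr_ge0 ?sqrtr_ge0.
have r0 : 0 <= r by apply: le_trans r1.
rewrite -(ger0_norm h) -sqrtr_sqr ler_sqrt; last by lra.
rewrite exprMn sqr_sqrtr//; lra.
Qed.

(** In the threshold, [sqrt (4 r + 2)] pays for the deviation [2 sqrt r], and [Lambda] with the
    final 1 for the entropy and the bias at the oracle. *)
Lemma threshold_const :
  2 * N + 2 * Num.sqrt 2 <= 2 * (Lambda K Q + Num.sqrt (4 * r + 2) + 1).
Proof.
rewrite /Lambda /A0; have := sqrt_4r2; have := sqrt2; have := sC0; lra.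
Qed.

(** The left side is twice the constant [4 c + 3 N + 3 sqrt 2] of the oracle comparison. Its term
    [12 sqrt r] is at most [72 gauss_c r], which the Gaussian part of [C1] covers. *)
Lemma C1_const :
  8 * (Lambda K Q + Num.sqrt (4 * r + 2) + 1) + 6 * N + 6 * Num.sqrt 2 <= C1 r Q K.
Proof.
rewrite /C1; have := gauss_c_ge1 r1; have := gauss_c_ge_sqrt r1.
move: (gauss_c r) => c c6 c1; rewrite /Lambda /A0.
have := sC0; move: sC => s s0; have := sqrt2_ge; have := sqrt2.
move: (Num.sqrt 2) => q2 hq1 hq2; move: (Num.sqrt r) c6 => m c6.
have h1 : c * (7 / 5 * (8 * s + 50)) <= c * (q2 * (8 * s + 50)).
  by rewrite ler_wpM2l ?ler_wpM2r//; lra.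
have h2 : s <= c * s by rewrite ler_peMl.
have -> : c * ((2 + q2) * (8 * s + 50) + 2) =
  c * (q2 * (8 * s + 50)) + 16 * (c * s) + 102 * c by ring.
have h3 : c * (7 / 5 * (8 * s + 50)) = 56 / 5 * (c * s) + 70 * c by field.
move: (Num.sqrt (4 * r + 2)) (c * (q2 * (8 * s + 50))) h1 => S X; rewrite h3.
move: (c * s) h2 => cs h2 h1; lra.
Qed.

Lemma C2_const : A0 + 2 * Num.sqrt r <= Lambda K Q * gauss_c (2 * r).
Proof.
have r2 : 1 <= 2 * r by have := r1; lra.
have := gauss_c_ge1 r2; have := gauss_c_ge_sqrt r2.
have : Num.sqrt r <= Num.sqrt (2 * r) by rewrite ler_sqrt; have := r1; lra.
move: (gauss_c _) (Num.sqrt (2 * r)) (Num.sqrt r) => c m2 m hm hc c1.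
rewrite /Lambda /A0; have := sC0; move: sC => s s0.
have h2 : s <= c * s by rewrite ler_peMl.
rewrite (_ : (8 * s + 50) * c = 8 * (c * s) + 50 * c); last by ring.
move: (c * s) h2 => cs h2; lra.
Qed.

End constants.

Section risk.
Context {R : realType} {d : measure_display} {T : measurableType d}.
Variables (P : probability T R) (K : R -> R) (Q M eps r : R).
Hypotheses (hK : K1 K Q) (eps0 : 0 < eps) (r1 : 1 <= r).
Notation kap := (norm_inf K).
Notation ell := (ln (1 / eps)).
Hypothesis heps :
  eps <= expR (- Num.max 1 ((2 * M * Lp_norm 1%E K / kap) ^+ 2)).
Variables (f : R -> R) (theta0 x : R * R).
Hypotheses (hf : FM M f) (htheta0 : S1 theta0).
Variables (D : set (R * R)).
Hypothesis hD : windows_observed K eps x D.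
Variable Y : 'M[R]_2 -> {RV P >-> R}.
Notation y0 := (dotp x theta0).
Notation noise := (noise K eps f theta0 x D Y).
Notation hs := (hstar K f eps y0).
Variables (w : T) (v : \bar R) (theta : R * R).
Notation obs := (fun E => Y E w).
Hypothesis hsel : selected_direction K Q r eps obs theta.
Hypothesis noise_le : forall k p u, 1 / 4 <= sqnorm p <= 1 -> 0 <= u ->
  (v <= (expR u)%:E)%E ->
  Num.sqrt (bw k) * `|noise p (bw k) w| <= 2 * kap ^+ 2 * Num.sqrt (u + entropy K Q k).
Notation A0 := (entropy_const K Q).
Notation err := `|Fhat obs theta (hhat K Q r eps obs theta) - f y0|.

(** The common scale at bandwidth [bw k]: in this unit the noise on the good event and the
    thresholds have constant size. *)
Let unit_error k : R := kap ^+ 2 * eps * Num.sqrt ell / Num.sqrt (bw k).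

Let ell1 : 1 <= ell. Proof. exact: ell_ge1 eps0 heps. Qed.
Let eps1 : eps <= 1. Proof. exact: ltW (eps_lt1 heps). Qed.
Let kap0 : 0 <= kap. Proof. exact: norm_inf_ge0 hK. Qed.
Let bw0 k : 0 < bw k :> R. Proof. by have /andP[] := bw_itv (R := R) k. Qed.
Let sbw0 k : 0 < Num.sqrt (bw k) :> R. Proof. by rewrite sqrtr_gt0. Qed.
Let ell0 : 0 <= ell. Proof. exact: le_trans ell1. Qed.

Let unit_error_ge0 k : 0 <= unit_error k.
Proof. by rewrite !mulr_ge0 ?invr_ge0 ?sqrtr_ge0 ?(ltW eps0). Qed.

Let unit_error_mono j k : bw k <= bw j :> R -> unit_error j <= unit_error k.
Proof.
move=> h; rewrite /unit_error ler_wpM2l ?mulr_ge0 ?sqrtr_ge0 ?(ltW eps0)//.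
by rewrite lef_pV2 ?posrE// ler_sqrt ?(ltW (bw0 _)).
Qed.

Let TH_unit k : TH K Q r eps (bw k) =
  2 * (Lambda K Q + Num.sqrt (4 * r + 2) + 1) * unit_error k.
Proof.
rewrite /TH sqrtrM ?invr_ge0 ?(ltW (bw0 _))// sqrtrV ?(ltW (bw0 _))// /unit_error.
by rewrite [(Num.sqrt (bw k))^-1 * _]mulrC; ring.
Qed.

Lemma noise_bound u k p : 0 <= u -> (v <= (expR u)%:E)%E ->
  eps ^+ 2 <= bw k -> 1 / 4 <= sqnorm p <= 1 ->
  eps * `|noise p (bw k) w| <=
    kap ^+ 2 * eps * (2 * Num.sqrt u + A0 * Num.sqrt ell) / Num.sqrt (bw k).
Proof.
move=> u0 hv hk hp.
set Z := 2 * Num.sqrt u + _.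
have hZ : 2 * Num.sqrt (u + entropy K Q k) <= Z.
  have := sqrtrD_le u0 (entropy_ge0 K Q k); have := sqrt_entropy_le hK eps0 ell1 hk.
  by rewrite /Z => h1 h2; apply: le_trans (lerD (lexx _) h1); rewrite -mulrDr ler_pM2l.
rewrite ler_pdivlMr//.
have -> : eps * `|noise p (bw k) w| * Num.sqrt (bw k) =
  eps * (Num.sqrt (bw k) * `|noise p (bw k) w|) by ring.
have -> : kap ^+ 2 * eps * Z = eps * (kap ^+ 2 * Z) by ring.
rewrite ler_pM2l//; apply: le_trans (noise_le k hp u0 hv) _.
by rewrite [2 * _]mulrC -mulrA ler_wpM2l ?exprn_ge0.
Qed.

(** Here [u = r ell] makes the noise at most [N] units, below the thresholds. The inequality
    [hstar <= 4 h0] turns the unit at the oracle into at most twice the rate of the statement. *)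
Lemma good_error : (v <= (expR (r * ell))%:E)%E ->
  err <= C1 r Q K * Num.sqrt (kap ^+ 4 * eps ^+ 2 * ell / hs).
Proof.
move=> hv; have r0 : 0 <= r by apply: le_trans r1.
have rl0 : 0 <= r * ell by rewrite mulr_ge0.
set N := 2 * Num.sqrt r + A0.
have N0 : 0 <= N by rewrite addr_ge0 ?entropy_const_ge0// mulr_ge0 ?sqrtr_ge0.
pose B k := N * unit_error k.
have hB k p : eps ^+ 2 <= bw k -> 1 / 4 <= sqnorm p <= 1 ->
    eps * `|noise p (bw k) w| <= B k.
  move=> hk hp; apply: le_trans (noise_bound rl0 hv hk hp) _.
  rewrite le_eqVlt; apply/orP; left; apply/eqP.
  by rewrite sqrtrM// /B /N /unit_error; ring.
have h1 := Fhat_approx hK eps0 hf htheta0 hD hB.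
have h2 := Fhat2_approx hK eps0 hf htheta0 hD hB.
have [k0 [hk0 hs4 hDl]] := oracle_bandwidth hK hf eps0 heps y0.
set Dl := Delta_star _ _ _ _ in hDl.
have kDl : kap * Dl <= Num.sqrt 2 * unit_error k0.
  rewrite /unit_error mulrA ler_pdivlMr//.
  have -> : kap * Dl * Num.sqrt (bw k0) = kap * (Num.sqrt (bw k0) * Dl) by ring.
  apply: le_trans (ler_wpM2l kap0 hDl) _.
  by rewrite le_eqVlt; apply/orP; left; apply/eqP; ring.
have tol k : eps ^+ 2 <= bw k -> bw k <= bw k0 :> R ->
    2 * B k + 2 * (kap * Dl) <= TH K Q r eps (bw k).
  move=> hk le; rewrite TH_unit.
  apply: (@le_trans _ _ ((2 * N + 2 * Num.sqrt 2) * unit_error k)).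
    rewrite /B [leRHS]mulrDl -!mulrA lerD2l ler_pM2l//.
    by apply: le_trans kDl _; rewrite ler_wpM2l ?sqrtr_ge0 ?unit_error_mono.
  by rewrite ler_wpM2r ?unit_error_ge0 ?threshold_const.
have Bm k : bw k <= bw k0 :> R -> B k0 <= B k.
  by move=> h; rewrite ler_wpM2l ?unit_error_mono.
apply: le_trans (selection_oracle hK eps0 eps1 hf htheta0 hsel h1 h2 hk0 tol Bm) _.
set c := Lambda K Q + Num.sqrt (4 * r + 2) + 1.
apply: (@le_trans _ _ ((4 * c + 3 * N + 3 * Num.sqrt 2) * unit_error k0)).
  rewrite TH_unit -/c /B -/Dl.
  have -> : (4 * c + 3 * N + 3 * Num.sqrt 2) * unit_error k0 =
    2 * (2 * c * unit_error k0) + 3 * (N * unit_error k0) + 3 * (Num.sqrt 2 * unit_error k0).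
    by ring.
  by rewrite lerD2l ler_pM2l.
have /andP[hs0 _] := hstar_itv hK hf eps0 heps y0.
have {}hs0 : 0 < hs by apply: lt_le_trans hs0; rewrite exprn_gt0.
have sE : Num.sqrt (kap ^+ 4 * eps ^+ 2 * ell / hs) =
    kap ^+ 2 * eps * Num.sqrt ell / Num.sqrt hs.
  have h : 0 <= kap ^+ 2 * eps by rewrite mulr_ge0 ?exprn_ge0 ?(ltW eps0).
  have -> : kap ^+ 4 * eps ^+ 2 * ell / hs = (kap ^+ 2 * eps) ^+ 2 * (ell / hs).
    by ring.
  by rewrite sqrtrM ?sqr_ge0// sqrtr_sqr ger0_norm// sqrtrM// sqrtrV ?(ltW hs0)// mulrA.
have uE : unit_error k0 <= 2 * Num.sqrt (kap ^+ 4 * eps ^+ 2 * ell / hs).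
  rewrite sE /unit_error mulrCA ler_wpM2l ?mulr_ge0 ?exprn_ge0 ?sqrtr_ge0 ?(ltW eps0)//.
  rewrite ler_pdivlMr ?sqrtr_gt0// mulrC ler_pdivrMr//.
  have -> : 2 * Num.sqrt (bw k0) = Num.sqrt (4 * bw k0) :> R.
    have -> : 4 = 2 ^+ 2 :> R by ring.
    by rewrite sqrtrM ?sqr_ge0// sqrtr_sqr ger0_norm.
  by rewrite ler_sqrt// mulr_ge0 ?(ltW (bw0 _)).
have c0 : 0 <= 4 * c + 3 * N + 3 * Num.sqrt 2.
  have := threshold_const K Q r1; rewrite -/N -/c; have := sqrtr_ge0 (2 : R); lra.
apply: le_trans (ler_wpM2l c0 uE) _.
rewrite mulrA ler_wpM2r ?sqrtr_ge0//; apply: le_trans (C1_const K Q r1).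
by rewrite -/N -/c le_eqVlt; apply/orP; left; apply/eqP; ring.
Qed.

(** Every bandwidth is at least [eps^2], so the factor [eps] of the noise is cancelled by
    [1 / sqrt h]. *)
Lemma crude_error u : 0 <= u -> (v <= (expR u)%:E)%E ->
  err <= kap ^+ 2 * (2 * M + A0 * Num.sqrt ell + 2 * Num.sqrt u).
Proof.
move=> u0 hv.
have hB k p := @noise_bound u k p u0 hv.
have h1 := Fhat_approx hK eps0 hf htheta0 hD hB.
have [k hk hE] := selection_crude hK eps0 eps1 hf hsel h1.
apply: le_trans hE _.
set Z := 2 * Num.sqrt u + A0 * Num.sqrt ell.
have Z0 : 0 <= Z by rewrite addr_ge0 ?mulr_ge0 ?sqrtr_ge0 ?entropy_const_ge0.
have -> : kap ^+ 2 * (2 * M + A0 * Num.sqrt ell + 2 * Num.sqrt u) =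
  kap ^+ 2 * Z + 2 * M * kap ^+ 2 by rewrite /Z; ring.
rewrite lerD2r ler_pdivrMr// mulrAC ler_wpM2l ?mulr_ge0 ?exprn_ge0//.
by rewrite -(ger0_norm (ltW eps0)) -sqrtr_sqr ler_sqrt// ltW.
Qed.

Let crude_const : 0 <= 2 * M + A0 * Num.sqrt ell.
Proof.
by rewrite addr_ge0 ?mulr_ge0 ?(FM_ge0 hf) ?sqrtr_ge0 ?entropy_const_ge0.
Qed.

(** One inequality affine in [v] covers both regimes: beyond [exp (r ell)] the crude error is used
    at [u = ln v], and its excess is traded for the factor [v]. Integration then costs only the mean
    of [V]. *)
Lemma error_power_le : (0 <= v)%E ->
  ((err `^ r)%:E <=
    ((C1 r Q K * Num.sqrt (kap ^+ 4 * eps ^+ 2 * ell / hs)) `^ r)%:E +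
    ((kap ^+ 2 * (eps * (2 * M + A0 * Num.sqrt ell + 2 * Num.sqrt (r * ell)))) `^ r)%:E * v)%E.
Proof.
move=> v0; have r0 : 0 < r := lt_le_trans ltr01 r1.
have powm a b : 0 <= a -> a <= b -> a `^ r <= b `^ r.
  move=> a0 ab; apply: ge0_ler_powR => //; rewrite ?nnegrE ?(ltW r0)//.
  exact: le_trans ab.
have [hv|hv] := leP v (expR (r * ell))%:E.
  apply: (@le_trans _ _ ((C1 r Q K * Num.sqrt (kap ^+ 4 * eps ^+ 2 * ell / hs)) `^ r)%:E).
    by rewrite lee_fin; exact: powm (good_error hv).
  by rewrite leeDl// mule_ge0// lee_fin powR_ge0.
apply: (@le_trans _ _ (((kap ^+ 2 * (eps * (2 * M + A0 * Num.sqrt ell + 2 * Num.sqrt (r * ell)))) `^ r)%:E * v)%E); last first.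
  by rewrite leeDr// lee_fin powR_ge0.
have rl0 : 0 < r * ell by rewrite mulr_gt0// (lt_le_trans ltr01).
have b0 : 0 < eps * (2 * M + A0 * Num.sqrt ell + 2 * Num.sqrt (r * ell)).
  by rewrite mulr_gt0// ltr_wpDl// mulr_gt0// sqrtr_gt0.
have kk0 : 0 < kap ^+ 2 by rewrite exprn_gt0// (lt_le_trans ltr01)// (norm_inf_ge1 hK).
(* For infinite [v] the right side is infinite because its coefficient is positive. *)
case: v v0 hv (@crude_error) => [s| |] //= v0 hv crude; last first.
  by rewrite gt0_muley ?leey// lte_fin powR_gt0// mulr_gt0.
rewrite lte_fin in hv; have s0 : 0 < s by apply: lt_trans hv; exact: expR_gt0.
have ru : r * ell <= ln s by rewrite -ler_expR lnK ?posrE// ltW.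
have u0 : 0 <= ln s by apply: le_trans ru; exact: ltW.
have hs' : (s%:E <= (expR (ln s))%:E)%E by rewrite lnK ?posrE.
rewrite -EFinM lee_fin; apply: le_trans (powm _ _ _ (crude _ u0 hs')) _ => //.
have z0 : 0 <= 2 * M + A0 * Num.sqrt ell + 2 * Num.sqrt (ln s).
  by rewrite addr_ge0// mulr_ge0 ?sqrtr_ge0.
rewrite (powRM _ (ltW kk0) z0) (powRM _ (ltW kk0) (ltW b0)).
rewrite -mulrA ler_wpM2l ?powR_ge0//.
by have := tail_moment_trade crude_const eps0 ell1 r1 ru; rewrite lnK ?posrE.
Qed.

End risk.

Theorem theorem1 (R : realType) (d : measure_display) (T : measurableType d)
  (P : probability T R)
  (* kernel, constants and noise level *)
  (K : R -> R) (Q M eps r : R)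
  (hK : K1 K Q) (hM : 0 < M) (heps : 0 < eps)
  (heps_small :
    eps <= expR (- Num.max 1 ((2 * M * Lp_norm 1%E K / norm_inf K) ^+ 2)))
  (hr : 1 <= r)
  (* signal and estimation point *)
  (f : R -> R) (hf : FM M f) (theta0 x : R * R) (htheta0 : S1 theta0)
  (hx : - (1 / 2) <= x.1 <= 1 / 2 /\ - (1 / 2) <= x.2 <= 1 / 2)
  (* observation domain and Brownian sheet *)
  (D : set (R * R)) (mD : measurable D) (hD : windows_observed K eps x D)
  (W : R * R -> {RV P >-> R}) (hW : brownian_sheet W)
  (* the observed integrals of K(E(t - x)), in a version continuous in E *)
  (Y : 'M[R]_2 -> {RV P >-> R})
  (hY : forall E : 'M[R]_2, E \in unitmx ->
     is_observed_integral W D eps (fun t => f (dotp t theta0)) (window K E x) (Y E))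
  (hYc : {ae P, forall w,
     {within [set E : 'M[R]_2 | E \in unitmx], continuous (fun E => Y E w)}})
  (* any measurable choice of the direction *)
  (thetahat : T -> R * R) (mthetahat : measurable_fun setT thetahat)
  (hthetahat : {ae P, forall w,
     selected_direction K Q r eps (fun E => Y E w) (thetahat w)}) :
  ((\int[P]_w
      (`| Fhat (fun E => Y E w) (thetahat w)
            (hhat K Q r eps (fun E => Y E w) (thetahat w))
          - f (dotp x theta0) | `^ r)%:E) `^ r^-1
   <= (C1 r Q K *
         Num.sqrt (norm_inf K ^+ 4 * eps ^+ 2 * ln (1 / eps)
                   / hstar K f eps (dotp x theta0))
       + C2 r M Q K * norm_inf K ^+ 2 * eps * Num.sqrt (ln (1 / eps)))%:E)%E.
Proof.
have [V [mV V0 V2 VP]] := noise_chaining hK heps hf mD hW hY hYc.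
set ell := ln (1 / eps); set kap := norm_inf K.
set G := C1 r Q K * Num.sqrt _.
pose Bd := kap ^+ 2 * (eps * (2 * M + entropy_const K Q * Num.sqrt ell + 2 * Num.sqrt (r * ell))).
have r0 : 0 < r := lt_le_trans ltr01 hr.
have ell1 : 1 <= ell := ell_ge1 heps heps_small.
have ell0 : 0 <= ell := le_trans ler01 ell1.
have kap0 : 0 <= kap := norm_inf_ge0 hK.
have sell1 : 1 <= Num.sqrt ell by rewrite -[leLHS]sqrtr1 ler_sqrt.
have A0 := entropy_const_ge0 K Q.
have L0 : 0 <= Lambda K Q by rewrite addr_ge0// mulr_ge0 ?sqrtr_ge0.
have G0 : 0 <= G.
  rewrite mulr_ge0 ?sqrtr_ge0// /C1 !addr_ge0 ?mulr_ge0 ?addr_ge0 ?mulr_ge0 ?sqrtr_ge0//.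
  exact: le_trans (gauss_c_ge1 hr).
have Bd0 : 0 <= Bd.
  by rewrite !mulr_ge0 ?exprn_ge0 ?(ltW heps)// !addr_ge0 ?mulr_ge0 ?sqrtr_ge0// ltW.
(* As [ell >= 1], the signal bound [2 M] may be multiplied by [sqrt ell], which brings all three
   terms to the rate of the second summand. *)
have Bd_le : Bd <= (2 * M + Lambda K Q * gauss_c (2 * r)) * (kap ^+ 2 * eps * Num.sqrt ell).
  have -> : (2 * M + Lambda K Q * gauss_c (2 * r)) * (kap ^+ 2 * eps * Num.sqrt ell) =
    kap ^+ 2 * (eps * (2 * M * Num.sqrt ell +
                       Lambda K Q * gauss_c (2 * r) * Num.sqrt ell)) by ring.
  rewrite ler_wpM2l ?exprn_ge0// ler_pM2l// -addrA; apply: lerD.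
    by rewrite ler_peMr// mulr_ge0// ltW.
  rewrite sqrtrM ?(ltW r0)// mulrA -mulrDl ler_wpM2r ?sqrtr_ge0//.
  exact: C2_const.
have risk_le : (\int[P]_w
      (`| Fhat (fun E => Y E w) (thetahat w)
            (hhat K Q r eps (fun E => Y E w) (thetahat w))
          - f (dotp x theta0) | `^ r)%:E <= (G `^ r + 2 * Bd `^ r)%:E)%E.
  apply: (@le_trans _ _ (\int[P]_w ((G `^ r)%:E + (Bd `^ r)%:E * V w))%E).
    (* The risk integrand stands on the smaller side, where only nonnegativity is asked of it. *)
    apply: ge0_le_integral_ae.
    - by move=> w; rewrite lee_fin powR_ge0.
    - apply: emeasurable_funD; first exact: measurable_cst.
      by apply: emeasurable_funM => //; exact: measurable_cst.
    - by move=> w; rewrite adde_ge0 ?mule_ge0 ?lee_fin ?powR_ge0.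
    apply: filterS2 hthetahat VP => w hsel hV.
    have := error_power_le hK heps hr heps_small hf htheta0 hD hsel hV (V0 w).
    exact.
  rewrite ge0_integralD//=; last first.
  - by apply: emeasurable_funM => //; exact: measurable_cst.
  - by move=> w _; rewrite mule_ge0 ?lee_fin ?powR_ge0.
  - by move=> w _; rewrite lee_fin powR_ge0.
  rewrite integral_cst// ge0_integralZl//; last by rewrite lee_fin powR_ge0.
  rewrite EFinD; apply: leeD.
    by rewrite -[leRHS]mule1 lee_wpmul2l ?lee_fin ?powR_ge0 ?(probability_le1 P measurableT).
  by rewrite mulrC EFinM lee_wpmul2l ?lee_fin ?powR_ge0.
apply: (@le_trans _ _ ((G `^ r + 2 * Bd `^ r)%:E `^ r^-1)%E).
  apply: gt0_ler_poweR => //; rewrite ?invr_ge0 ?(ltW r0)//.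
    by rewrite in_itv/= leey andbT integral_ge0// => w _; rewrite lee_fin powR_ge0.
  by rewrite in_itv/= leey andbT lee_fin addr_ge0 ?powR_ge0// mulr_ge0 ?powR_ge0.
rewrite poweR_EFin lee_fin; apply: le_trans (powR_root_le G0 Bd0 hr) _.
rewrite lerD2l /C2 -!mulrA ler_wpM2l ?powR_ge0//.
by apply: le_trans Bd_le _; rewrite -!mulrA.
Qed.
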